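(* Let $0<H<1$ and let $(W_t;t\in\mathbb{R})$ be a fractional Brownian motion with parameter $H$; for $-\infty\le s\le t\le+\infty$, denote by $\mathcal{F}_t^s$ the $\sigma$-algebra generated by the increments $W_v-W_u$, $s<u\le v<t$. Let $q>1$. There exist $\varepsilon>0$ and $C>0$, depending only on $q$ and $H$, such that the following holds. Let $t_0<t_1<t_2$ be real numbers, let $F$ and $G$ be real random variables in $L^q$ which are respectively measurable with respect to $\mathcal{F}_{t_0}^{-\infty}$ and $\mathcal{F}_{t_2}^{t_1}$, and let $$R(t_0,t_1,t_2):=\Bigl(\frac{t_2-t_1}{t_1-t_0}\Bigr)^{1-H}.$$ If $R(t_0,t_1,t_2)\le\varepsilon$, then the product $FG$ is integrable and $$\bigl|\mathbb{E}[FG]-\mathbb{E}[F]\,\mathbb{E}[G]\bigr|\le C\,\|F\|_q\,\|G\|_q\,R(t_0,t_1,t_2),$$ where $\|\cdot\|_q$ is the norm of $L^q$.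
   Context: Fractional Brownian motion with parameter $H$: centered Gaussian process with covariance $\operatorname{cov}(W_s,W_t)=\frac{\sigma^2}{2}(|s|^{2H}+|t|^{2H}-|t-s|^{2H})$, for a coefficient $\sigma^2>0$. *)

(* Defs.v *)
From HB Require Import structures.
From mathcomp Require Import all_boot all_order all_algebra.
From mathcomp Require Import all_classical all_reals all_analysis.

Set Implicit Arguments.
Unset Strict Implicit.
Unset Printing Implicit Defensive.

Import Order.TTheory GRing.Theory Num.Theory.
Import numFieldNormedType.Exports.

Local Open Scope classical_set_scope.
Local Open Scope ring_scope.

(* The case s = 0 is singled out because the library's [normal_prob m 0] is, by
   convention, the uniform law on [0, 1] rather than the point mass at m. *)
Definition gaussian_law (R : realType) (m s : R) : set R -> \bar R :=
  fun A => if s == 0 then \d_m A else normal_prob m s A.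

Definition is_gaussian (d : measure_display) (T : measurableType d)
    (R : realType) (P : probability T R) (X : T -> R) : Prop :=
  measurable_fun setT X /\
  exists m s : R, 0 <= s /\
    forall A : set R, measurable A -> pushforward P X A = gaussian_law m s A.

(* The linear combinations may be degenerate, that is, almost surely constant. *)
Definition gaussian_process (d : measure_display) (T : measurableType d)
    (R : realType) (P : probability T R) (W : R -> {RV P >-> R}) : Prop :=
  forall (n : nat) (a t : 'I_n -> R),
    is_gaussian P (fun w => \sum_(i < n) a i * W (t i) w).

Definition is_fbm (d : measure_display) (T : measurableType d)
    (R : realType) (P : probability T R) (H : R) (W : R -> {RV P >-> R}) : Prop :=
  [/\ gaussian_process W,
      forall t, ('E_P[W t] = 0)%E &
      exists2 sigma2 : R, 0 < sigma2 &
        forall s t, covariance P (W s) (W t) =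
          (sigma2 / 2 *
            (`|s| `^ (2 * H) + `|t| `^ (2 * H) - `|t - s| `^ (2 * H)))%:E].

(* The sigma-algebra usually written F_t^s: s is the lower endpoint, t the upper
   one, and either may be infinite.  It is not completed by null sets. *)
Definition increments_sigma (d : measure_display) (T : measurableType d)
    (R : realType) (P : probability T R) (W : R -> {RV P >-> R})
    (s t : \bar R) : set (set T) :=
  <<s [set A | exists u v : R,
        [/\ (s < u%:E)%E, u <= v, (v%:E < t)%E &
            preimage_set_system setT (W v \- W u) measurable A]] >>.

(* Meant for a sigma-algebra S, in which case the measurable sets of
   [g_sigma_algebraType S], namely <<s S >>, are exactly the members of S. *)
Definition measurable_wrt (T : pointedType) (R : realType) (S : set (set T))
    (F : T -> R) : Prop :=
  measurable_fun [set: g_sigma_algebraType S] (F : g_sigma_algebraType S -> R).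

Definition gap_ratio (R : realType) (H t0 t1 t2 : R) : R :=
  ((t2 - t1) / (t1 - t0)) `^ (1 - H).

(* Main.v *)
(* Realize the increments of W as stochastic integrals of Mandelbrot-Van Ness
   kernels.  If Y is a combination of increments after t1, its kernel before t0 is
   governed, by Taylor's formula at t1, by moments of Y that are recovered from the
   kernel on all of the line through the Beta integral; hence the correlation of X
   in the past with Y in the future is at most rho = C R(t0, t1, t2).

   By Mehler's formula, for exponentials of Gaussian variables,
   E[e^X e^Y] - E[e^X] E[e^Y] is a power series in the covariance of X and Y
   without constant term.  Schur's product theorem bounds each term, so for
   combinations f, g of exponentials
   2 |Cov (f, g)| <= (rho / d^2) (|P_d f|_2^2 + |P_d g|_2^2) when rho <= d^2, where
   P_d is the Ornstein-Uhlenbeck semigroup scaling Gaussian variables by d.  For d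
   small, P_d maps L^r into L^2 (Nelson; obtained from Bonami's inequality on the
   cube by the central limit theorem, and by duality).

   Exponentials are dense: their closure contains sines, hence signs and
   indicators of half-lines, and is stable under products and bounded limits.
   Homogeneity and truncation give the bound for F and G in L^q. *)
Require Import Defs.
From HB Require Import structures.
From mathcomp Require Import all_boot all_order all_algebra.
From mathcomp Require Import all_classical all_reals all_analysis.
From mathcomp Require Import measurable_realfun ring lra.

Set Implicit Arguments.
Unset Strict Implicit.
Unset Printing Implicit Defensive.

Import Order.TTheory GRing.Theory Num.Theory.
Import numFieldNormedType.Exports.

Local Open Scope classical_set_scope.
Local Open Scope ring_scope.

(** * Integrals over the line *)

Section lebesgue_affine.
Context {R : realType}.
Local Notation mu := (@lebesgue_measure R).

Lemma lebesgue_measure_affine (l c : R) (A : set R) : 0 < l -> measurable A ->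
  mu ((fun x => l * x + c) @^-1` A) = (l^-1%:E * mu A)%E.
Proof.
move=> l0 mA.
have mf : measurable_fun setT (fun x : measurableTypeR R => l * x + c : measurableTypeR R).
  by apply: measurable_funD => //; exact: measurable_funM.
pose l' : {nonneg R} := NngNum (ltW l0).
pose f := fun x : measurableTypeR R => l * x + c : measurableTypeR R.
have [nu nuE] : exists nu : {measure set (measurableTypeR R) -> \bar R},
    forall B, nu B = (l%:E * mu (f @^-1` B))%E.
  by unshelve eexists (mscale l' (pushforward mu f)); first exact: mf.
have E : mu A = nu A.
  apply: lebesgue_measure_unique => // _ [[a b]] _ <-.
  rewrite nuE.
  rewrite (_ : f @^-1` _ = `](a - c) / l, (b - c) / l]%classic); last first.
    apply/seteqP; split => x /=; rewrite !in_itv/= ltr_pdivrMr// ler_pdivlMr//;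
      by rewrite ltrBlDr lerBrDr (mulrC x).
  rewrite !lebesgue_measure_itv/= !lte_fin ltr_pM2r ?invr_gt0// ltrD2r.
  case: ifPn => _; last by rewrite mule0.
  by rewrite -!EFinB -EFinM; congr EFin; field; rewrite gt_eqF.
rewrite E nuE muleA -EFinM mulVf ?mul1e// gt_eqF//.
Qed.

Lemma ge0_integral_affine (l c : R) (f : R -> \bar R) : 0 < l ->
  measurable_fun setT f -> (forall x, 0 <= f x)%E ->
  (\int[mu]_x f (l * x + c)%R = l^-1%:E * \int[mu]_x f x)%E.
Proof.
move=> l0 mf f0.
pose g := fun x : measurableTypeR R => l * x + c : measurableTypeR R.
have mg : measurable_fun setT g.
  by apply: measurable_funD => //; exact: measurable_funM.
have l'0 : 0 <= l^-1 by rewrite invr_ge0 ltW.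
pose l' : {nonneg R} := NngNum l'0.
transitivity (\int[pushforward mu g]_x f x)%E.
  by rewrite (ge0_integral_pushforward mg)// preimage_setT.
transitivity (\int[mscale l' mu]_x f x)%E; last first.
  by rewrite ge0_integral_mscale.
by apply: eq_measure_integral => A mA _; exact: lebesgue_measure_affine.
Qed.

Lemma ge0_integralN (f : R -> \bar R) :
  measurable_fun setT f -> (forall x, 0 <= f x)%E ->
  (\int[mu]_x f (- x)%R = \int[mu]_x f x)%E.
Proof.
move=> mf f0.
have mg : measurable_fun setT (fun x : measurableTypeR R => - x : measurableTypeR R).
  exact: measurable_funN.
transitivity (\int[pushforward mu (-%R : _ -> measurableTypeR R)]_x f x)%E.
  by rewrite (ge0_integral_pushforward mg)// preimage_setT.
by apply: eq_measure_integral => A mA _; exact: lebesgue_measureN.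
Qed.

End lebesgue_affine.

Section square_integrable.
Context d (T : measurableType d) (R : realType) (m : {measure set T -> \bar R}).
Implicit Types f g : T -> R.

Definition rintegrable f := m.-integrable setT (EFin \o f).

Lemma rintegrable_measurable f : rintegrable f -> measurable_fun setT f.
Proof. by move=> /integrableP[/measurable_EFinP]. Qed.

Lemma rintegrableD f g : rintegrable f -> rintegrable g -> rintegrable (f \+ g).
Proof.
move=> If Ig; have := integrableD measurableT If Ig.
by apply: eq_integrable => // x _.
Qed.

Lemma rintegrableZ c f : rintegrable f -> rintegrable (fun x => c * f x).
Proof.
move=> If; have := integrableZl measurableT c If.
by apply: eq_integrable => // x _.
Qed.

Lemma rintegrableB f g : rintegrable f -> rintegrable g ->
  rintegrable (fun x => f x - g x).
Proof.
move=> If Ig; have := integrableB measurableT If Ig.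
by apply: eq_integrable => // x _.
Qed.

Lemma rintegrable0 : rintegrable (fun=> 0).
Proof. by have := integrable0 m setT; apply: eq_integrable. Qed.

Lemma rintegrable_sum (I : Type) (s : seq I) (F : I -> T -> R) :
  (forall i, rintegrable (F i)) -> rintegrable (fun x => \sum_(i <- s) F i x).
Proof.
move=> IF; elim: s => [|i s IH].
  by under [X in rintegrable X]eq_fun do rewrite big_nil; exact: rintegrable0.
under [X in rintegrable X]eq_fun do rewrite big_cons.
exact: rintegrableD.
Qed.

Lemma le_rintegrable f g : measurable_fun setT f -> (forall x, `|f x| <= g x) ->
  rintegrable g -> rintegrable f.
Proof.
move=> mf fg; apply: le_integrable => //; first exact/measurable_EFinP.
move=> x _ /=; rewrite lee_fin.
by rewrite [`|g x|]ger0_norm// (le_trans _ (fg x)).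
Qed.

Lemma ge0_rintegrable f : measurable_fun setT f -> (forall x, 0 <= f x) ->
  (\int[m]_x (f x)%:E < +oo)%E -> rintegrable f.
Proof.
move=> mf f0 foo; apply/integrableP; split; first exact/measurable_EFinP.
by under eq_integral do rewrite /= ger0_norm//.
Qed.

Lemma integral_EFin_fine f : rintegrable f ->
  (\int[m]_x (f x)%:E)%E = (\int[m]_x f x)%:E.
Proof. by move=> If; rewrite fineK// integrable_fin_num. Qed.

Lemma rintegralD f g : rintegrable f -> rintegrable g ->
  \int[m]_x (f x + g x) = \int[m]_x f x + \int[m]_x g x.
Proof. by move=> If Ig; rewrite RintegralD. Qed.

Lemma rintegralB f g : rintegrable f -> rintegrable g ->
  \int[m]_x (f x - g x) = \int[m]_x f x - \int[m]_x g x.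
Proof. by move=> If Ig; rewrite RintegralB. Qed.

Lemma rintegralZ c f : rintegrable f ->
  \int[m]_x (c * f x) = c * \int[m]_x f x.
Proof. by move=> If; rewrite RintegralZl. Qed.

Lemma rintegral_sum (I : Type) (s : seq I) (F : I -> T -> R) :
  (forall i, rintegrable (F i)) ->
  \int[m]_x (\sum_(i <- s) F i x) = \sum_(i <- s) \int[m]_x F i x.
Proof.
move=> IF; elim: s => [|i s IH].
  rewrite big_nil; under eq_Rintegral do rewrite big_nil.
  by rewrite /Rintegral integral0.
under eq_Rintegral do rewrite big_cons.
by rewrite big_cons rintegralD// ?IH//; exact: rintegrable_sum.
Qed.

Lemma rintegral_ge0 f : (forall x, 0 <= f x) -> 0 <= \int[m]_x f x.
Proof. by move=> f0; apply: Rintegral_ge0. Qed.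

Lemma le_rintegral f g : rintegrable f -> rintegrable g ->
  (forall x, f x <= g x) -> \int[m]_x f x <= \int[m]_x g x.
Proof. by move=> If Ig fg; apply: le_Rintegral. Qed.

Definition L2 f := measurable_fun setT f /\ rintegrable (fun x => f x ^+ 2).

Lemma L2M f g : L2 f -> L2 g -> rintegrable (fun x => f x * g x).
Proof.
move=> [mf If] [mg Ig]; apply: (le_rintegrable _ _ (rintegrableD If Ig)).
  exact: measurable_funM.
move=> x /=; rewrite ler_norml; apply/andP; split.
  by have := sqr_ge0 (f x + g x); nra.
by have := sqr_ge0 (f x - g x); nra.
Qed.

Lemma L2D f g : L2 f -> L2 g -> L2 (fun x => f x + g x).
Proof.
move=> Lf Lg; split; first by apply: measurable_funD; [case: Lf|case: Lg].
have [[_ If] [_ Ig]] := (Lf, Lg).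
have := rintegrableD (rintegrableD If (rintegrableZ 2 (L2M Lf Lg))) Ig.
by apply: eq_integrable => // x _ /=; congr EFin; ring.
Qed.

Lemma L2Z c f : L2 f -> L2 (fun x => c * f x).
Proof.
move=> [mf If]; split; first exact: measurable_funM.
have := rintegrableZ (c ^+ 2) If.
by apply: eq_integrable => // x _ /=; congr EFin; ring.
Qed.

Lemma L2B f g : L2 f -> L2 g -> L2 (fun x => f x - g x).
Proof.
move=> Lf Lg; have := L2D Lf (L2Z (-1) Lg).
by under [in X in X -> _]eq_fun do rewrite mulN1r.
Qed.

Lemma L2_sum (I : Type) (s : seq I) (F : I -> T -> R) :
  (forall i, L2 (F i)) -> L2 (fun x => \sum_(i <- s) F i x).
Proof.
move=> IF; elim: s => [|i s IH].
  under eq_fun do rewrite big_nil; split => //.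
  by under eq_fun do rewrite expr0n; exact: rintegrable0.
under [X in L2 X]eq_fun do rewrite big_cons.
exact: L2D.
Qed.

Lemma rintegral_sumM (I J : Type) (s : seq I) (s' : seq J) (c : I -> R) (c' : J -> R)
    (X : I -> T -> R) (Y : J -> T -> R) :
  (forall i, L2 (X i)) -> (forall j, L2 (Y j)) ->
  \int[m]_w ((\sum_(i <- s) c i * X i w) * (\sum_(j <- s') c' j * Y j w)) =
  \sum_(i <- s) \sum_(j <- s') c i * c' j * \int[m]_w (X i w * Y j w).
Proof.
move=> LX LY.
have I1 i j : rintegrable (fun w => c i * c' j * (X i w * Y j w)).
  by apply: rintegrableZ; exact: L2M.
transitivity (\int[m]_w \sum_(i <- s) \sum_(j <- s') c i * c' j * (X i w * Y j w)).
  apply: eq_Rintegral => w _; rewrite big_distrl/=; apply: eq_bigr => i _.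
  by rewrite big_distrr/=; apply: eq_bigr => j _; ring.
rewrite rintegral_sum => [|i]; last exact: rintegrable_sum.
apply: eq_bigr => i _; rewrite rintegral_sum//; apply: eq_bigr => j _.
by rewrite rintegralZ//; exact: L2M.
Qed.

(* The discriminant of [t |-> \int (t f + g)^2] is nonpositive. *)
Lemma cauchy_schwarz_sqr f g : L2 f -> L2 g ->
  (\int[m]_x (f x * g x)) ^+ 2 <=
  (\int[m]_x (f x ^+ 2)) * (\int[m]_x (g x ^+ 2)).
Proof.
move=> Lf Lg; have [[_ If] [_ Ig]] := (Lf, Lg); have Ifg := L2M Lf Lg.
set a := \int[m]_x (f x ^+ 2); set b := \int[m]_x (g x ^+ 2).
set c := \int[m]_x (f x * g x).
have quad s t : 0 <= s ^+ 2 * a + (2 * (s * t)) * c + t ^+ 2 * b.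
  have I1 := rintegrableZ (s ^+ 2) If; have I2 := rintegrableZ (2 * (s * t)) Ifg.
  have I3 := rintegrableZ (t ^+ 2) Ig.
  rewrite -!rintegralZ// -rintegralD// -rintegralD//; last exact: rintegrableD.
  apply: rintegral_ge0 => x.
  have := sqr_ge0 (s * f x + t * g x); set L := (X in 0 <= X -> _).
  by congr (0 <= _); rewrite /L; ring.
have a0 : 0 <= a by apply: rintegral_ge0 => x; exact: sqr_ge0.
have b0 : 0 <= b by apply: rintegral_ge0 => x; exact: sqr_ge0.
have [a_eq0|a_neq0] := eqVneq a 0.
  have [->|c0] := eqVneq c 0; first by rewrite expr0n mulr_ge0.
  have := quad (- (b + 1) / (2 * c)) 1; rewrite a_eq0.
  rewrite (_ : _ + _ = -1); last by field.
  by rewrite ler0N1.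
have := quad (- c) a; rewrite (_ : _ + _ = a * (a * b - c ^+ 2)); last by ring.
by rewrite pmulr_rge0 ?subr_ge0// lt_def a_neq0.
Qed.

Lemma cauchy_schwarz_norm f g : L2 f -> L2 g ->
  `|\int[m]_x (f x * g x)| <=
  Num.sqrt (\int[m]_x (f x ^+ 2)) * Num.sqrt (\int[m]_x (g x ^+ 2)).
Proof.
move=> Lf Lg; rewrite -sqrtrM; last first.
  by apply: rintegral_ge0 => x; exact: sqr_ge0.
by rewrite -sqrtr_sqr ler_wsqrtr// cauchy_schwarz_sqr.
Qed.

End square_integrable.

Section truncated_power.
Context {R : realType}.
Local Notation mu := (@lebesgue_measure R).
Implicit Types a b x y : R.

Lemma gt0_powRD x a b : 0 < x -> x `^ (a + b) = x `^ a * x `^ b.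
Proof. by move=> x0; rewrite powRD// (gt_eqF x0) implybT. Qed.

Definition powp a x : R := if 0 < x then x `^ a else 0.

Lemma powp_ge0 a x : 0 <= powp a x.
Proof. by rewrite /powp; case: ifP => // _; exact: powR_ge0. Qed.

Lemma powp_pos a x : 0 < x -> powp a x = x `^ a.
Proof. by rewrite /powp => ->. Qed.

Lemma powp_neg a x : x <= 0 -> powp a x = 0.
Proof. by rewrite /powp leNgt => /negbTE ->. Qed.

Lemma powpM a l x : 0 < l -> powp a (l * x) = l `^ a * powp a x.
Proof.
move=> l0; rewrite /powp pmulr_rgt0//; case: ifPn => [x0|_]; last by rewrite mulr0.
by rewrite powRM// ltW.
Qed.

Lemma powpD a b x : powp a x * powp b x = powp (a + b) x.
Proof.
rewrite /powp; case: ifPn => [x0|_]; last by rewrite mulr0.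
by rewrite gt0_powRD.
Qed.

Lemma sqr_powp a x : powp a x ^+ 2 = powp (2 * a) x.
Proof. by rewrite expr2 powpD mulr_natl. Qed.

Lemma measurable_powp a : measurable_fun setT (powp a).
Proof.
rewrite /powp; apply: measurable_fun_ifT => //.
exact: measurable_fun_ltr.
Qed.

Let dyad x : R := (2^-1 < x <= 1)%R%:R.

Let measurable_dyad : measurable_fun setT dyad.
Proof.
rewrite /dyad.
have -> : (fun x => (2^-1 < x <= 1)%R%:R) = \1_(`]2^-1, 1]) :> (R -> R).
  by apply/funext => x; rewrite indicE mem_setE in_itv.
exact: measurable_indic.
Qed.

Let measurable_powp_dyad a : measurable_fun setT (fun x => powp a x * dyad x).
Proof. by apply: measurable_funM => //; exact: measurable_powp. Qed.

Let integral_powp_dyad a : (\int[mu]_x (powp a x * dyad x)%:E < +oo)%E.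
Proof.
apply: (@le_lt_trans _ _ (\int[mu]_x (2 `^ `|a| * dyad x)%:E)%E).
  apply: ge0_le_integral => //.
  - by move=> x _; rewrite lee_fin mulr_ge0 ?powp_ge0.
  - by apply/measurable_EFinP; exact: measurable_powp_dyad.
  - by apply/measurable_EFinP; exact: measurable_funM.
  - move=> x _; rewrite lee_fin /dyad; case: (boolP (_ < _ <= _)) => [|_]; last by rewrite !mulr0.
    move=> /andP[x2 x1]; have x0 : 0 < x by apply: lt_trans x2; lra.
    rewrite !mulr1 powp_pos//.
    rewrite /powR gt_eqF// gt_eqF// ler_expR.
    have lnx : - ln 2 <= ln x by rewrite -lnV ?posrE// ler_ln ?posrE// ltW.
    have lnx0 : ln x <= 0 by rewrite ln_le0.
    have l2 : 0 <= ln 2 :> R by rewrite ln_ge0// ler1n.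
    have [a0|a0] := leP 0 a; first by rewrite ger0_norm//; nra.
    by rewrite ltr0_norm//; nra.
under eq_integral do rewrite EFinM.
rewrite ge0_integralZl_EFin ?powR_ge0//; last 2 first.
- by move=> x _; rewrite lee_fin.
- by apply/measurable_EFinP.
rewrite (_ : (fun x => (dyad x)%:E) = (fun x => (\1_(`]2^-1, 1]) x)%:E)); last first.
  by apply/funext => x; rewrite indicE mem_setE in_itv.
rewrite integral_indic// setIT /= lebesgue_measure_itv/= lte_fin.
by case: ifP => _; rewrite ?mule0 ?ltry// -EFinB -EFinM ltry.
Qed.

(* Summing over the dyadic scales [1/2 < l^k x <= 1] turns the integral into a
   geometric series. *)
Lemma integral_powp_lty a l (D : R -> bool) : 0 < l -> l `^ (- (a + 1)) < 1 ->
  measurable_fun setT (fun x => (D x)%:R : R) ->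
  (forall x, 0 < x -> D x -> exists k, 2^-1 < l ^+ k * x <= 1) ->
  (\int[mu]_x (powp a x * (D x)%:R)%:E < +oo)%E.
Proof.
move=> l0 r1 mD Dk; set r := l `^ (- (a + 1)) in r1.
pose u x := powp a x * dyad x.
pose t k x := (l ^+ k) `^ (- a) * u (l ^+ k * x).
have lk0 k : 0 < l ^+ k by rewrite exprn_gt0.
have u0 x : 0 <= u x by rewrite mulr_ge0 ?powp_ge0.
have t0 k x : 0 <= t k x by rewrite mulr_ge0 ?powR_ge0.
have mu_ : measurable_fun setT u by exact: measurable_powp_dyad.
have mul k : measurable_fun setT (fun x => u (l ^+ k * x)).
  by apply: (measurableT_comp mu_); exact: measurable_funM.
have mt k : measurable_fun setT (t k) by exact: (measurable_funM (measurable_cst _) (mul k)).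
have tE k x : t k x = powp a x * dyad (l ^+ k * x).
  rewrite /t /u powpM// !mulrA -gt0_powRD//.
  by rewrite addNr powRr0 mul1r.
pose K := (\int[mu]_x (u x)%:E)%E.
have K0 : (0 <= K)%E by apply: integral_ge0 => x _; rewrite lee_fin.
have Koo : K \is a fin_num by rewrite ge0_fin_numE//; exact: integral_powp_dyad.
have It k : (\int[mu]_x (t k x)%:E = (fine K * r ^+ k)%:E)%E.
  under eq_integral do rewrite EFinM.
  rewrite ge0_integralZl_EFin ?powR_ge0//; last 2 first.
  - by move=> x _; rewrite lee_fin.
  - by apply/measurable_EFinP; exact: mul.
  have -> : (\int[mu]_x (u (l ^+ k * x))%:E = (l ^+ k)^-1%:E * K)%E.
    rewrite -(@ge0_integral_affine R (l ^+ k) 0 (EFin \o u))//.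
      by apply: eq_integral => x _ /=; rewrite addr0.
    by apply/measurable_EFinP.
  rewrite -(fineK Koo) -!EFinM; congr EFin.
  rewrite mulrA mulrC; congr (_ * _).
  rewrite -powR_inv1 ?(ltW (lk0 k))// -gt0_powRD// -(powR_mulrn k (ltW l0)).
  rewrite -[RHS]powR_mulrn ?powR_ge0// -!powRrM.
  by congr (_ `^ _); ring.
apply: (@le_lt_trans _ _ (\int[mu]_x (\sum_(k <oo) (t k x)%:E))%E).
  apply: ge0_le_integral => //.
  - by move=> x _; rewrite lee_fin mulr_ge0 ?powp_ge0.
  - by apply/measurable_EFinP; apply: measurable_funM => //; exact: measurable_powp.
  - by apply: ge0_emeasurable_sum => // k *; [rewrite lee_fin|apply/measurable_EFinP; exact: mt].
  - move=> x _.
    have s0 : (0 <= \sum_(k <oo) (t k x)%:E)%E.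
      by apply: nneseries_ge0 => k _ _; rewrite lee_fin.
    have [x0|x0] := leP x 0; first by rewrite powp_neg// mul0r.
    have [Dx|] := boolP (D x); last by rewrite mulr0.
    have [k kP] := Dk _ x0 Dx.
    have -> : powp a x * true%:R = t k x by rewrite tE /dyad kP.
    apply: (@le_trans _ _ (\sum_(0 <= i < k.+1) (t i x)%:E)%E); last first.
      by apply: nneseries_lim_ge => i _ _; rewrite lee_fin.
    by rewrite big_nat_recr//= leeDr// sume_ge0// => i _; rewrite lee_fin.
rewrite integral_nneseries//; last 2 first.
- by move=> k; apply/measurable_EFinP; exact: mt.
- by move=> k x _; rewrite lee_fin.
under eq_eseriesr do rewrite It.
have r0 : 0 <= r by exact: powR_ge0.
apply: (@le_lt_trans _ _ (fine K / (1 - r))%:E); last exact: ltry.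
apply: lime_le.
  by apply: is_cvg_nneseries => k _ _; rewrite lee_fin mulr_ge0 ?fine_ge0 ?exprn_ge0.
apply: nearW => n; rewrite sumEFin lee_fin.
have := @geometric_le_lim R n (fine K) r (fine_ge0 K0) (powR_gt0 _ l0).
by rewrite ger0_norm// => /(_ r1).
Qed.

Lemma rintegrable_powp_unit a : -1 < a ->
  rintegrable mu (fun x => powp a x * (x <= 1)%R%:R).
Proof.
move=> a1.
have mD : measurable_fun setT (fun x => (x <= 1)%R%:R : R).
  have -> : (fun x => (x <= 1)%R%:R) = \1_(`]-oo, 1]) :> (R -> R).
    by apply/funext => x; rewrite indicE mem_setE in_itv.
  exact: measurable_indic.
apply: ge0_rintegrable.
- by apply: measurable_funM => //; exact: measurable_powp.
- by move=> x; rewrite mulr_ge0 ?powp_ge0.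
apply: (@integral_powp_lty a 2 (fun x => x <= 1)) => //.
  by rewrite /powR gt_eqF// -[ltRHS]expR0 ltr_expR nmulr_rlt0 ?ln_gt0 ?ltr1n//; lra.
move=> x x0 x1.
have ex : exists k, 2^-1 < 2 ^+ k * x.
  have [n nP] : exists n : nat, x^-1 < n%:R.
    by exists (Num.bound x^-1); apply: archi_boundP; rewrite invr_ge0 ltW.
  exists n; apply: (@lt_le_trans _ _ (n%:R * x)).
    by move: nP; rewrite -(ltr_pM2r x0) mulVf ?gt_eqF//; lra.
  by rewrite ler_wpM2r ?(ltW x0)// -natrX ler_nat ltnW// ltn_expl.
case: (ex_minnP ex) => k k2 kmin; exists k; rewrite k2/=.
case: k k2 kmin => [|k] _ kmin; first by rewrite mul1r.
rewrite leNgt; apply/negP; rewrite exprS -mulrA => k1.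
have /kmin : 2^-1 < 2 ^+ k * x by move: (2 ^+ k * x) k1 => y; lra.
by rewrite ltnn.
Qed.

Lemma rintegrable_powp_infty a : a < -1 ->
  rintegrable mu (fun x => powp a x * (2^-1 < x)%R%:R).
Proof.
move=> a1.
have mD : measurable_fun setT (fun x => (2^-1 < x)%R%:R : R).
  have -> : (fun x => (2^-1 < x)%R%:R) = \1_(`]2^-1, +oo[) :> (R -> R).
    by apply/funext => x; rewrite indicE mem_setE in_itv/= andbT.
  exact: measurable_indic.
apply: ge0_rintegrable.
- by apply: measurable_funM => //; exact: measurable_powp.
- by move=> x; rewrite mulr_ge0 ?powp_ge0.
apply: (@integral_powp_lty a 2^-1 (fun x => 2^-1 < x)) => //.
  rewrite /powR gt_eqF// -[ltRHS]expR0 ltr_expR lnV ?posrE// mulrN -mulNr.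
  by rewrite nmulr_rlt0 ?ln_gt0 ?ltr1n//; lra.
move=> x x0 x1.
have ex : exists k, 2^-1 ^+ k * x <= 1.
  have [n nP] : exists n : nat, x < n%:R.
    by exists (Num.bound x); apply: archi_boundP; rewrite ltW.
  exists n; rewrite exprVn mulrC ler_pdivrMr ?exprn_gt0// mul1r.
  by rewrite (le_trans (ltW nP))// -natrX ler_nat ltnW// ltn_expl.
case: (ex_minnP ex) => k k2 kmin; exists k; rewrite k2 andbT.
case: k k2 kmin => [|k] _ kmin; first by rewrite mul1r.
rewrite ltNge; apply/negP; rewrite exprS -mulrA => k1.
have /kmin : 2^-1 ^+ k * x <= 1 by move: (2^-1 ^+ k * x) k1 => y; lra.
by rewrite ltnn.
Qed.

End truncated_power.

Section ge0_change_of_variable.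
Context {R : realType}.
Local Notation mu := (@lebesgue_measure R).
Implicit Types f : R -> R.

Lemma ge0_rintegral_affine l c f : 0 < l -> (forall x, 0 <= f x) ->
  rintegrable mu f -> rintegrable mu (fun x => f (l * x + c)) /\
  \int[mu]_x f (l * x + c) = l^-1 * \int[mu]_x f x.
Proof.
move=> l0 f0 If; have mf := rintegrable_measurable If.
have mf' : measurable_fun setT (EFin \o f) by apply/measurable_EFinP.
have E := ge0_integral_affine c l0 mf' (fun x => f0 x).
have Ifl : rintegrable mu (fun x => f (l * x + c)).
  apply: ge0_rintegrable => //.
    apply: (measurableT_comp mf).
    by apply: measurable_funD => //; exact: measurable_funM.
  by rewrite [X in (X < _)%E]E [X in (_ * X)%E]integral_EFin_fine// -EFinM ltry.
split=> //; apply: EFin_inj; rewrite EFinM -!integral_EFin_fine//.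
Qed.

Lemma ge0_rintegralN f : (forall x, 0 <= f x) ->
  rintegrable mu f -> rintegrable mu (fun x => f (- x)) /\
  \int[mu]_x f (- x) = \int[mu]_x f x.
Proof.
move=> f0 If; have mf := rintegrable_measurable If.
have mf' : measurable_fun setT (EFin \o f) by apply/measurable_EFinP.
have E := ge0_integralN mf' (fun x => f0 x).
have Ifl : rintegrable mu (fun x => f (- x)).
  apply: ge0_rintegrable => //; first exact: (measurableT_comp mf).
  by rewrite [X in (X < _)%E]E [X in (X < _)%E]integral_EFin_fine// ltry.
by split=> //; apply: EFin_inj; rewrite -!integral_EFin_fine.
Qed.

Lemma ge0_rintegral_affineN l c f : 0 < l -> (forall x, 0 <= f x) ->
  rintegrable mu f -> rintegrable mu (fun x => f (c - l * x)) /\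
  \int[mu]_x f (c - l * x) = l^-1 * \int[mu]_x f x.
Proof.
move=> l0 f0 If; have [I1 E1] := ge0_rintegral_affine c l0 f0 If.
have [I2 E2] := ge0_rintegralN (fun x => f0 (l * x + c)) I1.
have E : (fun x => f (c - l * x)) = (fun x => f (l * (- x) + c)).
  by apply/funext => x; rewrite mulrN addrC.
by rewrite E E2 E1.
Qed.

Lemma rintegral_gt0 f p q e : p < q -> 0 < e -> (forall x, 0 <= f x) ->
  (forall x, p <= x <= q -> e <= f x) -> rintegrable mu f ->
  0 < \int[mu]_x f x.
Proof.
move=> pq e0 f0 fe If.
have I1 : rintegrable mu (fun x => e * \1_(`[p, q]) x).
  apply: rintegrableZ; rewrite /rintegrable.
  exact: integrable_indic_itv.
have -> : 0 < \int[mu]_x f x = (0%:E < (\int[mu]_x f x)%:E)%E by rewrite lte_fin.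
rewrite -integral_EFin_fine//.
apply: (@lt_le_trans _ _ (\int[mu]_x (e * \1_(`[p, q]) x)%:E)%E).
  under eq_integral do rewrite EFinM.
  rewrite ge0_integralZl_EFin ?ltW//; last first.
    by apply/measurable_EFinP; exact: measurable_indic.
  rewrite integral_indic// setIT/= lebesgue_measure_itv/= lte_fin pq.
  by rewrite -EFinB -EFinM lte_fin mulr_gt0// subr_gt0.
apply: ge0_le_integral => //.
- by move=> x _; rewrite lee_fin mulr_ge0// ltW.
- by apply/measurable_EFinP; exact: (rintegrable_measurable I1).
- by apply/measurable_EFinP; exact: (rintegrable_measurable If).
move=> x _; rewrite lee_fin indicE mem_setE in_itv/=.
by case: (boolP (_ <= _ <= _)) => [/fe|_]; rewrite ?mulr1 ?mulr0.
Qed.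

End ge0_change_of_variable.

(** * The moving-average kernel and its decorrelation *)

Section fractional_kernel.
Context {R : realType}.
Local Notation mu := (@lebesgue_measure R).
Implicit Types (a b x y : R).

Lemma nonincr_powR b x y : b <= 0 -> 0 < x -> x <= y -> y `^ b <= x `^ b.
Proof.
move=> b0 x0 xy; have y0 : 0 < y by exact: lt_le_trans xy.
rewrite /powR !gt_eqF// ler_expR.
have : ln x <= ln y by rewrite ler_ln.
by nra.
Qed.

Lemma powR_increment_bound b x : b < 1 -> 0 < x ->
  `|(x + 1) `^ b - x `^ b| <= `|b| * x `^ (b - 1).
Proof.
move=> b1 x0; have x1 : x < x + 1 by lra.
have [||c] := @MVT R (@powR R ^~ b) (fun y => b * y `^ (b - 1)) x (x + 1) x1.
- move=> y; rewrite in_itv/= => /andP[xy _]; apply: is_derive1_powR.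
  exact: lt_trans xy.
- apply: derivable_within_continuous => y; rewrite in_itv/= => /andP[xy _].
  by apply: ex_derive; apply: is_derive1_powR; lra.
rewrite in_itv/= => /andP[xc _] ->.
rewrite (_ : x + 1 - x = 1); last by ring.
rewrite mulr1 normrM ler_wpM2l// ger0_norm ?powR_ge0//.
by apply: nonincr_powR => //; [lra|exact: ltW].
Qed.

Variable a : R.
Hypotheses (a_gt : - 2^-1 < a) (a_lt : a < 2^-1).

Definition mvn_base x := powp a (x + 1) - powp a x.

Lemma L2_mvn_base : L2 mu mvn_base.
Proof.
have [ha1 ha2] := conj a_gt a_lt.
have a2 : -1 < 2 * a by lra.
have a3 : 2 * a - 2 < -1 by lra.
have a4 : 2 * a <= 1 by lra.
have a5 : a - 1 + (a - 1) = 2 * a - 2 by ring.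
have a6 : a < 1 by lra.
have a7 : `|a| <= 1 by rewrite ler_norml; lra.
have ms : measurable_fun setT (fun x : R => x + 1) by exact: measurable_funD.
have mb : measurable_fun setT mvn_base.
  apply: measurable_funB; last exact: measurable_powp.
  by apply: (measurableT_comp (measurable_powp a)).
split=> //.
pose q0 y := powp (2 * a) y * (y <= 1)%R%:R.
pose qi y := powp (2 * a - 2) y * (2^-1 < y)%R%:R.
have Iq0 : rintegrable mu q0 by exact: rintegrable_powp_unit.
have Iqi : rintegrable mu qi by exact: rintegrable_powp_infty.
have q00 y : 0 <= q0 y by rewrite mulr_ge0 ?powp_ge0.
have qi0 y : 0 <= qi y by rewrite mulr_ge0 ?powp_ge0.
have [Iq1 _] := ge0_rintegral_affine 1 ltr01 q00 Iq0.
have I1 : rintegrable mu (\1_(`[0, 1]) : R -> R) by exact: integrable_indic_itv.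
have := rintegrableD (rintegrableD (rintegrableD Iq1 (rintegrableZ 2 Iq0))
  (rintegrableZ 4 I1)) Iqi.
apply: le_rintegrable; first exact: measurable_funX.
move=> x /=; rewrite ger0_norm ?sqr_ge0// mul1r indicE mem_setE in_itv/=.
have ind0 (t : bool) : 0 <= t%:R :> R by [].
have [x1|x1] := leP x (-1).
  rewrite /mvn_base !powp_neg; [|lra|lra].
  by rewrite subrr expr0n/= !addr_ge0 ?q00 ?qi0// mulr_ge0 ?q00.
have [x2|x2] := leP x 0.
  rewrite /mvn_base (powp_neg a x2) subr0 sqr_powp -[leLHS]addr0 -addrA -addrA.
  rewrite lerD ?addr_ge0 ?qi0//; [|by rewrite mulr_ge0 ?q00..]; rewrite /q0.
  have x3 : x + 1 <= 1 by lra.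
  by rewrite x3 mulr1.
have [x3|x3] := leP x 1.
  rewrite (ltW x2) mulr1.
  have -> : q0 x = powp a x ^+ 2 by rewrite sqr_powp /q0 x3 mulr1.
  have : powp a (x + 1) ^+ 2 <= 2.
    rewrite sqr_powp powp_pos; last by lra.
    apply: (@le_trans _ _ ((x + 1) `^ 1)); last by rewrite powRr1; lra.
    by apply: ler_powR; lra.
  have := q00 (x + 1); have := qi0 x; have := sqr_ge0 (powp a (x + 1) + powp a x).
  rewrite /mvn_base; move: (powp a (x + 1)) (powp a x) => p q; nra.
rewrite (ltW x2)/= mulr0 addr0 /mvn_base !powp_pos//; last by lra.
have -> : qi x = (x `^ (a - 1)) ^+ 2.
  rewrite /qi powp_pos//; have x4 : 2^-1 < x by lra.
  by rewrite x4 mulr1 expr2 -gt0_powRD// a5.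
rewrite -[leLHS]add0r lerD ?addr_ge0 ?q00//; first by rewrite mulr_ge0 ?q00.
rewrite -real_normK ?num_real// lerXn2r ?nnegrE ?powR_ge0//.
apply: le_trans (powR_increment_bound a6 x2) _.
by rewrite ler_piMl ?powR_ge0.
Qed.

Definition fvar := \int[mu]_x (mvn_base x ^+ 2).

Lemma fvar_gt0 : 0 < fvar.
Proof.
have [ha1 ha2] := conj a_gt a_lt.
have [_ Ib] := L2_mvn_base.
apply: (@rintegral_gt0 _ _ (- 2^-1) 0 (2^-1)) => //; try lra.
- by move=> x; exact: sqr_ge0.
move=> x /andP[x1 x0]; rewrite /mvn_base (powp_neg a x0) subr0 sqr_powp powp_pos; last by lra.
apply: (@le_trans _ _ ((x + 1) `^ 1)); first by rewrite powRr1; lra.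
by apply: ger_powR; lra.
Qed.

(* The Mandelbrot-Van Ness kernel of an increment of fractional Brownian motion,
   with [a = H - 1/2]. *)
Definition fker u v x := powp a (v - x) - powp a (u - x).

Let fkerE u v x : u < v ->
  fker u v x ^+ 2 = (v - u) `^ (2 * a) * mvn_base (u / (v - u) - (v - u)^-1 * x) ^+ 2.
Proof.
move=> uv; have l0 : 0 < v - u by rewrite subr_gt0.
have -> : fker u v x = (v - u) `^ a * mvn_base (u / (v - u) - (v - u)^-1 * x).
  rewrite /mvn_base mulrBr -!powpM//; congr (powp a _ - powp a _).
    by field; rewrite gt_eqF.
  by field; rewrite gt_eqF.
by rewrite exprMn expr2 -gt0_powRD// mulr_natl.
Qed.

Lemma fker_sqr u v : u < v -> rintegrable mu (fun x => fker u v x ^+ 2) /\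
  \int[mu]_x (fker u v x ^+ 2) = fvar * (v - u) `^ (2 * a + 1).
Proof.
move=> uv; have l0 : 0 < v - u by rewrite subr_gt0.
have [_ Ib] := L2_mvn_base.
have l'0 : 0 < (v - u)^-1 by rewrite invr_gt0.
have [I1 E1] := ge0_rintegral_affineN (u / (v - u)) l'0 (fun x => sqr_ge0 (mvn_base x)) Ib.
have E : (fun x => fker u v x ^+ 2) =
   (fun x => (v - u) `^ (2 * a) * mvn_base (u / (v - u) - (v - u)^-1 * x) ^+ 2).
  by apply/funext => x; exact: fkerE.
rewrite E rintegralZ// E1 invrK; split; first exact: rintegrableZ.
rewrite gt0_powRD// powRr1 ?ltW// /fvar; ring.
Qed.

Lemma fkerN u v x : fker u v x = - fker v u x.
Proof. by rewrite /fker opprB. Qed.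

Lemma measurable_powp_rev b v : measurable_fun setT (fun x : R => powp b (v - x)).
Proof.
apply: (measurableT_comp (measurable_powp b)).
exact: measurable_funB.
Qed.

Lemma L2_fker u v : L2 mu (fker u v).
Proof.
split; first by apply: measurable_funB; exact: measurable_powp_rev.
have [uv|uv|->] := ltgtP u v; first by case: (fker_sqr uv).
  by under eq_fun do rewrite fkerN sqrrN; case: (fker_sqr uv).
by under eq_fun do rewrite /fker subrr expr0n; exact: rintegrable0.
Qed.

Lemma integral_fker_sqr u v :
  \int[mu]_x (fker u v x ^+ 2) = fvar * `|v - u| `^ (2 * a + 1).
Proof.
have [ha1 ha2] := conj a_gt a_lt.
have [uv|uv|->] := ltgtP u v.
- by have [_ ->] := fker_sqr uv; rewrite ger0_norm// subr_ge0 ltW.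
- under eq_Rintegral do rewrite fkerN sqrrN.
  by have [_ ->] := fker_sqr uv; rewrite distrC ger0_norm// subr_ge0 ltW.
- under eq_Rintegral do rewrite /fker subrr expr0n/=.
  rewrite subrr normr0 powR0 ?mulr0 ?/Rintegral ?integral0//.
  by rewrite gt_eqF//; lra.
Qed.

Lemma integral_fkerM u v u' v' :
  \int[mu]_x (fker u v x * fker u' v' x) = fvar / 2 *
   (`|v - u'| `^ (2 * a + 1) + `|v' - u| `^ (2 * a + 1)
    - `|v' - v| `^ (2 * a + 1) - `|u' - u| `^ (2 * a + 1)).
Proof.
have I p q : rintegrable mu (fun x => fker p q x ^+ 2) by case: (L2_fker p q).
transitivity (\int[mu]_x (2^-1 * (fker u' v x ^+ 2 + fker u v' x ^+ 2
   - (fker v v' x ^+ 2 + fker u u' x ^+ 2)))).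
  by apply: eq_Rintegral => x _; rewrite /fker; field.
have I1 := rintegrableD (I u' v) (I u v'); have I2 := rintegrableD (I v v') (I u u').
rewrite rintegralZ; last exact: rintegrableB.
rewrite rintegralB// !rintegralD// !integral_fker_sqr.
ring.
Qed.

End fractional_kernel.

Section beta_convolution.
Context {R : realType}.
Local Notation mu := (@lebesgue_measure R).
Variable a : R.
Hypotheses (a_gt : - 2^-1 < a) (a_lt : a < 2^-1).

Definition beta_fun x : R := powp a (1 - x) * powp (- a) x.

Definition beta_cst : R := \int[mu]_x beta_fun x.

Lemma beta_fun_ge0 x : 0 <= beta_fun x.
Proof. by rewrite mulr_ge0 ?powp_ge0. Qed.

Lemma powR_le2 b y : - 2^-1 < b -> 2^-1 <= y -> y <= 1 -> y `^ b <= 2 :> R.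
Proof.
move=> b0 y2 y1; have y0 : 0 < y by lra.
apply: (@le_trans _ _ (y `^ (-1))).
  by apply: ger_powR; [rewrite y0|lra].
rewrite powR_inv1 ?(ltW y0)// -[leRHS]invrK lef_pV2 ?posrE//; lra.
Qed.

Lemma rintegrable_beta_fun : rintegrable mu beta_fun.
Proof.
have [ha1 ha2] := conj a_gt a_lt.
have na : - 2^-1 < - a by lra.
have b1 : -1 < a by lra.
have b2 : -1 < - a by lra.
pose q b (y : R) := powp b y * (y <= 1)%R%:R.
have q0 b y : 0 <= q b y by rewrite mulr_ge0 ?powp_ge0.
have Iq1 : rintegrable mu (q (- a)) by exact: rintegrable_powp_unit.
have Iq2 : rintegrable mu (q a) by exact: rintegrable_powp_unit.
have [Iq3 _] := ge0_rintegral_affineN 1 ltr01 (q0 a) Iq2.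
have := rintegrableD (rintegrableZ 2 Iq1) (rintegrableZ 2 Iq3).
apply: le_rintegrable.
  by apply: measurable_funM; [exact: measurable_powp_rev|exact: measurable_powp].
move=> x /=; rewrite mul1r ger0_norm ?beta_fun_ge0// /beta_fun.
have [x0|x0] := leP x 0.
  by rewrite (powp_neg _ x0) mulr0 addr_ge0// mulr_ge0.
have [x1|x1] := leP 1 x.
  rewrite (@powp_neg _ a (1 - x)); last by lra.
  by rewrite mul0r addr_ge0// mulr_ge0.
have [x2|x2] := leP x 2^-1.
  rewrite -[leLHS]addr0 lerD ?(mulr_ge0 _ (q0 _ _))// /q (ltW x1) mulr1.
  rewrite ler_wpM2r ?powp_ge0// powp_pos; last by lra.
  by apply: powR_le2 => //; lra.
rewrite -[leLHS]add0r lerD ?(mulr_ge0 _ (q0 _ _))// /q.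
have x3 : 1 - x <= 1 by lra.
rewrite x3 mulr1 mulrC ler_wpM2r ?powp_ge0// powp_pos//.
by apply: powR_le2 => //; lra.
Qed.

Lemma beta_cst_gt0 : 0 < beta_cst.
Proof.
have [ha1 ha2] := conj a_gt a_lt.
apply: (@rintegral_gt0 _ _ (4^-1) (3 / 4) (16^-1)); [lra|lra|exact: beta_fun_ge0| |].
  move=> x /andP[x1 x2]; rewrite /beta_fun !powp_pos; [|lra|lra].
  have pw b y : b <= 1 -> 4^-1 <= y -> y <= 1 -> 4^-1 <= y `^ b :> R.
    move=> b1 y0 y1; apply: (le_trans y0); rewrite -[leLHS]powRr1; last by lra.
    by apply: ger_powR => //; lra.
  have p1 : 4^-1 <= (1 - x) `^ a by apply: pw; lra.
  have p2 : 4^-1 <= x `^ (- a) by apply: pw; lra.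
  by move: ((1 - x) `^ a) (x `^ (- a)) p1 p2 => y z; nra.
exact: rintegrable_beta_fun.
Qed.

Definition beta_conv_fun t r x : R := powp a (t - x) * powp (- a) (x - r).

Lemma beta_conv t r : rintegrable mu (beta_conv_fun t r) /\
  \int[mu]_x beta_conv_fun t r x = beta_cst * Num.max 0 (t - r).
Proof.
have [tr|rt] := leP t r.
  have -> : beta_conv_fun t r = fun=> 0.
    apply/funext => x; rewrite /beta_conv_fun.
    have [xr|rx] := leP x r; first by rewrite (@powp_neg _ _ (x - r)) ?subr_le0// mulr0.
    rewrite powp_neg ?mul0r// subr_le0 (le_trans tr)// ltW//.
  rewrite /Rintegral integral0 max_l ?subr_le0// mulr0.
  by split=> //; exact: rintegrable0.
have l0 : 0 < t - r by rewrite subr_gt0.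
have l'0 : 0 < (t - r)^-1 by rewrite invr_gt0.
have [I1 E1] := ge0_rintegral_affine (- (r / (t - r))) l'0 beta_fun_ge0 rintegrable_beta_fun.
have -> : beta_conv_fun t r = (fun x => beta_fun ((t - r)^-1 * x - r / (t - r))).
  apply/funext => x; rewrite /beta_conv_fun /beta_fun.
  rewrite (_ : 1 - _ = (t - r)^-1 * (t - x)); last by field; rewrite gt_eqF.
  rewrite (_ : _ - _ / _ = (t - r)^-1 * (x - r)); last by field; rewrite gt_eqF.
  rewrite !powpM// mulrACA -gt0_powRD// subrr powRr0 mul1r//.
split=> //; rewrite E1 invrK max_r ?ltW// /beta_cst; ring.
Qed.

End beta_convolution.

Section kernel_decorrelation.
Context {R : realType}.
Local Notation mu := (@lebesgue_measure R).
Variable a : R.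
Hypotheses (a_gt : - 2^-1 < a) (a_lt : a < 2^-1).

Definition taylor_fun (s t1 t2 t r : R) : R :=
  powp (a - 2) (r - s) * (Num.max 0 (t - r) * \1_(`[t1, t2]) r).

Let measurable_taylor_fun s t1 t2 t : measurable_fun setT (taylor_fun s t1 t2 t).
Proof.
apply: measurable_funM.
  by apply: (measurableT_comp (measurable_powp _)); exact: measurable_funB.
apply: measurable_funM; last exact: measurable_indic.
by apply: measurable_maxr => //; exact: measurable_funB.
Qed.

Lemma rintegrable_taylor_fun s t1 t2 t : s < t1 -> t <= t2 ->
  rintegrable mu (taylor_fun s t1 t2 t).
Proof.
move=> st1 tt2; have [ha1 ha2] := conj a_gt a_lt.
have a2 : a - 2 <= 0 by lra.
have I1 : rintegrable mu (\1_(`[t1, t2]) : R -> R) by exact: integrable_indic_itv.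
apply: le_rintegrable (rintegrableZ ((t1 - s) `^ (a - 2) * Num.max 0 (t2 - t1)) I1).
  exact: measurable_taylor_fun.
move=> r; rewrite /taylor_fun ger0_norm; last first.
  by rewrite mulr_ge0 ?powp_ge0// mulr_ge0// le_max lexx.
rewrite -mulrA indicE mem_setE in_itv/=.
case: (boolP (_ <= _ <= _)) => [/andP[t1r rt2]|_]; last by rewrite !mulr0.
rewrite !mulr1 ler_pM ?powp_ge0 ?le_max ?lexx//.
  by rewrite powp_pos ?nonincr_powR//; lra.
by rewrite !ge_max; apply/orP; right; apply/andP; split; lra.
Qed.

(* Taylor's formula with integral remainder for [r |-> (r - s) `^ a] at [t1]. *)
Lemma powR_taylor s t1 t2 t : s < t1 -> t1 <= t -> t <= t2 ->
  (t - s) `^ a = (t1 - s) `^ a + a * (t1 - s) `^ (a - 1) * (t - t1)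
    + a * (a - 1) * \int[mu]_r taylor_fun s t1 t2 t r.
Proof.
move=> st1; rewrite le_eqVlt => /predU1P[<- t12|t1t tt2].
  rewrite subrr mulr0 addr0.
  have -> : taylor_fun s t1 t2 t1 = fun=> 0.
    apply/funext => r; rewrite /taylor_fun indicE mem_setE in_itv/=.
    case: (boolP (_ <= _ <= _)) => [/andP[t1r _]|_]; last by rewrite !mulr0.
    by rewrite max_l ?mul0r ?mulr0// subr_le0.
  by rewrite /Rintegral integral0 mulr0 addr0.
pose h (r : R) := a * (a - 1) * ((r - s) `^ (a - 2) * (t - r)).
pose F (r : R) := a * (r - s) `^ (a - 1) * (t - r) + (r - s) `^ a.
have dpow b r : s < r -> is_derive r (1 : R) (fun r : R => (r - s) `^ b) (b * (r - s) `^ (b - 1)).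
  move=> sr; have rs : 0 < r - s by rewrite subr_gt0.
  have := @is_derive1_comp R (@powR R ^~ b) (fun r => r - s) r _ 1 (is_derive1_powR b rs).
  by rewrite mulr1; apply; rewrite -[X in is_derive _ _ _ X]subr0; exact: is_deriveB.
have dF r : s < r -> is_derive r (1 : R) F (h r).
  move=> sr.
  have D1 := dpow (a - 1) r sr; have D2 := dpow a r sr.
  have D3 : is_derive r (1 : R) (fun r : R => t - r) (-1).
    by rewrite -[X in is_derive _ _ _ X]sub0r; exact: is_deriveB.
  apply: is_derive_eq.
  rewrite /h /GRing.scale/= (_ : a - 1 - 1 = a - 2); last by ring.
  ring.
have ch : {within `[t1, t], continuous h}.
  apply: derivable_within_continuous => r; rewrite in_itv/= => /andP[t1r _].
  have sr : s < r by exact: lt_le_trans t1r.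
  have D1 := dpow (a - 2) r sr.
  by apply: derivableM => //; apply: derivableM => //; apply: ex_derive.
have cF r : s < r -> F x @[x --> r] --> F r.
  move=> sr; apply: differentiable_continuous; apply/derivable1_diffP.
  by have D := dF r sr; exact: ex_derive.
have FTC : (\int[mu]_(r in `[t1, t]) (h r)%:E = (F t)%:E - (F t1)%:E)%E.
  apply: continuous_FTC2 => //.
    split.
    - move=> r; rewrite in_itv/= => /andP[t1r _].
      by have D := dF r (lt_trans st1 t1r); exact: ex_derive.
    - by apply: cvg_at_right_filter; exact: cF.
    - by apply: cvg_at_left_filter; apply: cF; exact: lt_trans t1t.
  move=> r; rewrite in_itv/= => /andP[t1r _].
  have D := dF r (lt_trans st1 t1r).
  by rewrite derive1E derive_val.
have E : \int[mu]_r (a * (a - 1) * taylor_fun s t1 t2 t r) = F t - F t1.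
  transitivity (\int[mu]_(r in `[t1, t]) h r); last by rewrite /Rintegral FTC.
  rewrite [RHS]Rintegral_mkcond; apply: eq_Rintegral => r _.
  rewrite /patch mem_setE in_itv/= /taylor_fun indicE mem_setE in_itv/=.
  have [rt|tr] := leP r t; last first.
    by rewrite andbF max_l ?mul0r ?mulr0// subr_le0 ltW.
  rewrite (le_trans rt tt2) andbT; case: ifPn => [t1r|_]; last by rewrite !mulr0.
  rewrite mulr1 max_r ?subr_ge0// powp_pos ?subr_gt0//.
  exact: lt_le_trans t1r.
rewrite -rintegralZ; last exact: rintegrable_taylor_fun.
by rewrite E /F subrr mulr0 add0r; ring.
Qed.

End kernel_decorrelation.

Section kernel_decorrelation.
Context {R : realType}.
Local Notation mu := (@lebesgue_measure R).
Variable a : R.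
Hypotheses (a_gt : - 2^-1 < a) (a_lt : a < 2^-1).

Section kernel_sum.
Context {I : Type} (s : seq I) (c u v : I -> R).

Definition ksum x : R := \sum_(i <- s) c i * fker a (u i) (v i) x.

Definition ramp r : R :=
  \sum_(i <- s) c i * (Num.max 0 (v i - r) - Num.max 0 (u i - r)).

Lemma L2_ksum : L2 mu ksum.
Proof. by apply: L2_sum => i; apply: L2Z; exact: L2_fker. Qed.

Lemma ksum_eq0 T x : (forall i, u i <= T /\ v i <= T) -> T <= x -> ksum x = 0.
Proof.
move=> uvT Tx; rewrite /ksum big1// => i _; have [uT vT] := uvT i.
by rewrite /fker !powp_neg ?subrr ?mulr0// subr_le0; exact: le_trans Tx.
Qed.

(* Pairing with a power of exponent [-a] inverts the fractional kernel. *)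
Lemma ramp_bound t1 t2 r : (forall i, u i <= t2 /\ v i <= t2) ->
  t1 <= r -> r <= t2 -> t1 < t2 ->
  `|ramp r| <= (beta_cst a)^-1 *
    Num.sqrt (\int[mu]_x (powp (- (2 * a)) x * (x <= 1)%R%:R)) *
    (t2 - t1) `^ (2^-1 - a) * Num.sqrt (\int[mu]_x (ksum x ^+ 2)).
Proof.
have [ha1 ha2] := conj a_gt a_lt.
have a1 : 0 < 2^-1 - a by lra.
have a2 : -1 < - (2 * a) by lra.
have a3 : 2 * a + 1 - 1 = 2 * a by lra.
have B0 : 0 < beta_cst a by exact: beta_cst_gt0.
move=> uvt t1r; rewrite le_eqVlt => /predU1P[-> t12|rt2 t12].
  rewrite /ramp big1 ?normr0 ?mulr_ge0 ?invr_ge0 ?powR_ge0// ?ltW// => i _.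
  have [ui vi] := uvt i.
  by rewrite !max_l ?subr_le0// subrr mulr0.
pose q x := powp (- (2 * a)) x * (x <= 1)%R%:R.
have q0 x : 0 <= q x by rewrite mulr_ge0 ?powp_ge0.
have Iq : rintegrable mu q by exact: rintegrable_powp_unit.
pose w x := powp (- a) (x - r) * (x <= t2)%R%:R.
have l0 : 0 < t2 - r by rewrite subr_gt0.
have l'0 : 0 < (t2 - r)^-1 by rewrite invr_gt0.
have [Iq1 Eq1] := ge0_rintegral_affine (- (r / (t2 - r))) l'0 q0 Iq.
have wE x : w x ^+ 2 = (t2 - r) `^ (- (2 * a)) * q ((t2 - r)^-1 * x - r / (t2 - r)).
  rewrite /w /q exprMn sqr_powp.
  rewrite (_ : _ - _ / _ = (t2 - r)^-1 * (x - r)); last by field; rewrite gt_eqF.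
  rewrite powpM// mulrA mulrA -powR_inv1 ?(ltW l0)// -powRrM -gt0_powRD//.
  rewrite (_ : - (2 * a) + -1 * - (2 * a) = 0); last by ring.
  rewrite powRr0 mul1r powR_inv1 ?(ltW l0)// mulrN.
  congr (_ * _).
  rewrite mulrC ler_pdivrMr// mul1r lerD2r.
  by case: (x <= t2); rewrite ?expr1n ?expr0n.
have mw : measurable_fun setT w.
  apply: measurable_funM.
    by apply: (measurableT_comp (measurable_powp _)); exact: measurable_funB.
  have -> : (fun x => (x <= t2)%R%:R) = \1_(`]-oo, t2]) :> (R -> R).
    by apply/funext => x; rewrite indicE mem_setE in_itv.
  exact: measurable_indic.
have E2 : (fun x => w x ^+ 2) = (fun x => (t2 - r) `^ (- (2 * a)) *
     q ((t2 - r)^-1 * x - r / (t2 - r))) by apply/funext => x; exact: wE.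
have Lw : L2 mu w by split=> //; rewrite E2; exact: rintegrableZ.
have Ew : \int[mu]_x (w x ^+ 2) = (t2 - r) `^ (1 - 2 * a) * \int[mu]_x q x.
  rewrite E2 rintegralZ// Eq1 invrK mulrA; congr (_ * _).
  by rewrite gt0_powRD// powRr1 ?(ltW l0)// mulrC.
have Epair : \int[mu]_x (ksum x * w x) = beta_cst a * ramp r.
  transitivity (\int[mu]_x (\sum_(i <- s) c i *
      (beta_conv_fun a (v i) r x - beta_conv_fun a (u i) r x))).
    apply: eq_Rintegral => x _; rewrite /ksum big_distrl/=; apply: eq_bigr => i _.
    have [ui vi] := uvt i.
    rewrite -mulrA; congr (_ * _); rewrite /fker mulrBl /w /beta_conv_fun.
    have [xt|tx] := leP x t2; first by rewrite mulr1.
    by rewrite !(@powp_neg _ a) ?mul0r// subr_le0; apply/ltW/(le_lt_trans _ tx).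
  have Ibc t : rintegrable mu (beta_conv_fun a t r) by case: (beta_conv a_gt a_lt t r).
  rewrite rintegral_sum => [|i]; last by apply: rintegrableZ; exact: rintegrableB.
  rewrite /ramp big_distrr/=; apply: eq_bigr => i _.
  rewrite rintegralZ ?rintegralB//; last exact: rintegrableB.
  have [_ ->] := beta_conv a_gt a_lt (v i) r; have [_ ->] := beta_conv a_gt a_lt (u i) r.
  by ring.
have := cauchy_schwarz_norm L2_ksum Lw.
rewrite Epair normrM (gtr0_norm B0) Ew sqrtrM ?powR_ge0//.
have <- : (t2 - r) `^ (2^-1 - a) = Num.sqrt ((t2 - r) `^ (1 - 2 * a)).
  by rewrite -powR12_sqrt ?powR_ge0// -powRrM; congr (_ `^ _); field.
move=> CS; rewrite -mulrA -mulrA ler_pdivlMl//.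
apply: (le_trans CS); rewrite mulrC -mulrA mulrCA ler_wpM2l ?sqrtr_ge0//.
rewrite ler_wpM2r ?sqrtr_ge0// ge0_ler_powR ?nnegrE; lra.
Qed.

Lemma ksum_taylor t1 t2 x :
  (forall i, t1 <= u i <= t2 /\ t1 <= v i <= t2) -> x < t1 ->
  ksum x = a * (t1 - x) `^ (a - 1) * ramp t1 +
    a * (a - 1) * \int[mu]_r (powp (a - 2) (r - x) * (\1_(`[t1, t2]) r * ramp r)).
Proof.
move=> uvt xt1.
have It t : t <= t2 -> rintegrable mu (taylor_fun a x t1 t2 t).
  by move=> tt2; exact: rintegrable_taylor_fun.
have -> : \int[mu]_r (powp (a - 2) (r - x) * (\1_(`[t1, t2]) r * ramp r)) =
    \int[mu]_r (\sum_(i <- s) c i *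
      (taylor_fun a x t1 t2 (v i) r - taylor_fun a x t1 t2 (u i) r)).
  apply: eq_Rintegral => r _; rewrite /ramp mulrA big_distrr/=.
  by apply: eq_bigr => i _; rewrite /taylor_fun; ring.
have Iuv i : rintegrable mu (fun r => taylor_fun a x t1 t2 (v i) r - taylor_fun a x t1 t2 (u i) r).
  by have [/andP[_ ?] /andP[_ ?]] := uvt i; apply: rintegrableB; exact: It.
rewrite rintegral_sum => [|i]; last exact: rintegrableZ.
rewrite /ksum /ramp !big_distrr -big_split/=; apply: eq_bigr => i _.
have [/andP[u1 u2] /andP[v1 v2]] := uvt i.
rewrite rintegralZ// rintegralB; [|exact: It|exact: It].
rewrite /fker !powp_pos ?subr_gt0 ?(lt_le_trans xt1)//.
rewrite (@powR_taylor _ a a_gt a_lt x t1 t2 (u i))//.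
rewrite (@powR_taylor _ a a_gt a_lt x t1 t2 (v i))//.
rewrite !max_r ?subr_ge0//.
by ring.
Qed.

Lemma ksum_bound t1 t2 x K :
  (forall i, t1 <= u i <= t2 /\ t1 <= v i <= t2) -> t1 < t2 -> 
  t2 - t1 <= t1 - x -> (forall r, t1 <= r <= t2 -> `|ramp r| <= K) ->
  `|ksum x| <= 2 * K * (t1 - x) `^ (a - 1).
Proof.
have [ha1 ha2] := conj a_gt a_lt.
move=> uvt t12 t12x rK.
have xt1 : x < t1 by lra.
have K0 : 0 <= K by apply: (le_trans (normr_ge0 _) (rK t1 _)); lra.
have na : `|a| <= 2^-1 by rewrite ler_norml; lra.
have na1 : `|a - 1| <= 2 by rewrite ler_norml; lra.
have a20 : a - 2 <= 0 by lra.
have t1x0 : 0 < t1 - x by rewrite subr_gt0.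
pose g r := powp (a - 2) (r - x) * (\1_(`[t1, t2]) r * ramp r).
have gb r : `|g r| <= (t1 - x) `^ (a - 2) * K * \1_(`[t1, t2]) r.
  rewrite /g indicE mem_setE in_itv/=.
  case: (boolP (_ <= _ <= _)) => [t1rt2|_]; last by rewrite mul0r !mulr0 normr0.
  rewrite mulr1 mul1r normrM ger0_norm ?powp_ge0// ler_pM ?powp_ge0 ?rK//.
  move/andP: t1rt2 => [t1r _].
  by rewrite powp_pos ?nonincr_powR//; lra.
have I1 : rintegrable mu (\1_(`[t1, t2]) : R -> R) by exact: integrable_indic_itv.
have IK := rintegrableZ ((t1 - x) `^ (a - 2) * K) I1.
have mramp : measurable_fun setT ramp.
  apply: measurable_sum => i; apply: measurable_funM => //; apply: measurable_funB.
    by apply: measurable_maxr => //; exact: measurable_funB.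
  by apply: measurable_maxr => //; exact: measurable_funB.
have mg : measurable_fun setT g.
  apply: measurable_funM.
    by apply: (measurableT_comp (measurable_powp _)); exact: measurable_funB.
  by apply: measurable_funM => //; exact: measurable_indic.
have Ig : rintegrable mu g by apply: le_rintegrable IK.
have Ing : rintegrable mu (fun r => `|g r|).
  by apply: le_rintegrable IK => [|r]; [exact: measurableT_comp|rewrite normr_id].
have int1 : \int[mu]_r (\1_(`[t1, t2]) r : R) = t2 - t1.
  rewrite /Rintegral integral_indic// setIT/= lebesgue_measure_itv/= lte_fin t12.
  by rewrite -EFinB.
have gint : `|\int[mu]_r g r| <= (t1 - x) `^ (a - 1) * K.
  apply: (le_trans (le_normr_Rintegral _ _)) => //.
  apply: (le_trans (le_rintegral Ing IK gb)).
  rewrite rintegralZ// int1 mulrAC ler_wpM2r//.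
  have -> : (t1 - x) `^ (a - 1) = (t1 - x) `^ (a - 2) * (t1 - x).
    rewrite -[X in _ = _ * X]powRr1 ?(ltW t1x0)// -gt0_powRD//.
    by congr (_ `^ _); ring.
  by rewrite ler_wpM2l ?powR_ge0.
rewrite (ksum_taylor uvt xt1) -/g.
apply: (le_trans (ler_normD _ _)); rewrite !normrM.
rewrite [`|(t1 - x) `^ _|]ger0_norm ?powR_ge0//.
have r1 : `|ramp t1| <= K by apply: rK; rewrite lexx ltW.
have P0 : 0 <= (t1 - x) `^ (a - 1) by exact: powR_ge0.
have n1 := normr_ge0 a; have n2 := normr_ge0 (a - 1).
have A1 : `|a| * (t1 - x) `^ (a - 1) * `|ramp t1| <= 2^-1 * (t1 - x) `^ (a - 1) * K.
  by rewrite ler_pM ?mulr_ge0// ler_pM.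
have A2 : `|a| * `|a - 1| * `|\int[mu]_r g r| <= 2^-1 * 2 * ((t1 - x) `^ (a - 1) * K).
  by rewrite ler_pM ?mulr_ge0// ler_pM.
apply: (le_trans (lerD A1 A2)).
rewrite -subr_ge0 (_ : _ - _ = 2^-1 * ((t1 - x) `^ (a - 1) * K)); last by field.
by rewrite !mulr_ge0.
Qed.

End kernel_sum.

End kernel_decorrelation.

Section kernel_decorrelation.
Context {R : realType}.
Local Notation mu := (@lebesgue_measure R).
Variable a : R.
Hypotheses (a_gt : - 2^-1 < a) (a_lt : a < 2^-1).

Lemma integral_tail_bound (t0 t1 : R) (f : R -> R) (c : R) : t0 < t1 ->
  L2 mu f -> (forall x, t0 < x -> f x = 0) ->
  (forall x, x <= t0 -> `|f x| <= c * (t1 - x) `^ (a - 1)) ->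
  \int[mu]_x (f x ^+ 2) <= c ^+ 2 * ((t1 - t0) `^ (2 * a - 1) *
    \int[mu]_x (powp (2 * a - 2) x * (2^-1 < x)%R%:R)).
Proof.
have [ha1 ha2] := conj a_gt a_lt.
move=> t01 [mf If] f0 fc.
have a1 : 2 * a - 2 < -1 by lra.
have c0 : 0 <= c.
  have := le_trans (normr_ge0 _) (fc t0 (lexx _)).
  by rewrite pmulr_lge0// powR_gt0// subr_gt0.
pose q x : R := powp (2 * a - 2) x * (2^-1 < x)%R%:R.
have q0 x : 0 <= q x by rewrite mulr_ge0 ?powp_ge0.
have Iq : rintegrable mu q by exact: rintegrable_powp_infty.
have D0 : 0 < t1 - t0 by rewrite subr_gt0.
have D'0 : 0 < (t1 - t0)^-1 by rewrite invr_gt0.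
have [I1 E1] := ge0_rintegral_affineN (t1 / (t1 - t0)) D'0 q0 Iq.
have IZ := rintegrableZ (c ^+ 2 * (t1 - t0) `^ (2 * a - 2)) I1.
apply: (le_trans (le_rintegral If IZ _)).
  move=> x; have [xt|tx] := leP x t0; last first.
    by rewrite f0// expr0n/= mulr_ge0// mulr_ge0 ?sqr_ge0 ?powR_ge0.
  have x0 : 0 < t1 - x by lra.
  have -> : q (t1 / (t1 - t0) - (t1 - t0)^-1 * x) =
     (t1 - t0) `^ (- (2 * a - 2)) * (t1 - x) `^ (2 * a - 2).
    rewrite /q (_ : t1 / (t1 - t0) - _ = (t1 - t0)^-1 * (t1 - x)); last by field; rewrite gt_eqF.
    have h : 2^-1 < (t1 - t0)^-1 * (t1 - x).
      by rewrite mulrC ltr_pdivlMr//; lra.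
    rewrite h mulr1 powpM// powp_pos// -powR_inv1 ?(ltW D0)// -powRrM.
    by congr (_ `^ _ * _); ring.
  have PP : (t1 - t0) `^ (2 * a - 2) * (t1 - t0) `^ (- (2 * a - 2)) = 1.
    by rewrite -gt0_powRD// subrr powRr0.
  rewrite -mulrA [X in _ * X]mulrA PP mul1r.
  have -> : (t1 - x) `^ (2 * a - 2) = ((t1 - x) `^ (a - 1)) ^+ 2.
    by rewrite expr2 -gt0_powRD//; congr (_ `^ _); ring.
  by rewrite -exprMn -real_normK ?num_real// lerXn2r ?nnegrE ?fc// mulr_ge0 ?powR_ge0.
rewrite rintegralZ// E1 invrK -/q.
rewrite le_eqVlt; apply/orP; left; apply/eqP.
have -> : (t1 - t0) `^ (2 * a - 1) = (t1 - t0) `^ (2 * a - 2) * (t1 - t0).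
  rewrite -[X in _ = _ * X]powRr1 ?(ltW D0)// -gt0_powRD//.
  by congr (_ `^ _); ring.
by rewrite !mulrA.
Qed.

Lemma ksum_decorrelation : exists2 C : R, 0 < C &
  forall t0 t1 t2 : R, t0 < t1 -> t1 < t2 -> t2 - t1 <= t1 - t0 ->
  forall (I J : Type) (s : seq I) (c u v : I -> R) (s' : seq J) (c' u' v' : J -> R),
  (forall i, u i <= t0 /\ v i <= t0) ->
  (forall j, t1 <= u' j <= t2 /\ t1 <= v' j <= t2) ->
  `|\int[mu]_x (ksum a s c u v x * ksum a s' c' u' v' x)| <=
   C * ((t2 - t1) / (t1 - t0)) `^ (2^-1 - a) *
   Num.sqrt (\int[mu]_x (ksum a s c u v x ^+ 2)) *
   Num.sqrt (\int[mu]_x (ksum a s' c' u' v' x ^+ 2)).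
Proof.
have [ha1 ha2] := conj a_gt a_lt.
pose k1 := (beta_cst a)^-1 *
    Num.sqrt (\int[mu]_x (powp (- (2 * a)) x * (x <= 1)%R%:R)).
pose k2 := Num.sqrt (\int[mu]_x (powp (2 * a - 2) x * (2^-1 < x)%R%:R)).
have k10 : 0 <= k1 by rewrite mulr_ge0 ?sqrtr_ge0// invr_ge0 ltW// beta_cst_gt0.
have k20 : 0 <= k2 by exact: sqrtr_ge0.
exists (2 * k1 * k2 + 1) => [|t0 t1 t2 t01 t12 tt I J s c u v s' c' u' v' uv uv'].
  by rewrite ltr_wpDl ?ltr01// mulr_ge0// mulr_ge0.
set X := ksum a s c u v; set Y := ksum a s' c' u' v'.
set NX := Num.sqrt _; set NY := Num.sqrt (\int[mu]_x (Y x ^+ 2)).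
pose D : R -> R := fun x => (x <= t0)%R%:R.
pose Y0 x := Y x * D x.
have mD : measurable_fun setT D.
  have -> : D = \1_(`]-oo, t0]) :> (R -> R).
    by apply/funext => x; rewrite indicE mem_setE in_itv.
  exact: measurable_indic.
have LX : L2 mu X by exact: L2_ksum.
have LY : L2 mu Y by exact: L2_ksum.
have DP x : D x = 0 \/ D x = 1.
  by rewrite /D; case: (x <= t0); [right|left].
have LY0 : L2 mu Y0.
  have [mY IY] := LY; split; first exact: measurable_funM.
  apply: le_rintegrable IY.
    by apply: measurable_funX; exact: measurable_funM.
  move=> x; rewrite ger0_norm ?sqr_ge0// /Y0 exprMn.
  by case: (DP x) => ->; rewrite ?expr1n ?mulr1// expr0n mulr0 sqr_ge0.
have -> : \int[mu]_x (X x * Y x) = \int[mu]_x (X x * Y0 x).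
  apply: eq_Rintegral => x _; rewrite /Y0 /D.
  have [xt|tx] := leP x t0; first by rewrite mulr1.
  by rewrite /X (ksum_eq0 a s c uv (ltW tx)) !mul0r.
apply: (le_trans (cauchy_schwarz_norm LX LY0)); rewrite -/NX.
pose rho := ((t2 - t1) / (t1 - t0)) `^ (2^-1 - a).
have rho0 : 0 <= rho by exact: powR_ge0.
have D0 : 0 < t1 - t0 by rewrite subr_gt0.
have L0 : 0 <= t2 - t1 by rewrite subr_ge0 ltW.
pose K := k1 * (t2 - t1) `^ (2^-1 - a) * NY.
have K0 : 0 <= K by rewrite /K mulr_ge0 ?sqrtr_ge0// mulr_ge0 ?powR_ge0.
have uv2 j : u' j <= t2 /\ v' j <= t2 by have [/andP[_ ->] /andP[_ ->]] := uv' j.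
have YK x : x <= t0 -> `|Y0 x| <= 2 * K * (t1 - x) `^ (a - 1).
  move=> xt; rewrite /Y0 /D xt mulr1.
  apply: (ksum_bound a_gt a_lt uv' t12); first by lra.
  by move=> r /andP[r1 r2]; exact: (ramp_bound a_gt a_lt s' c' uv2 r1 r2 t12).
have Y00 x : t0 < x -> Y0 x = 0 by move=> tx; rewrite /Y0 /D leNgt tx mulr0.
have := integral_tail_bound t01 LY0 Y00 YK.
move=> /(ler_wsqrtr); rewrite sqrtrM ?sqr_ge0// sqrtr_sqr ger0_norm ?(mulr_ge0 _ K0)//.
rewrite sqrtrM ?powR_ge0// -/k2.
have -> : Num.sqrt ((t1 - t0) `^ (2 * a - 1)) = (t1 - t0) `^ (- (2^-1 - a)).
  by rewrite -powR12_sqrt ?powR_ge0// -powRrM; congr (_ `^ _); field.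
move=> B.
have E : 2 * K * ((t1 - t0) `^ (- (2^-1 - a)) * k2) = 2 * k1 * k2 * rho * NY.
  rewrite /rho /K powRM ?invr_ge0 ?(ltW D0)// -(powR_inv1 (ltW D0)) -powRrM.
  by rewrite mulN1r; ring.
rewrite E in B.
apply: (@le_trans _ _ (NX * (2 * k1 * k2 * rho * NY))).
  by rewrite ler_wpM2l ?sqrtr_ge0.
rewrite -subr_ge0 (_ : _ - _ = rho * NX * NY); last by rewrite -/rho; ring.
by rewrite !mulr_ge0 ?sqrtr_ge0.
Qed.

End kernel_decorrelation.

(** * Hypercontractivity on the cube and its Gaussian limit *)

Section hypercube.
Context {R : realType}.
Implicit Types (f g : seq bool -> R) (e : seq bool) (w : nat -> R) (b : bool).

Fixpoint cubeE n f : R :=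
  if n is n'.+1 then
    (cubeE n' (fun e => f (false :: e)) + cubeE n' (fun e => f (true :: e))) / 2
  else f [::].

Lemma cubeED n f g : cubeE n (fun e => f e + g e) = cubeE n f + cubeE n g.
Proof. by elim: n f g => //= n IH f g; rewrite !IH; field. Qed.

Lemma cubeEZ n c f : cubeE n (fun e => c * f e) = c * cubeE n f.
Proof. by elim: n f => //= n IH f; rewrite !IH; field. Qed.

Lemma cubeE_ge0 n f : (forall e, 0 <= f e) -> 0 <= cubeE n f.
Proof.
by elim: n f => //= n IH f f0; rewrite divr_ge0// addr_ge0// IH.
Qed.

Lemma le_cubeE n f g : (forall e, f e <= g e) -> cubeE n f <= cubeE n g.
Proof.
by elim: n f g => //= n IH f g fg; rewrite ler_pM2r// lerD// IH.
Qed.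

Lemma cubeE_sum (I : Type) (s : seq I) (F : I -> seq bool -> R) n :
  cubeE n (fun e => \sum_(i <- s) F i e) = \sum_(i <- s) cubeE n (F i).
Proof.
elim: n F => //= n IH F; rewrite !IH -big_split/= big_distrl/=.
by [].
Qed.

Lemma cubeE_cauchy_schwarz n f g :
  cubeE n (fun e => f e * g e) ^+ 2 <=
  cubeE n (fun e => f e ^+ 2) * cubeE n (fun e => g e ^+ 2).
Proof.
set a := cubeE n (fun e => f e ^+ 2); set b := cubeE n (fun e => g e ^+ 2).
set c := cubeE n _.
have quad s t : 0 <= s ^+ 2 * a + (2 * (s * t)) * c + t ^+ 2 * b.
  rewrite -!cubeEZ -!cubeED; apply: cubeE_ge0 => e.
  have := sqr_ge0 (s * f e + t * g e); set L := (X in 0 <= X -> _).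
  by congr (0 <= _); rewrite /L; ring.
have a0 : 0 <= a by apply: cubeE_ge0 => e; exact: sqr_ge0.
have b0 : 0 <= b by apply: cubeE_ge0 => e; exact: sqr_ge0.
have [a_eq0|a_neq0] := eqVneq a 0.
  have [->|c0] := eqVneq c 0; first by rewrite expr0n mulr_ge0.
  have := quad (- (b + 1) / (2 * c)) 1; rewrite a_eq0.
  rewrite (_ : _ + _ = -1); last by field.
  by rewrite ler0N1.
have := quad (- c) a; rewrite (_ : _ + _ = a * (a * b - c ^+ 2)); last by ring.
by rewrite pmulr_rge0 ?subr_ge0// lt_def a_neq0.
Qed.

Fixpoint noise (d : R) n f e : R :=
  if n is n'.+1 then
    (1 + d) / 2 * noise d n' (fun e' => f (head false e :: e')) (behead e) +
    (1 - d) / 2 * noise d n' (fun e' => f (~~ head false e :: e')) (behead e)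
  else f [::].

Lemma noiseD d n f g e :
  noise d n (fun e => f e + g e) e = noise d n f e + noise d n g e.
Proof. by elim: n f g e => //= n IH f g e; rewrite !IH; ring. Qed.

Lemma noiseZ d n c f e : noise d n (fun e => c * f e) e = c * noise d n f e.
Proof. by elim: n f e => //= n IH f e; rewrite !IH; ring. Qed.

Lemma le_noise d n f g : 0 <= d <= 1 -> (forall e, f e <= g e) ->
  forall e, noise d n f e <= noise d n g e.
Proof.
move=> /andP[d0 d1]; elim: n f g => //= n IH f g fg e.
by apply: lerD; apply: ler_wpM2l; rewrite ?IH//; lra.
Qed.

Lemma sqr_noise_le d n f e : 0 <= d <= 1 ->
  noise d n f e ^+ 2 <= noise d n (fun e => f e ^+ 2) e.
Proof.
move=> /andP[d0 d1]; elim: n f e => //= n IH f e.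
set F := fun e' => f (head false e :: e').
set G := fun e' => f (~~ head false e :: e').
have HF := IH F (behead e); have HG := IH G (behead e).
apply: (@le_trans _ _ ((1 + d) / 2 * noise d n F (behead e) ^+ 2 +
  (1 - d) / 2 * noise d n G (behead e) ^+ 2)).
  move: (noise d n F _) (noise d n G _) => p q.
  rewrite -subr_ge0 (_ : _ - _ = (1 + d) / 2 * ((1 - d) / 2) * (p - q) ^+ 2).
    by rewrite mulr_ge0 ?sqr_ge0// mulr_ge0//; lra.
  by field.
by apply: lerD; apply: ler_wpM2l => //; lra.
Qed.

(* Bonami's lemma: write [f = g + e_0 h]; the odd powers of the sign [e_0]
   average out, and [6 d^2 <= 2]. *)
Lemma noise_norm4 d n f : 0 <= d -> 3 * d ^+ 2 <= 1 ->
  cubeE n (fun e => noise d n f e ^+ 4) <= cubeE n (fun e => f e ^+ 2) ^+ 2.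
Proof.
move=> d0 d3; elim: n f => [|n IH] f /=; first by rewrite -exprM.
set f0 := fun e => f (false :: e); set f1 := fun e => f (true :: e).
pose g e := 2^-1 * f0 e + 2^-1 * f1 e; pose h e := 2^-1 * f0 e + (- 2^-1) * f1 e.
pose u := noise d n g; pose v := noise d n h.
have uE e : u e = 2^-1 * noise d n f0 e + 2^-1 * noise d n f1 e.
  by rewrite /u noiseD !noiseZ.
have vE e : v e = 2^-1 * noise d n f0 e + (- 2^-1) * noise d n f1 e.
  by rewrite /v noiseD !noiseZ.
pose A := cubeE n (fun e => g e ^+ 2); pose B := cubeE n (fun e => h e ^+ 2).
have A0 : 0 <= A by apply: cubeE_ge0 => e; exact: sqr_ge0.
have B0 : 0 <= B by apply: cubeE_ge0 => e; exact: sqr_ge0.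
have uA : cubeE n (fun e => u e ^+ 4) <= A ^+ 2 by exact: IH.
have vB : cubeE n (fun e => v e ^+ 4) <= B ^+ 2 by exact: IH.
have uv : cubeE n (fun e => u e ^+ 2 * v e ^+ 2) <= A * B.
  rewrite -(@ler_pXn2r _ 2)// ?nnegrE ?mulr_ge0//; last first.
    by apply: cubeE_ge0 => e; rewrite mulr_ge0 ?sqr_ge0.
  apply: le_trans (cubeE_cauchy_schwarz _ _ _) _; rewrite exprMn.
  have E4 (k : seq bool -> R) : (fun e => (k e ^+ 2) ^+ 2) = (fun e => k e ^+ 4).
    by apply/funext => e; rewrite -exprM.
  rewrite !E4 ler_pM//; apply: cubeE_ge0 => e; rewrite -[4%N]/(2 * 2)%N exprM; exact: sqr_ge0.
have -> : (cubeE n (fun e => f0 e ^+ 2) + cubeE n (fun e => f1 e ^+ 2)) / 2 = A + B.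
  rewrite /A /B -!cubeED mulrC -cubeEZ; congr cubeE; apply/funext => e.
  by rewrite /g /h; field.
rewrite -cubeED mulrC -cubeEZ.
rewrite (_ : (fun e => _) = (fun e => u e ^+ 4 +
   (6 * d ^+ 2 * (u e ^+ 2 * v e ^+ 2) + d ^+ 4 * v e ^+ 4))); last first.
  by apply/funext => e; rewrite uE vE /= -/f0 -/f1; field.
rewrite !cubeED !cubeEZ.
have d2 : 0 <= d ^+ 2 by exact: sqr_ge0.
have d4 : d ^+ 4 <= 1 by rewrite -[4%N]/(2 * 2)%N exprM; nra.
have d40 : 0 <= d ^+ 4 by rewrite exprn_ge0.
have AB : 0 <= A * B by rewrite mulr_ge0.
have U0 : 0 <= cubeE n (fun e => u e ^+ 2 * v e ^+ 2).
  by apply: cubeE_ge0 => e; rewrite mulr_ge0 ?sqr_ge0.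
have V0 : 0 <= cubeE n (fun e => v e ^+ 4).
  by apply: cubeE_ge0 => e; rewrite -[4%N]/(2 * 2)%N exprM; exact: sqr_ge0.
rewrite sqrrD -addrA lerD// lerD//.
  rewrite -[leRHS]mulr_natl ler_pM ?mulr_ge0//; lra.
by rewrite -[leRHS]mul1r ler_pM.
Qed.

Lemma noise_hypercontractive d n j f : 0 <= d -> 3 * d ^+ 2 <= 1 ->
  cubeE n (fun e => iter j (noise d n) f e ^+ (2 ^ j.+1)) <=
  cubeE n (fun e => f e ^+ 2) ^+ (2 ^ j).
Proof.
move=> d0 d3; have d01 : 0 <= d <= 1 by rewrite d0/=; nra.
elim: j f => [|j IH] f; first by rewrite expr1.
have it2 i k e : iter i (noise d n) k e ^+ 2 <= iter i (noise d n) (fun e => k e ^+ 2) e.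
  elim: i e => // i IHi e; rewrite !iterS.
  apply: le_trans (sqr_noise_le _ _ _ d01) _.
  exact: le_noise.
pose u := noise d n f.
have -> : iter j.+1 (noise d n) f = iter j (noise d n) u by rewrite iterSr.
apply: (@le_trans _ _ (cubeE n (fun e => iter j (noise d n) (fun e => u e ^+ 2) e ^+ (2 ^ j.+1)))).
  apply: le_cubeE => e; rewrite [(2 ^ j.+2)%N]expnS exprM.
  by rewrite lerXn2r// ?nnegrE ?sqr_ge0// (le_trans _ (it2 _ _ _)) ?sqr_ge0.
apply: le_trans (IH _) _.
rewrite expnS exprM lerXn2r// ?nnegrE.
- by apply: cubeE_ge0 => e; exact: sqr_ge0.
- exact: sqr_ge0.
apply: le_trans (noise_norm4 n f d0 d3).
by apply: le_cubeE => e; rewrite -exprM.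
Qed.

Fixpoint cubeprod n w e : R :=
  if n is n'.+1 then
    (1 + w 0%N * (-1) ^+ head false e) * cubeprod n' (fun i => w i.+1) (behead e)
  else 1.

Lemma noise_cubeprod d n w : noise d n (cubeprod n w) = cubeprod n (fun i => d * w i).
Proof.
elim: n w => [|n IH] w; apply/funext => e //=.
rewrite !noiseZ !IH; move: (cubeprod _ _ _) => c.
by case: (head false e) => /=; field.
Qed.

Lemma iter_noise_cubeprod d n j w :
  iter j (noise d n) (cubeprod n w) = cubeprod n (fun i => d ^+ j * w i).
Proof.
elim: j => [|j IH].
  by rewrite /=; congr cubeprod; apply/funext => i; rewrite mul1r.
rewrite iterS IH noise_cubeprod; congr cubeprod; apply/funext => i.
by rewrite exprS mulrA.
Qed.

Lemma cubeE_prod_cubeprod (I : Type) (s : seq I) n (w : I -> nat -> R) :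
  cubeE n (fun e => \prod_(k <- s) cubeprod n (w k) e) =
  \prod_(i < n) ((\prod_(k <- s) (1 + w k i) + \prod_(k <- s) (1 - w k i)) / 2).
Proof.
elim: n w => [|n IH] w; first by rewrite big_ord0 /= big1.
rewrite big_ord_recl /= -(IH (fun k i => w k i.+1)).
pose c e := \prod_(k <- s) cubeprod n (fun i => w k i.+1) e.
have -> : (fun e => \prod_(k <- s) ((1 + w k 0%N * (-1) ^+ false) *
    cubeprod n (fun i => w k i.+1) e)) = (fun e => \prod_(k <- s) (1 + w k 0%N) * c e).
  by apply/funext => e; rewrite big_split/=; under eq_bigr do rewrite mulr1.
have -> : (fun e => \prod_(k <- s) ((1 + w k 0%N * (-1) ^+ true) *
    cubeprod n (fun i => w k i.+1) e)) = (fun e => \prod_(k <- s) (1 - w k 0%N) * c e).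
  by apply/funext => e; rewrite big_split/=; under eq_bigr do rewrite expr1 mulrN1.
by rewrite !cubeEZ -mulrDl mulrAC.
Qed.

End hypercube.

Section exponential_limit.
Context {R : realType}.

Lemma cvgn_sum (I : Type) (s : seq I) (F : I -> nat -> R) (l : I -> R) :
  (forall i, F i n @[n --> \oo] --> l i) ->
  \sum_(i <- s) F i n @[n --> \oo] --> \sum_(i <- s) l i.
Proof.
move=> Fl; elim: s => [|i s IH].
  by rewrite big_nil; under eq_fun do rewrite big_nil; exact: cvg_cst.
rewrite big_cons; under eq_fun do rewrite big_cons.
exact: cvgD.
Qed.

Lemma cvgn_prod (I : Type) (s : seq I) (F : I -> nat -> R) (l : I -> R) :
  (forall i, F i n @[n --> \oo] --> l i) ->
  \prod_(i <- s) F i n @[n --> \oo] --> \prod_(i <- s) l i.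
Proof.
move=> Fl; elim: s => [|i s IH].
  by rewrite big_nil; under eq_fun do rewrite big_nil; exact: cvg_cst.
rewrite big_cons; under eq_fun do rewrite big_cons.
exact: cvgM.
Qed.

Lemma cvgn_exp (F : nat -> R) (l : R) (k : nat) :
  F n @[n --> \oo] --> l -> F n ^+ k @[n --> \oo] --> l ^+ k.
Proof.
move=> Fl; elim: k => [|k IH]; first by rewrite expr0; exact: cvg_cst.
by rewrite exprS; under eq_fun do rewrite exprS; exact: cvgM.
Qed.

Lemma cvgn_pow_expR (t : nat -> R) (c : R) :
  n.+1%:R * t n @[n --> \oo] --> c ->
  (1 + t n) ^+ n.+1 @[n --> \oo] --> expR c.
Proof.
move=> tc.
have t0 : t n @[n --> \oo] --> (0 : R).
  have C1 : n.+1%:R * t n * harmonic n @[n --> \oo] --> (0 : R).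
    by rewrite -[X in _ --> X](mulr0 c); apply: cvgM => //; exact: cvg_harmonic.
  have E : (fun n => n.+1%:R * t n * harmonic n) = t.
    by apply/funext => n; rewrite /harmonic/= mulrAC mulfV ?mul1r// pnatr_eq0.
  by rewrite E in C1.
apply: (@squeeze_cvgr _ _ _ _ (fun n => expR (n.+1%:R * t n * (1 + t n)^-1)) (fun n => expR (n.+1%:R * t n))).
- near=> n.
  have tn : `|t n| < 1 by near: n; move/cvgr0_norm_lt : t0; apply; exact: ltr01.
  have t1 : 0 < 1 + t n by move: tn; rewrite ltr_norml => /andP[]; lra.
  apply/andP; split; last first.
    by rewrite expRM_natl lerXn2r ?nnegrE ?(ltW t1) ?expR_ge0// expR_ge1Dx.
  rewrite -mulrA expRM_natl lerXn2r ?nnegrE ?(ltW t1) ?expR_ge0//.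
  have -> : t n * (1 + t n)^-1 = - (- (t n / (1 + t n))) by rewrite opprK.
  rewrite expRN -[leRHS]invrK lef_pV2 ?posrE ?expR_gt0 ?invr_gt0//.
  apply: le_trans (expR_ge1Dx _).
  by rewrite le_eqVlt; apply/orP; left; apply/eqP; field; rewrite gt_eqF.
- apply: continuous_cvg; first exact: continuous_expR.
  rewrite -[X in _ --> X]mulr1; apply: cvgM => //.
  rewrite -[X in _ --> X]invr1; apply: cvgV; first by rewrite oner_eq0.
  rewrite -[X in _ --> X]addr0; apply: cvgD => //; exact: cvg_cst.
- by apply: continuous_cvg => //; exact: continuous_expR.
Unshelve. all: by end_near. Qed.

Definition elem2 (I : Type) (s : seq I) (u : I -> R) : R :=
  ((\sum_(i <- s) u i) ^+ 2 - \sum_(i <- s) u i ^+ 2) / 2.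

Lemma prod1D_expansion (I : Type) (s : seq I) (u : I -> R) :
  exists2 C : R, 0 <= C & forall h : R, `|h| <= 1 ->
  `|\prod_(i <- s) (1 + u i * h) -
     (1 + (\sum_(i <- s) u i) * h + elem2 s u * h ^+ 2)| <= C * `|h| ^+ 3.
Proof.
elim: s => [|i s [C C0 IH]].
  exists 0 => // h _; rewrite /elem2 !big_nil.
  by rewrite !(mul0r, expr0n, subrr, addr0, normr0).
exists (C * (1 + `|u i|) + `|u i * elem2 s u|) => [|h h1].
  by rewrite addr_ge0// mulr_ge0// addr_ge0.
have eE : elem2 (i :: s) u = elem2 s u + u i * \sum_(j <- s) u j.
  by rewrite /elem2 !big_cons; field.
have -> : \prod_(j <- i :: s) (1 + u j * h) - (1 + (\sum_(j <- i :: s) u j) * h +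
     elem2 (i :: s) u * h ^+ 2) =
   (\prod_(j <- s) (1 + u j * h) - (1 + (\sum_(j <- s) u j) * h + elem2 s u * h ^+ 2))
    * (1 + u i * h) + u i * elem2 s u * h ^+ 3.
  by rewrite eE !big_cons; ring.
apply: (le_trans (ler_normD _ _)); rewrite [leRHS]mulrDl; apply: lerD; last first.
  by rewrite [leLHS]normrM normrX.
rewrite normrM [leRHS]mulrAC ler_pM// ?IH//.
apply: (le_trans (ler_normD _ _)); rewrite normr1 lerD2l normrM.
by rewrite ler_piMr.
Qed.

Lemma cvg_prod1D_expR (I : Type) (s : seq I) (u : I -> R) :
  ((\prod_(i <- s) (1 + u i / Num.sqrt n.+1%:R) +
    \prod_(i <- s) (1 - u i / Num.sqrt n.+1%:R)) / 2) ^+ n.+1 @[n --> \oo]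
  --> expR (elem2 s u).
Proof.
have [C C0 HC] := prod1D_expansion s u.
pose h n : R := (Num.sqrt n.+1%:R)^-1.
pose A n := (\prod_(i <- s) (1 + u i * h n) + \prod_(i <- s) (1 - u i * h n)) / 2.
have h2 n : n.+1%:R * h n ^+ 2 = 1.
  by rewrite /h exprVn sqr_sqrtr// mulfV// pnatr_eq0.
have h0 n : 0 <= h n by rewrite invr_ge0 sqrtr_ge0.
have h1 n : `|h n| <= 1.
  rewrite ger0_norm// -(@ler_pXn2r _ 2)// ?nnegrE// expr1n.
  by rewrite -(h2 n) ler_peMl ?sqr_ge0// ler1n.
have Ab n : `|elem2 s u - n.+1%:R * (A n - 1)| <= C * h n.
  have B1 := HC _ (h1 n).
  have B2 : `|\prod_(i <- s) (1 - u i * h n) -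
     (1 - (\sum_(i <- s) u i) * h n + elem2 s u * h n ^+ 2)| <= C * `|h n| ^+ 3.
    have := HC (- h n); rewrite normrN => /(_ (h1 n)).
    by rewrite sqrrN mulrN; under eq_bigr do rewrite mulrN.
  have -> : elem2 s u - n.+1%:R * (A n - 1) = - (n.+1%:R / 2 *
    ((\prod_(i <- s) (1 + u i * h n) -
     (1 + (\sum_(i <- s) u i) * h n + elem2 s u * h n ^+ 2)) +
     (\prod_(i <- s) (1 - u i * h n) -
     (1 - (\sum_(i <- s) u i) * h n + elem2 s u * h n ^+ 2)))).
    have E : elem2 s u = elem2 s u * (n.+1%:R * h n ^+ 2) by rewrite h2 mulr1.
    by rewrite [X in X - _]E /A; field.
  rewrite normrN normrM ger0_norm//.
  apply: (@le_trans _ _ (n.+1%:R / 2 * (C * `|h n| ^+ 3 + C * `|h n| ^+ 3))).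
    by rewrite ler_wpM2l//; apply: (le_trans (ler_normD _ _)); rewrite lerD.
  rewrite ger0_norm// le_eqVlt; apply/orP; left; apply/eqP.
  rewrite [LHS](_ : _ = C * h n * (n.+1%:R * h n ^+ 2)); last by field.
  by rewrite h2 mulr1.
have hto0 : h n @[n --> \oo] --> (0 : R).
  have C1 := cvg_comp _ _ (@cvg_harmonic R) (@sqrt_continuous R 0).
  rewrite sqrtr0 in C1.
  have E : Num.sqrt \o harmonic = h by apply/funext => n; rewrite /h /= sqrtrV.
  by rewrite E in C1.
have -> : (fun n => ((\prod_(i <- s) (1 + u i / Num.sqrt n.+1%:R) +
    \prod_(i <- s) (1 - u i / Num.sqrt n.+1%:R)) / 2) ^+ n.+1) =
  (fun n => (1 + (A n - 1)) ^+ n.+1).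
  by apply/funext => n; rewrite (_ : 1 + (A n - 1) = A n)//; ring.
apply: cvgn_pow_expR; apply/cvgrPdist_le => e e0.
have Ch : C * h n @[n --> \oo] --> (0 : R).
  by rewrite -[X in _ --> X](mulr0 C); apply: cvgM => //; exact: cvg_cst.
move/cvgr0_norm_le : Ch => /(_ e e0).
apply: filterS => n; apply: le_trans; apply: (le_trans (Ab n)).
exact: ler_norm.
Unshelve. all: by end_near. Qed.

End exponential_limit.

Section gaussian_limit.
Context {R : realType}.

Definition spread N (z : 'I_N -> R) (m i : nat) : R :=
  (if insub (i %/ m.+1)%N is Some o then z o else 0) / Num.sqrt m.+1%:R.

(* The central limit theorem for the products [\prod_i (1 + w_i e_i)]. *)
Lemma cvg_cubeE_spread (I : Type) (s : seq I) N (z : I -> 'I_N -> R) :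
  cubeE (N * m.+1) (fun e => \prod_(k <- s) cubeprod (N * m.+1) (spread (z k) m) e)
  @[m --> \oo] --> expR (\sum_(o < N) elem2 s (fun k => z k o)).
Proof.
rewrite expR_sum.
have -> : (fun m => cubeE (N * m.+1) (fun e =>
     \prod_(k <- s) cubeprod (N * m.+1) (spread (z k) m) e)) =
  (fun m => \prod_(o < N) ((\prod_(k <- s) (1 + z k o / Num.sqrt m.+1%:R) +
    \prod_(k <- s) (1 - z k o / Num.sqrt m.+1%:R)) / 2) ^+ m.+1).
  apply/funext => m; rewrite cubeE_prod_cubeprod.
  rewrite -(big_mkord xpredT (fun i => (\prod_(k <- s) (1 + spread (z k) m i) +
    \prod_(k <- s) (1 - spread (z k) m i)) / 2)).
  rewrite big_nat_mul big_mkord; apply: eq_bigr => o _.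
  rewrite [LHS](_ : _ = \prod_(o * m.+1 <= i < o.+1 * m.+1)
    ((\prod_(k <- s) (1 + z k o / Num.sqrt m.+1%:R) +
    \prod_(k <- s) (1 - z k o / Num.sqrt m.+1%:R)) / 2)).
    by rewrite prodr_const_nat -mulnBl subSnn mul1n.
  apply: eq_big_nat => i /andP[io oi].
  have E k : spread (z k) m i = z k o / Num.sqrt m.+1%:R.
    rewrite /spread; have -> : (i %/ m.+1)%N = o.
      by apply/eqP; rewrite eqn_leq leq_divRL// io andbT -ltnS ltn_divLR.
    by rewrite valK.
  by under eq_bigr do rewrite E; under [X in _ + X]eq_bigr do rewrite E.
apply: cvgn_prod => o; exact: cvg_prod1D_expR.
Qed.

Lemma iter_noise_sum d n j (I : Type) (s : seq I) (c : I -> R) (f : I -> seq bool -> R) e :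
  iter j (noise d n) (fun e => \sum_(i <- s) c i * f i e) e =
  \sum_(i <- s) c i * iter j (noise d n) (f i) e.
Proof.
have noise_sum (g : I -> seq bool -> R) e' :
    noise d n (fun e => \sum_(i <- s) c i * g i e) e' =
    \sum_(i <- s) c i * noise d n (g i) e'.
  elim: s => [|i s IH].
    under [X in noise d n X]eq_fun do rewrite big_nil -(mul0r 0).
    by rewrite noiseZ mul0r big_nil.
  under [X in noise d n X]eq_fun do rewrite big_cons.
  by rewrite noiseD noiseZ IH big_cons.
elim: j e => // j IH e; rewrite iterS -noise_sum.
by congr (noise _ _ _ _); apply/funext => e1; exact: IH.
Qed.

Lemma sumrX (I : finType) (F : I -> R) p :
  (\sum_i F i) ^+ p = \sum_(k : {ffun 'I_p -> I}) \prod_(r < p) F (k r).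
Proof. by rewrite -(bigA_distr_bigA (fun _ => F)) prodr_const card_ord. Qed.

(* Gaussian hypercontractivity from L^2 to L^(2^j.+1) for linear combinations of
   exponentials of jointly Gaussian variables with covariance [\sum_o x k o * x l o],
   all expectations being written out. *)
Lemma exponential_hypercontractive (I : finType) N j (c : I -> R) (x : I -> 'I_N -> R) :
  \sum_(k : {ffun 'I_(2 ^ j.+1) -> I}) (\prod_(r < 2 ^ j.+1) c (k r)) *
    expR (\sum_(o < N) elem2 (index_enum 'I_(2 ^ j.+1))
       (fun r => 2^-1 ^+ j * x (k r) o)) <=
  (\sum_k \sum_l c k * c l * expR (\sum_(o < N) x k o * x l o)) ^+ (2 ^ j).
Proof.
pose p := (2 ^ j.+1)%N; pose d : R := 2^-1.
pose F m e := \sum_k c k * cubeprod (N * m.+1) (spread (x k) m) e.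
have iterF m e : iter j (noise d (N * m.+1)) (F m) e =
    \sum_k c k * cubeprod (N * m.+1) (spread (fun o => d ^+ j * x k o) m) e.
  rewrite /F iter_noise_sum; apply: eq_bigr => k _; congr (_ * _).
  rewrite iter_noise_cubeprod; congr (cubeprod _ _ _); apply/funext => i.
  by rewrite /spread; case: insub => [y|]; [rewrite mulrA|rewrite mul0r mulr0].
have HC m : cubeE (N * m.+1) (fun e => iter j (noise d (N * m.+1)) (F m) e ^+ p) <=
    cubeE (N * m.+1) (fun e => F m e ^+ 2) ^+ (2 ^ j).
  by apply: noise_hypercontractive; rewrite /d; lra.
pose L m := \sum_(k : {ffun 'I_p -> I}) (\prod_(r < p) c (k r)) *
   cubeE (N * m.+1) (fun e => \prod_(r < p)
     cubeprod (N * m.+1) (spread (fun o => d ^+ j * x (k r) o) m) e).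
pose G m := (\sum_k \sum_l c k * c l *
   cubeE (N * m.+1) (fun e => \prod_(r <- [:: k; l]) cubeprod (N * m.+1) (spread (x r) m) e))
    ^+ (2 ^ j).
have LE m : L m = cubeE (N * m.+1) (fun e => iter j (noise d (N * m.+1)) (F m) e ^+ p).
  under [X in _ = cubeE _ X]eq_fun do rewrite iterF sumrX.
  rewrite cubeE_sum; apply: eq_bigr => k _.
  by under [X in _ = cubeE _ X]eq_fun do rewrite big_split/=; rewrite cubeEZ.
have GE m : G m = cubeE (N * m.+1) (fun e => F m e ^+ 2) ^+ (2 ^ j).
  rewrite /G; congr (_ ^+ _).
  under [X in _ = cubeE _ X]eq_fun do rewrite expr2 big_distrl/=.
  rewrite cubeE_sum; apply: eq_bigr => k _.
  under [X in _ = cubeE _ X]eq_fun do rewrite big_distrr/=.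
  rewrite cubeE_sum; apply: eq_bigr => l _; rewrite -cubeEZ; congr cubeE.
  by apply/funext => e; rewrite !big_cons big_nil mulr1; ring.
apply: (@ler_cvg_to _ \oo _ _ L G).
- apply: cvgn_sum => k; apply: cvgM; first exact: cvg_cst.
  exact: (@cvg_cubeE_spread 'I_p (index_enum _) N (fun r o => d ^+ j * x (k r) o)).
- apply: cvgn_exp; apply: cvgn_sum => k; apply: cvgn_sum => l.
  apply: cvgM; first exact: cvg_cst.
  have -> : \sum_(o < N) x k o * x l o =
     \sum_(o < N) elem2 [:: k; l] (fun r => x r o).
    by apply: eq_bigr => o _; rewrite /elem2 !big_cons !big_nil !addr0; field.
  exact: (@cvg_cubeE_spread I [:: k; l] N x).
- by apply: nearW => m; rewrite LE GE.
Qed.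

End gaussian_limit.

Section positive_semidefinite.
Context {R : realType}.

Definition psd (I : finType) (K : I -> I -> R) : Prop :=
  (forall i j, K i j = K j i) /\
  forall a : I -> R, 0 <= \sum_i \sum_j a i * a j * K i j.

Lemma psd_shift (I : finType) (K : I -> I -> R) (i0 : I) (a : I -> R) (t : R) :
  (forall i j, K i j = K j i) ->
  \sum_i \sum_j (a i + t * (i == i0)%:R) * (a j + t * (j == i0)%:R) * K i j =
  \sum_i \sum_j a i * a j * K i j + 2 * t * (\sum_j a j * K i0 j) + t ^+ 2 * K i0 i0.
Proof.
move=> Ks.
have S1 (F : I -> R) : \sum_i (i == i0)%:R * F i = F i0.
  rewrite (bigD1 i0)//= eqxx mul1r big1 ?addr0// => i /negbTE ->.
  by rewrite mul0r.
transitivity (\sum_i \sum_j a i * a j * K i j +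
  \sum_i (i == i0)%:R * (t * \sum_j a j * K i j) +
  \sum_j (j == i0)%:R * (t * \sum_i a i * K i j) +
  \sum_i (i == i0)%:R * (t ^+ 2 * \sum_j (j == i0)%:R * K i j)).
  rewrite [X in _ + X + _](_ : _ = \sum_i \sum_j t * ((j == i0)%:R * a i * K i j)).
    rewrite -!big_split/=; apply: eq_bigr => i _.
    rewrite !mulrA !big_distrr/= -!big_split/=; apply: eq_bigr => j _; ring.
  rewrite exchange_big/=; apply: eq_bigr => j _; rewrite !big_distrr/=.
  by apply: eq_bigr => i _; ring.
rewrite !S1.
under [X in _ + t * X + _]eq_bigr do rewrite Ks.
by ring.
Qed.

Lemma psd_diag_eq0 (I : finType) (K : I -> I -> R) i j :
  psd K -> K i i = 0 -> K i j = 0.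
Proof.
move=> [Ks K0] Kii; pose a (k : I) : R := (k == j)%:R.
have S1 (F : I -> R) : \sum_k a k * F k = F j.
  rewrite (bigD1 j)//= /a eqxx mul1r big1 ?addr0// => k /negbTE ->.
  by rewrite mul0r.
have quad t : 0 <= K j j + 2 * t * K i j.
  have := K0 (fun k => a k + t * (k == i)%:R); rewrite psd_shift// Kii mulr0 addr0.
  rewrite S1; under eq_bigr do (under eq_bigr do rewrite -mulrA; rewrite -big_distrr/= S1).
  by rewrite S1.
apply/eqP/negPn/negP => Kij0.
have := quad (- (K j j + 1) / (2 * K i j)).
rewrite (_ : K j j + _ = -1); last by field.
by rewrite ler0N1.
Qed.

(* Gaussian elimination: a positive diagonal entry is a pivot, and the remainder
   has fewer nonzero diagonal entries. *)
Lemma psd_gram (I : finType) (K : I -> I -> R) : psd K ->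
  exists s : seq (I -> R), forall i j, K i j = \sum_(f <- s) f i * f j.
Proof.
move: {2}#|[pred i | K i i != 0]|.+1 (ltnSn #|[pred i | K i i != 0]|) => m.
elim: m K => // m IH K Km psdK; have [Ks K0] := psdK.
have [/existsP[i0 i0P]|/existsPn none] := boolP [exists i, K i i != 0]; last first.
  exists [::] => i j; rewrite big_nil; apply: (psd_diag_eq0 _ psdK).
  by apply/eqP/negPn; exact: none.
pose k := K i0 i0.
have k0 : 0 < k.
  rewrite lt_def i0P/=; have := K0 (fun i => 0 + 1 * (i == i0)%:R).
  rewrite psd_shift// !big1 => [|i _|i _]; last 2 first.
  - by rewrite mul0r.
  - by rewrite big1// => j _; rewrite !mul0r.
  by rewrite mulr0 !add0r expr1n mul1r.
pose K' i j := K i j - K i i0 * K i0 j / k.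
have psdK' : psd K'.
  split=> [i j|a]; first by rewrite /K' Ks (Ks i i0) (Ks i0 j) (mulrC (K i0 i)).
  set B := \sum_j a j * K i0 j.
  have := K0 (fun i => a i + (- B / k) * (i == i0)%:R); rewrite psd_shift// -/B -/k.
  congr (0 <= _).
  have -> : \sum_i \sum_j a i * a j * K' i j =
     \sum_i \sum_j a i * a j * K i j - B * B / k.
    rewrite /B big_distrl/= big_distrl/= -sumrB; apply: eq_bigr => i _.
    rewrite big_distrr/= big_distrl/= -sumrB; apply: eq_bigr => j _.
    by rewrite /K' (Ks i i0); ring.
  by field; rewrite gt_eqF.
have card' : (#|[pred i | K' i i != 0%R]| < m)%N.
  rewrite -ltnS (leq_trans _ Km)// ltnS; apply: proper_card; apply/properP; split.
    apply/fintype.subsetP => i; rewrite !inE; apply: contra => /eqP Kii.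
    by rewrite /K' (psd_diag_eq0 i0 psdK Kii) Kii mul0r mul0r subrr.
  exists i0; rewrite !inE//= -/k negbK /K' -/k mulfK ?subrr// gt_eqF.
have [s sE] := IH K' card' psdK'.
exists ((fun i => K i i0 / Num.sqrt k) :: s) => i j.
rewrite big_cons -sE /K' (Ks j i0).
have kk : Num.sqrt k * Num.sqrt k = k by rewrite -expr2 sqr_sqrtr// ltW.
rewrite mulf_div kk; ring.
Qed.

Lemma psd_mul (I : finType) (K L : I -> I -> R) :
  psd K -> psd L -> psd (fun i j => K i j * L i j).
Proof.
move=> psdK [Ls L0]; have [Ks _] := psdK; split=> [i j|a]; first by rewrite Ks Ls.
have [s sE] := psd_gram psdK.
have -> : \sum_i \sum_j a i * a j * (K i j * L i j) =
   \sum_(f <- s) \sum_i \sum_j (a i * f i) * (a j * f j) * L i j.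
  rewrite [RHS]exchange_big/=; apply: eq_bigr => i _.
  rewrite [RHS]exchange_big/=; apply: eq_bigr => j _.
  by rewrite sE mulrA big_distrr big_distrl/=; apply: eq_bigr => f _; ring.
by apply: sumr_ge0 => f _; exact: L0.
Qed.

Lemma psd_exp (I : finType) (K : I -> I -> R) n :
  psd K -> psd (fun i j => K i j ^+ n).
Proof.
move=> psdK; elim: n => [|n IH].
  split=> // a; have := sqr_ge0 (\sum_i a i); congr (0 <= _).
  rewrite expr2 big_distrl/=; apply: eq_bigr => i _; rewrite big_distrr/=.
  by apply: eq_bigr => j _; rewrite expr0 mulr1.
by have := psd_mul psdK IH; under [X in _ -> psd X]eq_fun do under eq_fun do rewrite exprS.
Qed.

End positive_semidefinite.

Section exponential_covariance.
Context {R : realType}.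
Variables (I J : finType) (G1 : I -> I -> R) (G2 : J -> J -> R) (C : I -> J -> R).

Definition block (rho : R) (k l : I + J) : R :=
  match k, l with
  | inl i, inl i' => rho * G1 i i'
  | inl i, inr j => C i j
  | inr j, inl i => C i j
  | inr j, inr j' => rho * G2 j j'
  end.

Lemma block_power_bound rho n (a : I -> R) (b : J -> R) : psd (block rho) ->
  2 * `|\sum_i \sum_j a i * b j * C i j ^+ n| <=
  rho ^+ n * (\sum_i \sum_i' a i * a i' * G1 i i' ^+ n +
              \sum_j \sum_j' b j * b j' * G2 j j' ^+ n).
Proof.
move=> /(psd_exp n)[_ K0].
set A := \sum_i \sum_i' a i * a i' * G1 i i' ^+ n.
have key (e : R) : e ^+ 2 = 1 -> 0 <= rho ^+ n * A + 2 * e * (\sum_i \sum_j a i * b j * C i j ^+ n) +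
   rho ^+ n * (\sum_j \sum_j' b j * b j' * G2 j j' ^+ n).
  move=> e2; have := K0 (fun k => match k with inl i => a i | inr j => e * b j end).
  rewrite big_sumType/=.
  under eq_bigr do rewrite big_sumType/=.
  under [X in _ + X]eq_bigr do rewrite big_sumType/=.
  rewrite !big_split/=; congr (0 <= _).
  have -> : \sum_i \sum_i0 a i * a i0 * (rho * G1 i i0) ^+ n = rho ^+ n * A.
    rewrite /A big_distrr/=; apply: eq_bigr => i _; rewrite big_distrr/=.
    by apply: eq_bigr => i' _; rewrite exprMn; ring.
  have -> : \sum_i \sum_j a i * (e * b j) * C i j ^+ n =
     e * \sum_i \sum_j a i * b j * C i j ^+ n.
    rewrite big_distrr/=; apply: eq_bigr => i _; rewrite big_distrr/=.
    by apply: eq_bigr => j _; ring.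
  have -> : \sum_j \sum_i e * b j * a i * C i j ^+ n =
     e * \sum_i \sum_j a i * b j * C i j ^+ n.
    rewrite [LHS]exchange_big [RHS]big_distrr/=; apply: eq_bigr => i _; rewrite big_distrr/=.
    by apply: eq_bigr => j _; ring.
  have -> : \sum_j \sum_j0 e * b j * (e * b j0) * (rho * G2 j j0) ^+ n =
     e ^+ 2 * (rho ^+ n * \sum_j \sum_j' b j * b j' * G2 j j' ^+ n).
    rewrite !big_distrr/=; apply: eq_bigr => j _; rewrite !big_distrr/=.
    by apply: eq_bigr => j' _; rewrite exprMn; ring.
  by rewrite e2; ring.
have n1 : (-1 : R) ^+ 2 = 1 by rewrite sqrrN expr1n.
have := key 1 (expr1n _ _); have := key (-1) n1.
clear key K0; rewrite mulrDr; set B := \sum_j \sum_j' b j * b j' * G2 j j' ^+ n; clearbody A B.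
move: (rho ^+ n * A) (rho ^+ n * B) (\sum_i \sum_j _) => p q X h1 h2.
by have [X0|X0] := lerP 0 X; [rewrite ger0_norm|rewrite ltr0_norm]; lra.
Qed.

Lemma cvg_series_expR (x : R) :
  \sum_(0 <= n < m) x ^+ n / n`!%:R @[m --> \oo] --> expR x.
Proof. exact: is_cvg_series_exp_coeff. Qed.

(* Comparison of the power series, using [rho ^+ n <= rho / d * d ^+ n] for [0 < n]. *)
Lemma exponential_covariance_bound (rho d : R) (a : I -> R) (b : J -> R) :
  0 <= rho -> 0 < d -> rho <= d -> psd (block rho) -> psd G1 -> psd G2 ->
  2 * `|\sum_i \sum_j a i * b j * (expR (C i j) - 1)| <=
  rho / d * (\sum_i \sum_i' a i * a i' * expR (d * G1 i i') +
             \sum_j \sum_j' b j * b j' * expR (d * G2 j j')).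
Proof.
move=> r0 d0 rd psdB psd1 psd2.
pose S m (x : R) := \sum_(0 <= n < m) x ^+ n / n`!%:R.
pose L m := 2 * `|\sum_i \sum_j a i * b j * (S m.+1 (C i j) - 1)|.
pose Q m := rho / d * (\sum_i \sum_i' a i * a i' * S m.+1 (d * G1 i i') +
             \sum_j \sum_j' b j * b j' * S m.+1 (d * G2 j j')).
have cS x : S m.+1 x @[m --> \oo] --> expR x.
  have := @cvg_series_expR x; rewrite -(cvg_shiftS (S^~ x)) //.
apply: (@ler_cvg_to _ \oo _ _ L Q).
- apply: cvgM; first exact: cvg_cst.
  apply: cvg_norm; apply: cvgn_sum => i; apply: cvgn_sum => j.
  by apply: cvgM; [exact: cvg_cst|apply: cvgB => //; exact: cvg_cst].
- apply: cvgM; first exact: cvg_cst.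
  by apply: cvgD; apply: cvgn_sum => i; apply: cvgn_sum => j;
    apply: cvgM => //; exact: cvg_cst.
apply: nearW => m; rewrite /L /Q.
pose U n := \sum_i \sum_j a i * b j * C i j ^+ n.
pose V n := \sum_i \sum_i' a i * a i' * G1 i i' ^+ n +
            \sum_j \sum_j' b j * b j' * G2 j j' ^+ n.
have V0 n : 0 <= V n.
  by rewrite addr_ge0//; [exact: (psd_exp n psd1).2|exact: (psd_exp n psd2).2].
have -> : \sum_i \sum_j a i * b j * (S m.+1 (C i j) - 1) =
    \sum_(0 <= n < m) U n.+1 / n.+1`!%:R.
  under eq_bigr do under eq_bigr do
    rewrite /S big_nat_recl// expr0 fact0 divr1 addrAC subrr add0r big_distrr/=.
  under eq_bigr do rewrite exchange_big/=.
  rewrite exchange_big/=; apply: eq_bigr => n _; rewrite /U big_distrl/=.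
  apply: eq_bigr => i _; rewrite big_distrl/=.
  by apply: eq_bigr => j _; rewrite mulrA.
have -> : \sum_i \sum_i' a i * a i' * S m.+1 (d * G1 i i') +
             \sum_j \sum_j' b j * b j' * S m.+1 (d * G2 j j') =
    \sum_(0 <= n < m.+1) d ^+ n * V n / n`!%:R.
  under eq_bigr do under eq_bigr do rewrite /S big_distrr/=.
  under eq_bigr do rewrite exchange_big/=.
  rewrite exchange_big/=.
  under [X in _ + X]eq_bigr do under eq_bigr do rewrite /S big_distrr/=.
  under [X in _ + X]eq_bigr do rewrite exchange_big/=.
  rewrite [X in _ + X]exchange_big/= -big_split/=; apply: eq_bigr => n _.
  rewrite /V mulrDr mulrDl; congr (_ + _); rewrite big_distrr big_distrl/=;
    apply: eq_bigr => i _; rewrite big_distrr big_distrl/=;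
    by apply: eq_bigr => j _; rewrite exprMn; ring.
rewrite big_nat_recl//.
apply: (@le_trans _ _ (\sum_(0 <= n < m) rho ^+ n.+1 * V n.+1 / n.+1`!%:R)).
  apply: (@le_trans _ _ (2 * \sum_(0 <= n < m) `|U n.+1 / n.+1`!%:R|)).
    by rewrite ler_wpM2l// ler_norm_sum.
  rewrite big_distrr/=; apply: ler_sum => n _.
  rewrite normrM [`|_^-1|]ger0_norm// mulrA ler_wpM2r//.
  exact: block_power_bound.
apply: (@le_trans _ _ (rho / d * \sum_(0 <= n < m) d ^+ n.+1 * V n.+1 / n.+1`!%:R)).
  rewrite big_distrr/=; apply: ler_sum => n _.
  rewrite !mulrA ler_wpM2r// ler_wpM2r//.
  rewrite exprS [X in _ <= X](_ : _ = rho * d ^+ n); last first.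
    by rewrite exprS; field; rewrite gt_eqF.
  by rewrite ler_wpM2l// lerXn2r ?nnegrE// ltW.
rewrite ler_wpM2l ?divr_ge0 ?(ltW d0)// lerDr.
by rewrite expr0 mul1r fact0 divr1.
Qed.

End exponential_covariance.

(** * Gaussian variables and exponentials *)

Section density.
Context d (T : measurableType d) (R : realType) (m nu : {measure set T -> \bar R}).
Variable p : T -> R.
Hypotheses (mp : measurable_fun setT p) (p0 : forall x, 0 <= p x).
Hypothesis nuE : forall A, measurable A -> nu A = (\int[m]_(x in A) (p x)%:E)%E.
Local Open Scope ereal_scope.

Import HBNNSimple.

Lemma ge0_integral_density (f : T -> \bar R) :
  measurable_fun setT f -> (forall x, 0 <= f x) ->
  \int[nu]_x f x = \int[m]_x (f x * (p x)%:E).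
Proof.
move=> mf f0; pose h := nnsfun_approx measurableT mf.
have mpE : measurable_fun setT (EFin \o p) by apply/measurable_EFinP.
have hf x : EFin \o (h ^~ x) @ \oo --> f x by apply: cvg_nnsfun_approx.
have -> : \int[nu]_x f x = limn (fun n => \int[nu]_x (h n x)%:E).
  rewrite -monotone_convergence//.
  - by apply: eq_integral => x _; apply/esym/cvg_lim => //; exact: hf.
  - by move=> n; apply/measurable_EFinP.
  - by move=> n x _; rewrite lee_fin.
  - by move=> x _ a b ab; rewrite lee_fin; exact/lefP/nd_nnsfun_approx.
have -> : \int[m]_x (f x * (p x)%:E) = limn (fun n => \int[m]_x ((h n x)%:E * (p x)%:E)).
  rewrite -monotone_convergence//.
  - apply: eq_integral => x _; apply/esym/cvg_lim => //.
    by apply: cvgeZr => //; exact: hf.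
  - by move=> n; apply: emeasurable_funM => //; apply/measurable_EFinP.
  - by move=> n x _; rewrite mule_ge0// lee_fin.
  - move=> x _ a b ab; rewrite lee_wpmul2r ?lee_fin//.
    exact/lefP/nd_nnsfun_approx.
suff E : forall n, \int[nu]_x (h n x)%:E = \int[m]_x ((h n x)%:E * (p x)%:E).
  by under eq_fun do rewrite E.
move=> n.
transitivity (\int[nu]_x (\sum_(y \in range (h n)) (y * \1_(h n @^-1` [set y]) x)%:E)).
  by apply: eq_integral => x _; rewrite fsumEFin// -fimfunE.
have mind r : measurable_fun setT (fun x => (r * \1_(h n @^-1` [set r]) x)%:E).
  by apply/measurable_EFinP; exact: measurable_funM.
rewrite ge0_integral_fsum//; last by move=> y x _; exact: nnfun_muleindic_ge0.
transitivity (\int[m]_x (\sum_(y \in range (h n))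
    (y * \1_(h n @^-1` [set y]) x)%:E * (p x)%:E)); last first.
  apply: eq_integral => x _.
  rewrite -ge0_mule_fsuml => [|y]; last exact: nnfun_muleindic_ge0.
  by rewrite fsumEFin// -fimfunE.
rewrite ge0_integral_fsum//; last 2 first.
  - by move=> y; apply: emeasurable_funM.
  - by move=> y x _; apply: mule_ge0; [exact: nnfun_muleindic_ge0|rewrite lee_fin].
apply: eq_fsbigr => r rh.
have r0 : (0 <= r)%R by move: rh; rewrite inE => -[x _ <-].
under eq_integral do rewrite EFinM.
under [RHS]eq_integral do rewrite EFinM -muleA.
have m1 : measurable_fun setT (fun x => (\1_(h n @^-1` [set r]) x : R)%:E).
  by apply/measurable_EFinP; exact: measurable_indic.
rewrite ge0_integralZl_EFin//.
rewrite ge0_integralZl_EFin//; last 2 first.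
  - by move=> x _; apply: mule_ge0; rewrite lee_fin.
  - exact: emeasurable_funM.
congr (_ * _); rewrite integral_indic// setIT nuE// integral_mkcond.
apply: eq_integral => x _; rewrite /patch indicE.
by case: ifPn => _; rewrite ?mul1e ?mul0e.
Qed.

End density.

Section dominated_convergence.
Context d (T : measurableType d) (R : realType) (m : {measure set T -> \bar R}).

Lemma rintegral_dominated_convergence (f_ : nat -> T -> R) (f g : T -> R) :
  (forall n, measurable_fun setT (f_ n)) -> measurable_fun setT f ->
  (forall x, f_ n x @[n --> \oo] --> f x) -> rintegrable m g ->
  (forall n x, `|f_ n x| <= g x) ->
  \int[m]_x f_ n x @[n --> \oo] --> \int[m]_x f x.
Proof.
move=> mf_ mf ff Ig fg.
have Ifn n : rintegrable m (f_ n) by apply: le_rintegrable Ig.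
have [If _ C] : [/\ m.-integrable setT (EFin \o f), (\int[m]_x `|(EFin \o f_ n) x - (EFin \o f) x| @[n --> \oo] --> 0)%E &
   (\int[m]_x (EFin \o f_ n) x @[n --> \oo] --> \int[m]_x (EFin \o f) x)%E].
  apply: (@dominated_convergence _ _ _ m setT measurableT (fun n => EFin \o f_ n) (EFin \o f) (EFin \o g)) => //.
  - by move=> n; apply/measurable_EFinP.
  - exact/measurable_EFinP.
  - apply: aeW => x _; apply: cvg_EFin; first by apply: nearW.
    exact: ff.
  - by apply: aeW => x n _; rewrite /= lee_fin.
by apply: fine_cvg; rewrite integral_EFin_fine in C.
Qed.

End dominated_convergence.

Section exponential_limits.
Context {R : realType}.

Lemma expR_sub1_le (x : R) : expR x - 1 <= x * expR x.
Proof.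
have := expR_ge1Dx (- x); rewrite expRN => h.
have e0 := expR_gt0 x.
have : (1 - x) * expR x <= 1.
  by rewrite -[leRHS](@mulVf _ (expR x)) ?gt_eqF// ler_wpM2r ?expR_ge0.
by rewrite mulrBl mul1r; lra.
Qed.

Lemma cvg_expR_slope (h x : nat -> R) (l : R) : (forall n, 0 < h n) ->
  h n @[n --> \oo] --> (0 : R) -> x n @[n --> \oo] --> l ->
  (expR (h n * x n) - 1) / h n @[n --> \oo] --> l.
Proof.
move=> h0 hc xc.
apply: (@squeeze_cvgr _ _ _ _ x (fun n => x n * expR (h n * x n))) => //.
- apply: nearW => n; rewrite ler_pdivlMr// ler_pdivrMr// mulrC; apply/andP; split.
    by have := expR_ge1Dx (h n * x n); lra.
  by rewrite mulrAC (mulrC (x n)) expR_sub1_le.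
- rewrite -[X in _ --> X]mulr1; apply: cvgM => //.
  rewrite -expR0; apply: continuous_cvg; first exact: continuous_expR.
  by rewrite -(mul0r l); exact: cvgM.
Qed.

Lemma norm_expR_sub1 (x : R) : `|expR x - 1| <= `|x| * expR `|x|.
Proof.
have [x0|x0] := leP 0 x.
  by rewrite !ger0_norm ?expR_sub1_le// subr_ge0 -expR0 ler_expR.
rewrite ltr0_norm; last by rewrite subr_lt0 -expR0 ltr_expR.
rewrite opprB ltr0_norm//.
apply: (@le_trans _ _ (- x * 1)).
  by have := expR_ge1Dx x; lra.
by rewrite ler_pM2l ?oppr_gt0// -expR0 ler_expR oppr_ge0 ltW.
Qed.

Lemma norm_le_expR (x : R) : `|x| <= expR `|x|.
Proof. by have := expR_ge1Dx `|x|; lra. Qed.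

End exponential_limits.

Section gaussian_mgf.
Context d (T : measurableType d) (R : realType) (P : probability T R).

Lemma rintegrable_cst (c : R) : rintegrable P (fun=> c).
Proof. exact: finite_measure_integrable_cst. Qed.

Lemma rintegral_cst (c : R) : \int[P]_w c = c.
Proof. by have := expectation_cst P c; rewrite unlock /Rintegral => ->. Qed.

Lemma normal_pdf_tilt (m s t x : R) : s != 0 ->
  expR (t * x) * normal_pdf m s x =
  expR (t * m + t ^+ 2 * s ^+ 2 / 2) * normal_pdf (m + t * s ^+ 2) s x.
Proof.
move=> s0; rewrite !normal_pdfE// mulrCA [RHS]mulrCA; congr (_ * _).
rewrite /normal_fun -!expRD; congr expR; rewrite -[s ^+ 2 *+ 2]mulr_natr; field.
by rewrite s0.
Qed.

Lemma gaussian_mgf (X : T -> R) (m s t : R) : measurable_fun setT X ->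
  (forall A : set R, measurable A -> pushforward P X A = gaussian_law m s A) ->
  (\int[P]_w (expR (t * X w))%:E)%E = (expR (t * m + t ^+ 2 * s ^+ 2 / 2))%:E.
Proof.
move=> mX lawX.
pose f (x : R) : \bar R := (expR (t * x))%:E.
have mf : measurable_fun setT f.
  by apply/measurable_EFinP; apply: measurableT_comp => //; exact: measurable_funM.
have f0 x : (0 <= f x)%E by rewrite lee_fin expR_ge0.
pose X' : T -> measurableTypeR R := X.
have mX' : measurable_fun setT X' by exact: mX.
transitivity (\int[pushforward P X']_x f x)%E.
  by rewrite (ge0_integral_pushforward mX')// preimage_setT.
have [s0|s0] := eqVneq s 0.
  transitivity (\int[\d_(m : measurableTypeR R)]_x f x)%E.
    apply: eq_measure_integral => A mA _.
    by have := lawX A mA; rewrite /gaussian_law s0 eqxx.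
  by rewrite integral_dirac// diracT mul1e s0 expr0n mulr0 mul0r addr0.
transitivity (\int[normal_prob m s]_x f x)%E.
  apply: (@eq_measure_integral _ (measurableTypeR R)) => A mA _.
  by have := lawX A mA; rewrite /gaussian_law (negbTE s0).
rewrite (@ge0_integral_density _ _ _ lebesgue_measure (normal_prob m s) (normal_pdf m s))//.
- rewrite /f; under eq_integral do rewrite -EFinM normal_pdf_tilt// EFinM.
  rewrite ge0_integralZl_EFin ?expR_ge0//.
  + by rewrite integral_normal_pdf mule1.
  + by move=> x _; rewrite lee_fin normal_pdf_ge0.
  + by apply/measurable_EFinP; exact: measurable_normal_pdf.
- exact: measurable_normal_pdf.
- exact: normal_pdf_ge0.
Qed.

Definition exp_moments (X : T -> R) := measurable_fun setT X /\
  forall t : R, rintegrable P (fun w => expR (t * X w)).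

Lemma rintegrable_expR_abs (X : T -> R) (t : R) : exp_moments X -> 0 <= t ->
  rintegrable P (fun w => expR (t * `|X w|)).
Proof.
move=> [mX IX] t0; have := rintegrableD (IX t) (IX (- t)).
apply: le_rintegrable.
  by apply: measurableT_comp => //; apply: measurable_funM => //; exact: measurableT_comp.
move=> w /=; rewrite ger0_norm ?expR_ge0//.
have [X0|X0] := leP 0 (X w).
  by rewrite ger0_norm// lerDl expR_ge0.
by rewrite ltr0_norm// mulrN mulNr lerDr expR_ge0.
Qed.

Lemma exp_moments_mean (X : T -> R) (m v : R) : exp_moments X ->
  (forall t, \int[P]_w expR (t * X w) = expR (t * m + t ^+ 2 * v / 2)) ->
  rintegrable P X /\ \int[P]_w X w = m.
Proof.
move=> EX EE; have [mX IX] := EX.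
have I2 := rintegrable_expR_abs EX (ler0n R 2).
have IXX : rintegrable P X.
  apply: le_rintegrable I2 => // w; apply: (le_trans (norm_le_expR _)).
  by rewrite ler_expR ler_peMl// ler1n.
split=> //.
pose h (n : nat) : R := n.+1%:R^-1.
have h0 n : 0 < h n by rewrite invr_gt0.
have h1 n : h n <= 1 by rewrite invf_le1// ler1n.
have hc : h n @[n --> \oo] --> (0 : R) by exact: cvg_harmonic.
pose f n w := (expR (h n * X w) - 1) / h n.
have mf n : measurable_fun setT (f n).
  apply: measurable_funM => //; apply: measurable_funB => //.
  by apply: measurableT_comp => //; exact: measurable_funM.
have fc : \int[P]_w f n w @[n --> \oo] --> \int[P]_w X w.
  apply: (rintegral_dominated_convergence _ _ _ I2) => //.
  - by move=> w; apply: cvg_expR_slope => //; exact: cvg_cst.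
  - move=> n w; rewrite /f normrM normfV (gtr0_norm (h0 n)).
    rewrite ler_pdivrMr//; apply: (le_trans (norm_expR_sub1 _)).
    rewrite normrM (gtr0_norm (h0 n)) -mulrA [leRHS]mulrC ler_wpM2l ?(ltW (h0 n))//.
    rewrite (_ : 2 * `|X w| = `|X w| + `|X w|); last by ring.
    rewrite expRD ler_pM ?expR_ge0 ?norm_le_expR//.
    by rewrite ler_expR ler_piMl.
have E n : \int[P]_w f n w = (expR (h n * (m + h n * (v / 2))) - 1) / h n.
  rewrite /f; under eq_Rintegral do rewrite mulrC.
  rewrite rintegralZ; last by apply: rintegrableB => //; exact: rintegrable_cst.
  rewrite rintegralB ?rintegral_cst ?EE//; last exact: rintegrable_cst.
  by rewrite mulrC; congr ((expR _ - 1) / _); ring.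
have fm : \int[P]_w f n w @[n --> \oo] --> m.
  under eq_fun do rewrite E.
  apply: cvg_expR_slope => //; rewrite -[X in _ --> X]addr0 -(mul0r (v / 2)).
  by apply: cvgD; [exact: cvg_cst|apply: cvgM => //; exact: cvg_cst].
exact: (cvg_unique _ fc fm).
Qed.

Lemma exp_moments_var (X : T -> R) (v : R) : exp_moments X ->
  (forall t, \int[P]_w expR (t * X w) = expR (t ^+ 2 * v / 2)) ->
  rintegrable P (fun w => X w ^+ 2) /\ \int[P]_w (X w ^+ 2) = v.
Proof.
move=> EX EE; have [mX IX] := EX.
have I3 := rintegrable_expR_abs EX (ler0n R 3).
have IXX : rintegrable P (fun w => X w ^+ 2).
  apply: le_rintegrable I3; first exact: measurable_funX.
  move=> w; rewrite normrX expr2.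
  apply: (@le_trans _ _ (expR `|X w| * expR `|X w|)).
    by rewrite ler_pM ?norm_le_expR.
  by rewrite -expRD ler_expR; have := normr_ge0 (X w); lra.
split=> //.
pose h (n : nat) : R := n.+1%:R^-1.
have h0 n : 0 < h n by rewrite invr_gt0.
have h1 n : h n <= 1 by rewrite invf_le1// ler1n.
have hc : h n @[n --> \oo] --> (0 : R) by exact: cvg_harmonic.
pose f n w := ((expR (h n * X w) - 1) / h n) ^+ 2 * expR (- h n * X w).
have fE n w : f n w = h n ^- 2 * (expR (h n * X w) + expR (- h n * X w) - 2).
  rewrite /f (mulNr (h n)) expRN; field.
  by rewrite !gt_eqF ?expR_gt0.
have mf n : measurable_fun setT (f n).
  apply: measurable_funM; last by apply: measurableT_comp => //; exact: measurable_funM.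
  apply: measurable_funX; apply: measurable_funM => //; apply: measurable_funB => //.
  by apply: measurableT_comp => //; exact: measurable_funM.
have fc : \int[P]_w f n w @[n --> \oo] --> \int[P]_w (X w ^+ 2).
  have mX2 : measurable_fun setT (fun w => X w ^+ 2) by exact: measurable_funX.
  apply: (rintegral_dominated_convergence mf mX2 _ I3).
  - move=> w; rewrite /f -[X in _ --> X]mulr1; apply: cvgM.
      rewrite expr2; under eq_fun do rewrite expr2.
      by apply: cvgM; apply: cvg_expR_slope => //; exact: cvg_cst.
    rewrite -expR0; apply: continuous_cvg; first exact: continuous_expR.
    rewrite -(mul0r (X w)); apply: cvgM; last exact: cvg_cst.
    by rewrite -oppr0; exact: cvgN.
  - move=> n w; rewrite /f ger0_norm; last by rewrite mulr_ge0 ?sqr_ge0 ?expR_ge0.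
    have B : `|(expR (h n * X w) - 1) / h n| <= `|X w| * expR `|h n * X w|.
      rewrite normrM normfV (gtr0_norm (h0 n)) ler_pdivrMr//.
      apply: (le_trans (norm_expR_sub1 _)).
      by rewrite normrM (gtr0_norm (h0 n)) -mulrA mulrC.
    have hX : `|h n * X w| <= `|X w| by rewrite normrM (gtr0_norm (h0 n)) ler_piMl.
    set Y := _ / h n in B *.
    have C : f n w <= 0 -> True by [].
    have cosh : Y ^+ 2 * expR (- h n * X w) = h n ^- 2 * (expR (h n * X w) + expR (- h n * X w) - 2).
      by rewrite -fE.
    have B1 : `|Y| * expR (- (h n * X w) / 2) <= `|X w| * expR (`|X w| / 2).
      have [x0|x0] := leP 0 (h n * X w).
        apply: (@le_trans _ _ (`|X w| * expR `|h n * X w| * expR (- (h n * X w) / 2))).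
          by rewrite ler_wpM2r ?expR_ge0.
        rewrite -mulrA ler_wpM2l// -expRD ler_expR (ger0_norm x0).
        by move: hX; rewrite (ger0_norm x0); lra.
      have B2 : `|Y| <= `|X w|.
        rewrite /Y normrM normfV (gtr0_norm (h0 n)) ler_pdivrMr//.
        rewrite ltr0_norm; last by rewrite subr_lt0 -expR0 ltr_expR.
        have -> : `|X w| * h n = - (h n * X w).
          by rewrite -(ltr0_norm x0) normrM (gtr0_norm (h0 n)) mulrC.
        by have := expR_ge1Dx (h n * X w); lra.
      rewrite ler_pM ?expR_ge0// ler_expR.
      by move: hX; rewrite (ltr0_norm x0); lra.
    have -> : Y ^+ 2 * expR (- h n * X w) = (`|Y| * expR (- (h n * X w) / 2)) ^+ 2.
      rewrite [RHS]exprMn real_normK ?num_real// -expRM_natl.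
      by congr (_ * expR _); field.
    apply: (@le_trans _ _ ((`|X w| * expR (`|X w| / 2)) ^+ 2)).
      by rewrite lerXn2r ?nnegrE ?mulr_ge0 ?expR_ge0.
    rewrite exprMn -expRM_natl expr2.
    apply: (@le_trans _ _ ((expR `|X w| * expR `|X w|) * expR (2 * (`|X w| / 2)))).
      by rewrite ler_wpM2r ?expR_ge0// ler_pM ?norm_le_expR.
    by rewrite -!expRD ler_expR; lra.
have E n : \int[P]_w f n w = (expR (h n ^+ 2 * v / 2) - 1) / (h n ^+ 2 / 2).
  rewrite (_ : f n = fun w => h n ^- 2 * (expR (h n * X w) + expR (- h n * X w) - 2)); last first.
    by apply/funext => w; exact: fE.
  have I1 := rintegrableD (IX (h n)) (IX (- h n)).
  rewrite rintegralZ; last by apply: rintegrableB => //; exact: rintegrable_cst.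
  rewrite (rintegralB I1 (rintegrable_cst _)) (rintegralD (IX _) (IX _)) rintegral_cst !EE.
  by rewrite sqrrN; field; rewrite gt_eqF.
have fm : \int[P]_w f n w @[n --> \oo] --> v.
  under eq_fun do rewrite E.
  under eq_fun do rewrite mulrAC.
  apply: (@cvg_expR_slope _ (fun n => h n ^+ 2 / 2) (fun=> v)).
  - by move=> n; rewrite divr_gt0 ?exprn_gt0.
  - rewrite -[X in _ --> X](mul0r (2^-1)) -(mul0r (0 : R)).
    apply: cvgM; last exact: cvg_cst.
    by under eq_fun do rewrite expr2; exact: cvgM.
  - exact: cvg_cst.
exact: (cvg_unique _ fc fm).
Qed.

Lemma is_gaussian_centered (X : T -> R) : is_gaussian P X ->
  \int[P]_w X w = 0 ->
  [/\ exp_moments X, L2 P X &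
    forall t, \int[P]_w expR (t * X w) = expR (t ^+ 2 * \int[P]_w (X w ^+ 2) / 2)].
Proof.
move=> [mX [m [s [s0 lawX]]]] X0.
have mgf t := gaussian_mgf t mX lawX.
have EX : exp_moments X.
  split=> // t; apply: ge0_rintegrable.
  - by apply: measurableT_comp => //; exact: measurable_funM.
  - by move=> w; exact: expR_ge0.
  - by rewrite mgf ltry.
have EE t : \int[P]_w expR (t * X w) = expR (t * m + t ^+ 2 * s ^+ 2 / 2).
  by rewrite /Rintegral mgf.
have [_ Em] := exp_moments_mean EX EE.
have m0 : m = 0 by rewrite -Em.
have EE0 t : \int[P]_w expR (t * X w) = expR (t ^+ 2 * s ^+ 2 / 2).
  by rewrite EE m0 mulr0 add0r.
have [I2 E2] := exp_moments_var EX EE0.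
by split=> //; rewrite E2.
Qed.

End gaussian_mgf.

Section gaussian_space.
Context d (T : measurableType d) (R : realType) (P : probability T R).

Definition gaussian_space (V : (T -> R) -> Prop) :=
  [/\ forall X, V X -> exp_moments P X /\ L2 P X,
      forall X, V X -> \int[P]_w expR (X w) = expR ((\int[P]_w (X w ^+ 2)) / 2),
      V (fun=> 0) &
      forall c X Y, V X -> V Y -> V (fun w => c * X w + Y w)].

Definition dotP (X Y : T -> R) : R := \int[P]_w (X w * Y w).

Variable V : (T -> R) -> Prop.
Hypothesis gV : gaussian_space V.

Lemma gaussian_spaceZ c X : V X -> V (fun w => c * X w).
Proof.
have [_ _ V0 VD] := gV; move=> VX; have := VD c X _ VX V0.
by under eq_fun do rewrite addr0.
Qed.

Lemma gaussian_space_sum (I : Type) (s : seq I) (c : I -> R) (X : I -> T -> R) :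
  (forall i, V (X i)) -> V (fun w => \sum_(i <- s) c i * X i w).
Proof.
have [_ _ V0 VD] := gV; move=> VX; elim: s => [|i s IH].
  by under eq_fun do rewrite big_nil.
by under eq_fun do rewrite big_cons; exact: VD.
Qed.

Lemma dotPC X Y : dotP X Y = dotP Y X.
Proof. by apply: eq_Rintegral => w _; rewrite mulrC. Qed.

Lemma dotP_sum (I J : Type) (s : seq I) (s' : seq J) (c : I -> R) (c' : J -> R)
    (X : I -> T -> R) (Y : J -> T -> R) :
  (forall i, L2 P (X i)) -> (forall j, L2 P (Y j)) ->
  dotP (fun w => \sum_(i <- s) c i * X i w) (fun w => \sum_(j <- s') c' j * Y j w) =
  \sum_(i <- s) \sum_(j <- s') c i * c' j * dotP (X i) (Y j).
Proof. exact: rintegral_sumM. Qed.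

Lemma dotP_psd (I : finType) (X : I -> T -> R) : (forall i, L2 P (X i)) ->
  psd (fun i j => dotP (X i) (X j)).
Proof.
move=> LX; split=> [i j|a]; first exact: dotPC.
by rewrite -dotP_sum//; apply: rintegral_ge0 => w; rewrite -expr2 sqr_ge0.
Qed.

Section exponentials.
Variables (I : finType) (X : I -> T -> R) (c : I -> R).
Hypothesis VX : forall i, V (X i).

Definition wick (t : R) i w := expR (t * X i w - t ^+ 2 * dotP (X i) (X i) / 2).

Definition wick_sum (t : R) w := \sum_i c i * wick t i w.

(* The squared L^2 norm of [wick_sum] at [Num.sqrt t]. *)
Definition wick_norm (t : R) := \sum_i \sum_j c i * c j * expR (t * dotP (X i) (X j)).

Let L2X i : L2 P (X i).
Proof. by have [h _ _ _] := gV; have [] := h _ (VX i). Qed.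

Lemma prod_wick (K : Type) (s : seq K) (t : K -> R) (i : K -> I) :
  rintegrable P (fun w => \prod_(r <- s) wick (t r) (i r) w) /\
  \int[P]_w (\prod_(r <- s) wick (t r) (i r) w) =
  expR ((\sum_(r <- s) \sum_(r' <- s) t r * t r' * dotP (X (i r)) (X (i r'))
         - \sum_(r <- s) t r ^+ 2 * dotP (X (i r)) (X (i r))) / 2).
Proof.
pose Z w := \sum_(r <- s) t r * X (i r) w.
have VZ : V Z by apply: gaussian_space_sum.
have [mom mgf _ _] := gV.
pose k := - (\sum_(r <- s) t r ^+ 2 * dotP (X (i r)) (X (i r))) / 2.
have E w : \prod_(r <- s) wick (t r) (i r) w = expR k * expR (Z w).
  rewrite -expRD /wick -expR_sum; congr expR.
  rewrite big_split/= addrC; congr (_ + _).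
  by rewrite sumrN -big_distrl/= /k mulNr.
have IZ : rintegrable P (fun w => expR (Z w)).
  have [[_ /(_ 1) IZ1] _] := mom _ VZ; move: IZ1.
  by apply: eq_integrable => // w _ /=; rewrite mul1r.
have -> : (fun w => \prod_(r <- s) wick (t r) (i r) w) = (fun w => expR k * expR (Z w)).
  by apply/funext => w; exact: E.
split; first exact: rintegrableZ.
rewrite rintegralZ// mgf// -expRD; congr expR.
have -> : \int[P]_w (Z w ^+ 2) = dotP Z Z.
  by apply: eq_Rintegral => w _; rewrite expr2.
by rewrite /Z dotP_sum// /k; field.
Qed.

(* By the generating-function form of Gaussian hypercontractivity. *)
Lemma wick_sum_moment j :
  \int[P]_w (wick_sum (2^-1 ^+ j ^+ 2) w ^+ (2 ^ j.+1)) <=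
  wick_norm (2^-1 ^+ j ^+ 2) ^+ (2 ^ j).
Proof.
set e := 2^-1 ^+ j.
have [s sE] := psd_gram (dotP_psd L2X).
pose x i (o : 'I_(size s)) := e * nth (fun=> 0) s o i.
have gram i k t : t ^+ 2 * dotP (X i) (X k) =
    \sum_(o < size s) (t * nth (fun=> 0) s o i) * (t * nth (fun=> 0) s o k).
  rewrite sE (big_nth (fun=> 0)) big_mkord big_distrr/=.
  by apply: eq_bigr => o _; ring.
have := exponential_hypercontractive j c x; rewrite -/e.
have -> : \sum_k \sum_l c k * c l * expR (\sum_(o < size s) x k o * x l o) =
    wick_norm (e ^+ 2).
  apply: eq_bigr => k _; apply: eq_bigr => l _; congr (_ * expR _).
  by rewrite gram.
apply: le_trans; rewrite le_eqVlt; apply/orP; left; apply/eqP.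
transitivity (\int[P]_w (\sum_(k : {ffun 'I_(2 ^ j.+1) -> I})
   (\prod_(r < 2 ^ j.+1) c (k r)) * \prod_(r < 2 ^ j.+1) wick (e ^+ 2) (k r) w)).
  apply: eq_Rintegral => w _; rewrite /wick_sum sumrX; apply: eq_bigr => k _.
  by rewrite big_split.
have PW k := @prod_wick 'I_(2 ^ j.+1) (index_enum _) (fun=> e ^+ 2) k.
rewrite rintegral_sum => [|k]; last first.
  by apply: rintegrableZ; have [] := PW k.
apply: eq_bigr => k _; have [I1 E1] := PW k.
rewrite rintegralZ// E1; congr (_ * expR _).
rewrite /elem2 -big_distrl/=; congr (_ / 2); rewrite sumrB; congr (_ - _).
  transitivity (\sum_(r < 2 ^ j.+1) \sum_(r' < 2 ^ j.+1) \sum_(o < size s)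
     (e * x (k r) o) * (e * x (k r') o)).
    apply: eq_bigr => r _; apply: eq_bigr => r' _.
    rewrite -expr2 gram; apply: eq_bigr => o _.
    by rewrite /x !mulrA.
  under eq_bigr do rewrite exchange_big/=.
  rewrite exchange_big/=; apply: eq_bigr => o _.
  rewrite expr2 big_distrl/=; apply: eq_bigr => r _; rewrite big_distrr/=.
  by [].
rewrite exchange_big/=; apply: eq_bigr => r _.
rewrite gram; apply: eq_bigr => o _.
by rewrite /x; ring.
Qed.

Lemma wick_sum_pairing (t : R) :
  rintegrable P (fun w => wick_sum 1 w * wick_sum t w) /\
  \int[P]_w (wick_sum 1 w * wick_sum t w) = wick_norm t.
Proof.
pose tt (b : bool) : R := if b then 1 else t.
have PW i k := @prod_wick bool [:: true; false] tt (fun b => if b then i else k).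
have E w : wick_sum 1 w * wick_sum t w = \sum_i \sum_k c i * c k *
    \prod_(b <- [:: true; false]) wick (tt b) (if b then i else k) w.
  rewrite /wick_sum big_distrl/=; apply: eq_bigr => i _; rewrite big_distrr/=.
  apply: eq_bigr => k _; rewrite !big_cons big_nil mulr1/=; ring.
have I1 i k : rintegrable P (fun w => c i * c k *
    \prod_(b <- [:: true; false]) wick (tt b) (if b then i else k) w).
  by apply: rintegrableZ; have [] := PW i k.
rewrite (_ : (fun w => _) = fun w => \sum_i \sum_k c i * c k *
    \prod_(b <- [:: true; false]) wick (tt b) (if b then i else k) w); last first.
  by apply/funext => w; exact: E.
split; first by apply: rintegrable_sum => i; exact: rintegrable_sum.
rewrite rintegral_sum => [|i]; last exact: rintegrable_sum.
apply: eq_bigr => i _; rewrite rintegral_sum//; apply: eq_bigr => k _.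
have [I2 E2] := PW i k.
rewrite rintegralZ// E2; congr (_ * expR _).
by rewrite !big_cons !big_nil/= (dotPC (X k) (X i)); field.
Qed.

Lemma wick_norm_ge0 (t : R) : 0 <= wick_norm (t ^+ 2).
Proof.
have PW i k := @prod_wick bool [:: true; false] (fun=> t) (fun b => if b then i else k).
suff -> : wick_norm (t ^+ 2) = \int[P]_w (wick_sum t w ^+ 2).
  by apply: rintegral_ge0 => w; exact: sqr_ge0.
have I1 i k : rintegrable P (fun w => c i * c k *
    \prod_(b <- [:: true; false]) wick t (if b then i else k) w).
  by apply: rintegrableZ; have [] := PW i k.
transitivity (\int[P]_w (\sum_i \sum_k c i * c k *
    \prod_(b <- [:: true; false]) wick t (if b then i else k) w)); last first.
  apply: eq_Rintegral => w _; rewrite expr2.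
  rewrite /wick_sum big_distrl/=; apply: eq_bigr => i _; rewrite big_distrr/=.
  by apply: eq_bigr => k _; rewrite !big_cons big_nil mulr1/=; ring.
rewrite rintegral_sum => [|i]; last exact: rintegrable_sum.
apply: eq_bigr => i _; rewrite rintegral_sum//; apply: eq_bigr => k _.
have [I2 E2] := PW i k.
rewrite rintegralZ// E2; congr (_ * expR _).
by rewrite !big_cons !big_nil/= (dotPC (X k) (X i)); field.
Qed.

Lemma wick_sum_mean (t : R) : rintegrable P (wick_sum t) /\
  \int[P]_w wick_sum t w = \sum_i c i.
Proof.
have PW i : rintegrable P (wick t i) /\ \int[P]_w wick t i w = 1.
  have := @prod_wick unit [:: tt] (fun=> t) (fun=> i).
  rewrite !big_cons !big_nil !addr0 -expr2 subrr mul0r expR0.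
  rewrite (_ : (fun w => \prod_(r <- [:: tt]) wick t i w) = wick t i)//.
  by apply/funext => w; rewrite big_cons big_nil mulr1.
have I1 i : rintegrable P (fun w => c i * wick t i w).
  by apply: rintegrableZ; have [] := PW i.
split; first exact: rintegrable_sum.
rewrite rintegral_sum//; apply: eq_bigr => i _.
by have [I2 E2] := PW i; rewrite rintegralZ// E2 mulr1.
Qed.

End exponentials.
End gaussian_space.

Section real_norm.
Context d (T : measurableType d) (R : realType) (P : probability T R).

Definition Lp (q : R) (f : T -> R) := measurable_fun setT f /\
  rintegrable P (fun w => `|f w| `^ q).

Definition nrm (q : R) (f : T -> R) : R := (\int[P]_w (`|f w| `^ q)) `^ q^-1.

Lemma nrm_ge0 q f : 0 <= nrm q f.
Proof. exact: powR_ge0. Qed.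

Lemma measurable_norm_powR q (f : T -> R) : measurable_fun setT f ->
  measurable_fun setT (fun w => `|f w| `^ q).
Proof.
move=> mf; apply: (@measurableT_comp _ _ _ _ _ _ (@powR R ^~ q)) => //.
exact: measurableT_comp.
Qed.

Lemma LnormE q f : Lp q f -> 'N[P]_q%:E[EFin \o f]%E = (nrm q f)%:E.
Proof.
move=> [mf If]; rewrite unlock /nrm -poweR_EFin -integral_EFin_fine//.
Qed.

Lemma Lfun_Lp (q : R) (f : T -> R) : 0 < q -> f \in Lfun P q%:E -> Lp q f.
Proof.
move=> q0; rewrite inE => /andP[/[!inE]/= mf]; rewrite /finite_norm unlock => fin.
split=> //; apply: ge0_rintegrable.
- exact: measurable_norm_powR.
- by move=> w; exact: powR_ge0.
have := lty_poweRy _ fin; rewrite invr_eq0 gt_eqF// => /(_ isT).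
by [].
Qed.

Lemma hoelder_real p q f g : 0 < p -> 0 < q -> p^-1 + q^-1 = 1 ->
  Lp p f -> Lp q g ->
  rintegrable P (fun w => f w * g w) /\
  `|\int[P]_w (f w * g w)| <= nrm p f * nrm q g.
Proof.
move=> p0 q0 pq Lf Lg; have [[mf If] [mg Ig]] := (Lf, Lg).
have := hoelder P mf mg p0 q0 pq.
rewrite (LnormE Lf) (LnormE Lg) Lnorm1 -EFinM => H.
have mfg : measurable_fun setT (fun w => f w * g w) by exact: measurable_funM.
have Ifg : rintegrable P (fun w => f w * g w).
  apply/integrableP; split; first by apply/measurable_EFinP.
  by apply: le_lt_trans H _; exact: ltry.
split=> //; rewrite -lee_fin; apply: le_trans H.
rewrite -abse_EFin -integral_EFin_fine//.
by apply: le_abse_integral => //; apply/measurable_EFinP.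
Qed.

Lemma le_nrm p q f : 1 <= p -> p <= q -> Lp q f -> Lp p f /\ nrm p f <= nrm q f.
Proof.
move=> p1; rewrite le_eqVlt => /predU1P[<-//|pq] Lf; have [mf If] := Lf.
have p0 : 0 < p by lra.
have q0 : 0 < q by lra.
pose r := q / p; pose r' := (1 - r^-1)^-1.
have r1 : 1 < r by rewrite ltr_pdivlMr// mul1r.
have r0 : 0 < r by lra.
have rV : r^-1 < 1 by rewrite invf_lt1.
have r'0 : 0 < r' by rewrite invr_gt0 subr_gt0.
have rr' : r^-1 + r'^-1 = 1 by rewrite invrK; lra.
have E w : `| `|f w| `^ p | `^ r = `|f w| `^ q.
  by rewrite ger0_norm ?powR_ge0// -powRrM /r mulrC divfK// gt_eqF.
have Lf' : Lp r (fun w => `|f w| `^ p).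
  split; first exact: measurable_norm_powR.
  by under eq_fun do rewrite E.
have L1 : Lp r' (fun=> 1).
  by split=> //; under eq_fun do rewrite normr1 powR1; exact: rintegrable_cst.
have [I1 H] := hoelder_real r0 r'0 rr' Lf' L1.
have If' : rintegrable P (fun w => `|f w| `^ p).
  by move: I1; apply: eq_integrable => // w _ /=; rewrite mulr1.
split; first by split.
have i0 : 0 <= \int[P]_w (`|f w| `^ p) by apply: rintegral_ge0 => w; exact: powR_ge0.
have n1 : nrm r' (fun=> 1) = 1.
  rewrite /nrm (_ : (fun w => _) = fun=> 1); last first.
    by apply/funext => w; rewrite normr1 powR1.
  by rewrite rintegral_cst powR1.
have nf : nrm r (fun w => `|f w| `^ p) = (\int[P]_w (`|f w| `^ q)) `^ r^-1.
  by rewrite /nrm (_ : (fun w => _) = (fun w => `|f w| `^ q))//; apply/funext => w; exact: E.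
have H1 : \int[P]_w (`|f w| `^ p) <= (\int[P]_w (`|f w| `^ q)) `^ r^-1.
  rewrite -nf -[leRHS]mulr1 -n1; apply: le_trans H.
  apply: le_trans (ler_norm _); rewrite le_eqVlt; apply/orP; left; apply/eqP.
  by apply: eq_Rintegral => w _; rewrite mulr1.
rewrite /nrm.
have -> : (\int[P]_w (`|f w| `^ q)) `^ q^-1 = ((\int[P]_w (`|f w| `^ q)) `^ r^-1) `^ p^-1.
  rewrite -powRrM; congr (_ `^ _); rewrite /r invf_div.
  by field; rewrite !gt_eqF.
apply: ge0_ler_powR; last exact: H1.
- by rewrite invr_ge0 ltW.
- by rewrite nnegrE.
- by rewrite nnegrE; exact: powR_ge0.
Qed.

Lemma minkowski_real q f g : 1 <= q -> Lp q f -> Lp q g ->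
  Lp q (fun w => f w + g w) ->
  nrm q (fun w => f w + g w) <= nrm q f + nrm q g.
Proof.
move=> q1 Lf Lg Lfg; have [[mf If] [mg Ig]] := (Lf, Lg).
have := minkowski_EFin P mf mg q1.
by rewrite !LnormE// -EFinD lee_fin.
Qed.

Definition all_moments (f : T -> R) := measurable_fun setT f /\
  forall n, rintegrable P (fun w => `|f w| ^+ n).

Lemma all_momentsM f g : all_moments f -> all_moments g ->
  all_moments (fun w => f w * g w).
Proof.
move=> [mf If] [mg Ig]; split=> [|n]; first exact: measurable_funM.
apply: le_rintegrable (rintegrableD (If (n * 2)%N) (Ig (n * 2)%N)).
  apply: measurable_funX; apply: measurableT_comp => //; exact: measurable_funM.
move=> w /=; rewrite normrX normr_id normrM exprMn !exprM.
move: (`|f w| ^+ n) (`|g w| ^+ n) => x y.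
by have := sqr_ge0 (x - y); have := sqr_ge0 x; have := sqr_ge0 y; nra.
Qed.

Lemma all_momentsD f g : all_moments f -> all_moments g ->
  all_moments (fun w => f w + g w).
Proof.
move=> [mf If] [mg Ig]; split=> [|n]; first exact: measurable_funD.
apply: le_rintegrable (rintegrableZ (2 ^+ n) (rintegrableD (If n) (Ig n))).
  apply: measurable_funX; apply: measurableT_comp => //; exact: measurable_funD.
move=> w /=; rewrite normrX normr_id.
have D := ler_normD (f w) (g w).
apply: (@le_trans _ _ ((`|f w| + `|g w|) ^+ n)).
  by rewrite lerXn2r ?nnegrE ?addr_ge0.
have [fg|gf] := leP `|f w| `|g w|.
  apply: (@le_trans _ _ ((2 * `|g w|) ^+ n)).
    by rewrite lerXn2r ?nnegrE ?addr_ge0 ?mulr_ge0//; lra.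
  by rewrite exprMn ler_wpM2l ?exprn_ge0// lerDr exprn_ge0.
apply: (@le_trans _ _ ((2 * `|f w|) ^+ n)).
  by rewrite lerXn2r ?nnegrE ?addr_ge0 ?mulr_ge0//; lra.
by rewrite exprMn ler_wpM2l ?exprn_ge0// lerDl exprn_ge0.
Qed.

Lemma all_moments_cst c : all_moments (fun=> c).
Proof. by split=> // n; exact: rintegrable_cst. Qed.

Lemma all_moments_sum (I : Type) (s : seq I) (F : I -> T -> R) :
  (forall i, all_moments (F i)) -> all_moments (fun w => \sum_(i <- s) F i w).
Proof.
move=> HF; elim: s => [|i s IH].
  by under eq_fun do rewrite big_nil; exact: all_moments_cst.
by under eq_fun do rewrite big_cons; exact: all_momentsD.
Qed.

Lemma all_moments_expR (X : T -> R) : exp_moments P X ->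
  all_moments (fun w => expR (X w)).
Proof.
move=> [mX IX]; split=> [|n]; first exact: measurableT_comp.
have := IX n%:R; apply: eq_integrable => // w _ /=.
by rewrite ger0_norm ?expR_ge0// expRM_natl.
Qed.

Lemma all_moments_Lp q f : 0 < q -> all_moments f -> Lp q f.
Proof.
move=> q0 [mf If]; split=> //.
have [n qn] : exists n : nat, q <= n%:R.
  by exists (Num.bound q); rewrite ltW// archi_boundP// ltW.
apply: le_rintegrable (rintegrableD (rintegrable_cst P 1) (If n)).
  exact: measurable_norm_powR.
move=> w /=; rewrite ger0_norm ?powR_ge0//.
have [f1|f1] := leP `|f w| 1.
  rewrite -[leLHS]addr0 lerD ?exprn_ge0//.
  have [->|f0] := eqVneq (f w) 0; first by rewrite normr0 powR0// gt_eqF.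
  rewrite -[leRHS](powRr0 `|f w|); apply: ger_powR; last exact: ltW.
  by rewrite normr_gt0 f0.
rewrite -[leLHS]add0r lerD// -powR_mulrn//.
by apply: ler_powR => //; exact: ltW.
Qed.

Lemma all_moments_L2 f : all_moments f -> L2 P f.
Proof.
move=> [mf /(_ 2%N) If]; split=> //.
by move: If; apply: eq_integrable => // w _ /=; rewrite real_normK ?num_real.
Qed.

Lemma all_moments_integrable f : all_moments f -> rintegrable P f.
Proof.
move=> [mf /(_ 1%N) If]; apply: le_rintegrable If => // w; rewrite expr1.
Qed.

End real_norm.

Section exponential_span.
Context d (T : measurableType d) (R : realType) (P : probability T R).

Definition expspan (V : (T -> R) -> Prop) (f : T -> R) :=
  exists (I : finType) (X : I -> T -> R) (a : I -> R),
    (forall i, V (X i)) /\ f = fun w => \sum_i a i * expR (X i w).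

Variable V : (T -> R) -> Prop.
Hypothesis gV : gaussian_space P V.

Let momV X : V X -> exp_moments P X /\ L2 P X.
Proof. by have [h _ _ _] := gV; exact: h. Qed.

Lemma wick_sum_all_moments (I : finType) (X : I -> T -> R) (c : I -> R) t :
  (forall i, V (X i)) -> all_moments P (wick_sum P X c t).
Proof.
move=> VX; apply: all_moments_sum => i.
apply: all_momentsM; first exact: all_moments_cst.
have -> : wick P X t i =
    fun w => expR (t * X i w) * expR (- (t ^+ 2 * dotP P (X i) (X i) / 2)).
  by apply/funext => w; rewrite -expRD.
apply: all_momentsM; last exact: all_moments_cst.
apply: all_moments_expR.
by have [] := momV (gaussian_spaceZ gV t (VX i)).
Qed.

Lemma wick_norm_le (I : finType) (X : I -> T -> R) (c : I -> R) (j : nat) (q : R) :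
  (forall i, V (X i)) -> 0 < q -> q^-1 + (2 ^ j.+1)%:R^-1 = 1 ->
  wick_norm P X c (2^-1 ^+ j ^+ 2) <= nrm P q (wick_sum P X c 1) ^+ 2.
Proof.
move=> VX q0 qp; set e := 2^-1 ^+ j; set N := wick_norm _ _ _ _.
have N0 : 0 <= N by exact: (wick_norm_ge0 gV).
set p : R := (2 ^ j.+1)%:R in qp.
have p0 : 0 < p by rewrite ltr0n expn_gt0.
have [_ EN] := wick_sum_pairing gV c VX (e ^+ 2).
have A1 := wick_sum_all_moments c 1 VX.
have At := wick_sum_all_moments c (e ^+ 2) VX.
have [_] := hoelder_real q0 p0 qp (all_moments_Lp q0 A1) (all_moments_Lp p0 At).
rewrite EN (ger0_norm N0) => H.
have M := wick_sum_moment gV c VX j.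
have HN : nrm P p (wick_sum P X c (e ^+ 2)) <= Num.sqrt N.
  rewrite /nrm.
  have -> : (fun w => `|wick_sum P X c (e ^+ 2) w| `^ p) =
      (fun w => wick_sum P X c (e ^+ 2) w ^+ (2 ^ j.+1)).
    apply/funext => w; rewrite powR_mulrn// expnS !exprM.
    by rewrite real_normK// num_real.
  have -> : Num.sqrt N = (N ^+ (2 ^ j)) `^ p^-1.
    rewrite -powR_mulrn// -powRrM -powR12_sqrt//; congr (_ `^ _).
    rewrite /p expnS natrM; field.
    by rewrite pnatr_eq0 expn_eq0.
  apply: ge0_ler_powR; last exact: M.
  - by rewrite invr_ge0 ltW.
  - rewrite nnegrE; apply: rintegral_ge0 => w; rewrite expnS exprM.
    by rewrite exprn_ge0// sqr_ge0.
  - by rewrite nnegrE exprn_ge0.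
have n0 := nrm_ge0 P q (wick_sum P X c 1).
have H2 : N <= nrm P q (wick_sum P X c 1) * Num.sqrt N.
  by apply: (le_trans H); rewrite ler_wpM2l.
have [s0|s0] := eqVneq (Num.sqrt N) 0.
  by move: H2; rewrite s0 mulr0 => /le_trans; apply; exact: sqr_ge0.
have sp : 0 < Num.sqrt N by rewrite lt_def s0 sqrtr_ge0.
have NE : N = Num.sqrt N * Num.sqrt N by rewrite -expr2 sqr_sqrtr.
have H3 : Num.sqrt N <= nrm P q (wick_sum P X c 1).
  by rewrite -(ler_pM2r sp) -NE.
by rewrite NE expr2 ler_pM// ltW.
Qed.

Variables V1 V2 : (T -> R) -> Prop.
Hypotheses (gV1 : gaussian_space P V1) (gV2 : gaussian_space P V2).
Hypotheses (V1V : forall X, V1 X -> V X) (V2V : forall X, V2 X -> V X).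
Variable rho : R.
Hypothesis rho0 : 0 <= rho.
Hypothesis V12 : forall X Y, V1 X -> V2 Y ->
  `|dotP P X Y| <= rho * Num.sqrt (dotP P X X) * Num.sqrt (dotP P Y Y).

Lemma block_psd (I J : finType) (X : I -> T -> R) (Y : J -> T -> R) :
  (forall i, V1 (X i)) -> (forall j, V2 (Y j)) ->
  psd (block (fun i i' => dotP P (X i) (X i')) (fun j j' => dotP P (Y j) (Y j'))
    (fun i j => dotP P (X i) (Y j)) rho).
Proof.
move=> VX VY.
have LX i : L2 P (X i) by have [] := momV (V1V (VX i)).
have LY j : L2 P (Y j) by have [] := momV (V2V (VY j)).
split=> [[i|j] [i'|j']|v] /=; rewrite 1?dotPC//.
pose A w := \sum_i v (inl i) * X i w; pose B w := \sum_j v (inr j) * Y j w.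
have VA : V1 A by exact: (gaussian_space_sum gV1 _ _ VX).
have VB : V2 B by exact: (gaussian_space_sum gV2 _ _ VY).
rewrite big_sumType/=.
under eq_bigr do rewrite big_sumType/=.
under [X in _ + X]eq_bigr do rewrite big_sumType/=.
rewrite !big_split/=.
have -> : \sum_i \sum_i0 v (inl i) * v (inl i0) * (rho * dotP P (X i) (X i0)) =
    rho * dotP P A A.
  rewrite dotP_sum// big_distrr/=; apply: eq_bigr => i _; rewrite big_distrr/=.
  by apply: eq_bigr => i' _; ring.
have -> : \sum_j \sum_j0 v (inr j) * v (inr j0) * (rho * dotP P (Y j) (Y j0)) =
    rho * dotP P B B.
  rewrite dotP_sum// big_distrr/=; apply: eq_bigr => i _; rewrite big_distrr/=.
  by apply: eq_bigr => i' _; ring.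
have -> : \sum_i \sum_j v (inl i) * v (inr j) * dotP P (X i) (Y j) = dotP P A B.
  by rewrite dotP_sum.
have -> : \sum_j \sum_i v (inr j) * v (inl i) * dotP P (X i) (Y j) = dotP P A B.
  rewrite dotP_sum// exchange_big/=; apply: eq_bigr => i _; apply: eq_bigr => j _.
  by rewrite (mulrC (v (inr j))).
have q0 Z : 0 <= dotP P Z Z by apply: rintegral_ge0 => w; rewrite -expr2 sqr_ge0.
have := V12 VA VB; set a := Num.sqrt _; set b := Num.sqrt _.
have -> : dotP P A A = a ^+ 2 by rewrite sqr_sqrtr.
have -> : dotP P B B = b ^+ 2 by rewrite sqr_sqrtr.
rewrite ler_norml => /andP[h _].
have := mulr_ge0 rho0 (sqr_ge0 (a - b)).
by move: (dotP P A B) h => z h; nra.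
Qed.

Lemma wick_covariance (I J : finType) (X : I -> T -> R) (Y : J -> T -> R)
    (c : I -> R) (b : J -> R) :
  (forall i, V1 (X i)) -> (forall j, V2 (Y j)) ->
  \int[P]_w (wick_sum P X c 1 w * wick_sum P Y b 1 w) =
  \sum_i \sum_j c i * b j * expR (dotP P (X i) (Y j)).
Proof.
move=> VX VY.
pose Z (k : I + J) := match k with inl i => X i | inr j => Y j end.
have VZ k : V (Z k) by case: k => k /=; [exact: V1V|exact: V2V].
have PW i j := prod_wick gV VZ [:: true; false] (fun=> 1)
  (fun t : bool => if t then inl i else inr j).
transitivity (\int[P]_w (\sum_i \sum_j c i * b j *
    \prod_(t <- [:: true; false]) wick P Z 1 (if t then inl i else inr j) w)).
  apply: eq_Rintegral => w _; rewrite /wick_sum big_distrl/=; apply: eq_bigr => i _.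
  rewrite big_distrr/=; apply: eq_bigr => k _.
  by rewrite !big_cons big_nil mulr1 /wick/=; ring.
have I1 i j : rintegrable P (fun w => c i * b j *
    \prod_(t <- [:: true; false]) wick P Z 1 (if t then inl i else inr j) w).
  by apply: rintegrableZ; have [] := PW i j.
rewrite rintegral_sum => [|i]; last exact: rintegrable_sum.
apply: eq_bigr => i _; rewrite rintegral_sum//; apply: eq_bigr => j _.
have [I2 E2] := PW i j.
rewrite rintegralZ// E2; congr (_ * expR _).
by rewrite !big_cons !big_nil/= (dotPC P (Y j) (X i)); field.
Qed.

Lemma expspan_wick (W : (T -> R) -> Prop) f : expspan W f ->
  exists (I : finType) (X : I -> T -> R) (c : I -> R),
    (forall i, W (X i)) /\ f = wick_sum P X c 1.
Proof.
move=> [n [X [a [WX ->]]]]; exists n, X.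
exists (fun i => a i * expR (dotP P (X i) (X i) / 2)); split=> //.
apply/funext => w; apply: eq_bigr => i _.
rewrite /wick -mulrA -expRD; congr (_ * expR _); ring.
Qed.

Lemma expspan_all_moments f : expspan V f -> all_moments P f.
Proof.
move=> /expspan_wick[n [X [c [VX ->]]]]; exact: wick_sum_all_moments.
Qed.

Lemma expspan_covariance (j : nat) (q : R) f g :
  0 < q -> q^-1 + (2 ^ j.+1)%:R^-1 = 1 -> rho <= 2^-1 ^+ j ^+ 2 ->
  expspan V1 f -> expspan V2 g ->
  2 * `|\int[P]_w (f w * g w) - \int[P]_w f w * \int[P]_w g w| <=
  rho / 2^-1 ^+ j ^+ 2 * (nrm P q f ^+ 2 + nrm P q g ^+ 2).
Proof.
move=> q0 qp rj /expspan_wick[n [X [c [VX ->]]]] /expspan_wick[m [Y [b [VY ->]]]].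
have VXV i : V (X i) by exact: V1V.
have VYV i : V (Y i) by exact: V2V.
have LX i : L2 P (X i) by have [] := momV (VXV i).
have LY i : L2 P (Y i) by have [] := momV (VYV i).
rewrite wick_covariance//.
have [_ ->] := wick_sum_mean gV c VXV 1; have [_ ->] := wick_sum_mean gV b VYV 1.
have -> : \sum_i \sum_j0 c i * b j0 * expR (dotP P (X i) (Y j0)) - (\sum_i c i) * (\sum_i b i) =
    \sum_i \sum_k c i * b k * (expR (dotP P (X i) (Y k)) - 1).
  rewrite big_distrl/= -sumrB; apply: eq_bigr => i _.
  rewrite big_distrr/= -sumrB; apply: eq_bigr => k _; ring.
set e := 2^-1 ^+ j ^+ 2 in rj *.
have e0 : 0 < e by rewrite /e !exprn_gt0.
have B := exponential_covariance_bound c b rho0 e0 rj (block_psd VX VY)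
  (dotP_psd LX) (dotP_psd LY).
apply: (le_trans B); rewrite ler_wpM2l ?divr_ge0 ?(ltW e0)// lerD//.
  exact: (wick_norm_le c VXV q0 qp).
exact: (wick_norm_le b VYV q0 qp).
Qed.

End exponential_span.

(** * Density of exponentials *)

Section moment_closure.
Context d (T : measurableType d) (R : realType) (P : probability T R).

Lemma all_moments_le (f g : T -> R) : measurable_fun setT f -> all_moments P g ->
  (forall w, `|f w| <= g w) -> all_moments P f.
Proof.
move=> mf [mg Ig] fg; split=> // n; apply: le_rintegrable (Ig n).
  by apply: measurable_funX; exact: measurableT_comp.
move=> w; rewrite normrX normr_id lerXn2r ?nnegrE//.
exact: le_trans (fg w) (ler_norm _).
Qed.

Variable V : (T -> R) -> Prop.
Hypothesis gV : gaussian_space P V.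

Lemma expspan_cst c : expspan V (fun=> c).
Proof.
have [_ _ V0 _] := gV.
exists unit, (fun _ _ => 0), (fun=> c); split=> //.
by apply/funext => w; rewrite (bigD1 tt)//= big1 ?addr0 ?expR0 ?mulr1// => -[].
Qed.

Lemma expspanD f g : expspan V f -> expspan V g -> expspan V (fun w => f w + g w).
Proof.
move=> [I [X [a [VX ->]]]] [J [Y [b [VY ->]]]].
exists (I + J)%type, (fun k => match k with inl i => X i | inr j => Y j end),
  (fun k => match k with inl i => a i | inr j => b j end); split; first by case.
by apply/funext => w; rewrite big_sumType.
Qed.

Lemma expspanM f g : expspan V f -> expspan V g -> expspan V (fun w => f w * g w).
Proof.
have [_ _ _ VD] := gV.
move=> [I [X [a [VX ->]]]] [J [Y [b [VY ->]]]].
exists (I * J)%type, (fun k w => X k.1 w + Y k.2 w), (fun k => a k.1 * b k.2); split.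
  move=> k; have := VD 1 _ _ (VX k.1) (VY k.2).
  by under eq_fun do rewrite mul1r.
apply/funext => w; rewrite big_distrl/= (eq_bigr (fun i => \sum_j (a i * b j) * expR (X i w + Y j w))).
  by rewrite pair_big.
move=> i _; rewrite big_distrr/=; apply: eq_bigr => j _.
by rewrite expRD; ring.
Qed.

(* All moments at once, so that the closure is stable under products. *)
Definition moment_closure (f : T -> R) := all_moments P f /\
  forall (n : nat) (e : R), 0 < e ->
    exists2 a, expspan V a & \int[P]_w (`|f w - a w| ^+ n.+1) <= e.

Let mom f : expspan V f -> all_moments P f.
Proof. exact: (expspan_all_moments gV). Qed.

Let momN f : all_moments P f -> all_moments P (fun w => - f w).
Proof.
move=> /(all_momentsM (all_moments_cst P (-1))).
by under eq_fun do rewrite mulN1r.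
Qed.

Lemma all_momentsB f g : all_moments P f -> all_moments P g ->
  all_moments P (fun w => f w - g w).
Proof. by move=> Mf /momN; exact: all_momentsD. Qed.

Lemma expspan_closure f : expspan V f -> moment_closure f.
Proof.
move=> Vf; split=> [|n e e0]; first exact: mom.
exists f => //; rewrite (_ : (fun w => _) = fun=> 0) ?rintegral_cst ?ltW//.
by apply/funext => w; rewrite subrr normr0 expr0n.
Qed.

Lemma moment_closure_cst c : moment_closure (fun=> c).
Proof. exact/expspan_closure/expspan_cst. Qed.

Lemma norm_exprD_le (x y : R) n : `|x + y| ^+ n <= 2 ^+ n * (`|x| ^+ n + `|y| ^+ n).
Proof.
apply: (@le_trans _ _ ((`|x| + `|y|) ^+ n)).
  by rewrite lerXn2r ?nnegrE ?addr_ge0 ?ler_normD.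
have [fg|gf] := leP `|x| `|y|.
  apply: (@le_trans _ _ ((2 * `|y|) ^+ n)).
    by rewrite lerXn2r ?nnegrE ?addr_ge0 ?mulr_ge0//; lra.
  by rewrite exprMn ler_wpM2l ?exprn_ge0// lerDr exprn_ge0.
apply: (@le_trans _ _ ((2 * `|x|) ^+ n)).
  by rewrite lerXn2r ?nnegrE ?addr_ge0 ?mulr_ge0//; lra.
by rewrite exprMn ler_wpM2l ?exprn_ge0// lerDl exprn_ge0.
Qed.

Lemma integral_norm_exprD_le f g n : all_moments P f -> all_moments P g ->
  \int[P]_w (`|f w + g w| ^+ n) <=
  2 ^+ n * (\int[P]_w (`|f w| ^+ n) + \int[P]_w (`|g w| ^+ n)).
Proof.
move=> Mf Mg; have [_ Ifg] := all_momentsD Mf Mg.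
have [[_ If] [_ Ig]] := (Mf, Mg).
rewrite -rintegralD// -rintegralZ; last exact: rintegrableD.
apply: le_rintegral => //; first by apply: rintegrableZ; exact: rintegrableD.
by move=> w; exact: norm_exprD_le.
Qed.

Lemma moment_closureD f g : moment_closure f -> moment_closure g ->
  moment_closure (fun w => f w + g w).
Proof.
move=> [Mf Hf] [Mg Hg]; split=> [|n e e0]; first exact: all_momentsD.
have e'0 : 0 < e / (2 ^+ n.+1 * 2) by rewrite divr_gt0// mulr_gt0// exprn_gt0.
have [a Va Ha] := Hf n _ e'0; have [b Vb Hb] := Hg n _ e'0.
exists (fun w => a w + b w); first exact: expspanD.
rewrite (_ : (fun w => _) = (fun w => `|(f w - a w) + (g w - b w)| ^+ n.+1)); last first.
  by apply/funext => w; congr (`|_| ^+ _); ring.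
apply: (le_trans (integral_norm_exprD_le _ _ _)).
- exact: all_momentsB Mf (mom Va).
- exact: all_momentsB Mg (mom Vb).
apply: (@le_trans _ _ (2 ^+ n.+1 * (e / (2 ^+ n.+1 * 2) + e / (2 ^+ n.+1 * 2)))).
  by rewrite ler_wpM2l ?exprn_ge0// lerD.
rewrite le_eqVlt; apply/orP; left; apply/eqP; field.
by rewrite expf_neq0.
Qed.

Lemma integral_normM_le f g n : all_moments P f -> all_moments P g ->
  \int[P]_w (`|f w * g w| ^+ n) <=
  Num.sqrt (\int[P]_w (`|f w| ^+ (n * 2))) * Num.sqrt (\int[P]_w (`|g w| ^+ (n * 2))).
Proof.
move=> [mf If] [mg Ig].
have L (h : T -> R) : measurable_fun setT h -> (forall n, rintegrable P (fun w => `|h w| ^+ n)) ->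
    L2 P (fun w => `|h w| ^+ n).
  move=> mh Ih; split; first by apply: measurable_funX; exact: measurableT_comp.
  by under eq_fun do rewrite -exprM.
have := cauchy_schwarz_norm (L _ mf If) (L _ mg Ig).
under [X in _ <= Num.sqrt X * _]eq_Rintegral do rewrite -exprM.
under [X in _ <= _ * Num.sqrt X]eq_Rintegral do rewrite -exprM.
apply: le_trans; apply: le_trans (ler_norm _).
by under eq_Rintegral do rewrite normrM exprMn.
Qed.

Lemma moment_closureM f g : moment_closure f -> moment_closure g ->
  moment_closure (fun w => f w * g w).
Proof.
move=> [Mf Hf] [Mg Hg]; split=> [|n e e0]; first exact: all_momentsM.
pose k := e / (2 ^+ n.+1 * 2).
have k0 : 0 < k by rewrite divr_gt0// mulr_gt0// exprn_gt0.
have small h : all_moments P h -> exists2 r : R, 0 < r &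
    forall x, 0 <= x -> x <= r ->
    Num.sqrt x * Num.sqrt (\int[P]_w (`|h w| ^+ (n.+1 * 2))) <= k.
  move=> Mh; set S := Num.sqrt _; have S0 : 0 <= S by exact: sqrtr_ge0.
  exists ((k / (S + 1)) ^+ 2) => [|x x0 xr].
    by rewrite exprn_gt0// divr_gt0// ltr_wpDl.
  have : Num.sqrt x <= k / (S + 1).
    have := ler_wsqrtr xr; rewrite sqrtr_sqr ger0_norm//.
    by rewrite divr_ge0 ?(ltW k0)// addr_ge0.
  have S1 : 0 < S + 1 by rewrite ltr_wpDl.
  rewrite ler_pdivlMr// => H; apply: le_trans H.
  by rewrite ler_wpM2l ?sqrtr_ge0// lerDl.
have [r r0 Hr] := small _ Mg.
have nE : (n.+1 * 2 = (n.*2).+2)%N by rewrite muln2 doubleS.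
have [a Va Ha] := Hf (n.*2).+1 _ r0; rewrite -nE in Ha.
have [s s0 Hs] := small _ (mom Va).
have [b Vb Hb] := Hg (n.*2).+1 _ s0; rewrite -nE in Hb.
exists (fun w => a w * b w); first exact: expspanM.
have Mfa := all_momentsB Mf (mom Va); have Mgb := all_momentsB Mg (mom Vb).
rewrite (_ : (fun w => _) = (fun w => `|(f w - a w) * g w + (g w - b w) * a w| ^+ n.+1)); last first.
  by apply/funext => w; congr (`|_| ^+ _); ring.
apply: (le_trans (integral_norm_exprD_le _ _ _)).
- exact: all_momentsM Mfa Mg.
- exact: all_momentsM Mgb (mom Va).
apply: (@le_trans _ _ (2 ^+ n.+1 * (k + k))); last first.
  rewrite /k le_eqVlt; apply/orP; left; apply/eqP; field.
  by rewrite expf_neq0.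
rewrite ler_wpM2l ?exprn_ge0// lerD//.
  apply: (le_trans (integral_normM_le _ Mfa Mg)); apply: Hr => //.
  by apply: rintegral_ge0 => w; rewrite exprn_ge0.
apply: (le_trans (integral_normM_le _ Mgb (mom Va))); apply: Hs => //.
by apply: rintegral_ge0 => w; rewrite exprn_ge0.
Qed.

Lemma moment_closure_lim (f_ : nat -> T -> R) (f g : T -> R) :
  (forall n, moment_closure (f_ n)) -> all_moments P g ->
  measurable_fun setT f -> (forall w, f_ n w @[n --> \oo] --> f w) ->
  (forall n w, `|f_ n w| <= g w) -> moment_closure f.
Proof.
move=> Hf Mg mf fc fg.
have fle w : `|f w| <= g w.
  have C1 : `|f_ n w| @[n --> \oo] --> `|f w| by exact: cvg_norm (fc w).
  have C2 : g w @[_ --> \oo] --> g w by exact: cvg_cst.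
  apply: (ler_cvg_to C1 C2).
  by apply: nearW => n; exact: fg.
have Mf : all_moments P f by exact: all_moments_le Mg fle.
have Mfn n : all_moments P (f_ n) by have [] := Hf n.
split=> // n e e0.
have e'0 : 0 < e / (2 ^+ n.+1 * 2) by rewrite divr_gt0// mulr_gt0// exprn_gt0.
have [_ I2g] : all_moments P (fun w => 2 * g w).
  by apply: all_momentsM => //; exact: all_moments_cst.
have mfn k : measurable_fun setT (fun w => `|f w - f_ k w| ^+ n.+1).
  have [mk _] := Mfn k.
  by apply: measurable_funX; apply: measurableT_comp => //; exact: measurable_funB.
have C : \int[P]_w (`|f w - f_ k w| ^+ n.+1) @[k --> \oo] --> (0 : R).
  rewrite -[X in _ --> X](rintegral_cst P 0).
  have m0 : measurable_fun setT (fun _ : T => 0 : R) by exact: measurable_cst.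
  apply: (rintegral_dominated_convergence mfn m0 _ (I2g n.+1)).
  - move=> w; rewrite -[X in _ --> X](expr0n _ n.+1).
    apply: cvgn_exp; rewrite -[X in _ --> X](@normr0 _ R) -(subrr (f w)).
    by apply: cvg_norm; apply: cvgB => //; exact: cvg_cst.
  - move=> k w; rewrite normrX normr_id lerXn2r ?nnegrE//.
    apply: (le_trans (ler_normB _ _)); apply: le_trans (ler_norm _).
    have := fg k w; have := fle w; lra.
have [k Hk] : exists k, \int[P]_w (`|f w - f_ k w| ^+ n.+1) <= e / (2 ^+ n.+1 * 2).
  move/cvgr0_norm_le : C => /(_ _ e'0) [N _ HN]; exists N.
  exact: le_trans (ler_norm _) (HN N (leqnn N)).
have [a Va Ha] := (Hf k).2 n _ e'0.
exists a => //.
rewrite (_ : (fun w => _) = (fun w => `|(f w - f_ k w) + (f_ k w - a w)| ^+ n.+1)); last first.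
  by apply/funext => w; congr (`|_| ^+ _); ring.
apply: (le_trans (integral_norm_exprD_le _ _ _)).
- exact: all_momentsB.
- exact: all_momentsB (Mfn k) (mom Va).
apply: (@le_trans _ _ (2 ^+ n.+1 * (e / (2 ^+ n.+1 * 2) + e / (2 ^+ n.+1 * 2)))).
  by rewrite ler_wpM2l ?exprn_ge0// lerD.
rewrite le_eqVlt; apply/orP; left; apply/eqP; field.
by rewrite expf_neq0.
Qed.

End moment_closure.

Section moment_closure_sigma.
Context d (T : measurableType d) (R : realType) (P : probability T R).
Variable V : (T -> R) -> Prop.
Hypothesis gV : gaussian_space P V.
Local Notation closed := (moment_closure P V).

Let momV X : V X -> exp_moments P X.
Proof. by have [h _ _ _] := gV => /h[]. Qed.

Lemma closure_sum (I : Type) (s : seq I) (F : I -> T -> R) :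
  (forall i, closed (F i)) -> closed (fun w => \sum_(i <- s) F i w).
Proof.
move=> HF; elim: s => [|i s IH].
  by under eq_fun do rewrite big_nil; exact: moment_closure_cst.
by under eq_fun do rewrite big_cons; exact: moment_closureD.
Qed.

Lemma closureX f n : closed f -> closed (fun w => f w ^+ n).
Proof.
move=> Hf; elim: n => [|n IH].
  by under eq_fun do rewrite expr0; exact: moment_closure_cst.
by under eq_fun do rewrite exprS; exact: moment_closureM.
Qed.

Lemma closureZ c f : closed f -> closed (fun w => c * f w).
Proof. by move=> Hf; apply: moment_closureM => //; exact: moment_closure_cst. Qed.

Lemma all_moments_expR_abs X t : V X -> 0 <= t ->
  all_moments P (fun w => expR (t * `|X w|)).
Proof.
move=> /momV MX t0; have [mX _] := MX; split=> [|n].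
  by apply: measurableT_comp => //; apply: measurable_funM => //; exact: measurableT_comp.
have := rintegrable_expR_abs MX (mulr_ge0 (ler0n R n) t0).
apply: eq_integrable => // w _ /=.
by rewrite [`|expR _|]ger0_norm ?expR_ge0// -expRM_natl mulrA.
Qed.

(* The derivative at the origin of [h |-> expR (h * X)]. *)
Lemma closure_gaussian X : V X -> closed X.
Proof.
move=> VX; have [mX _] := momV VX.
pose h (n : nat) : R := n.+1%:R^-1.
have h0 n : 0 < h n by rewrite invr_gt0.
have h1 n : h n <= 1 by rewrite invf_le1// ler1n.
have hc : h n @[n --> \oo] --> (0 : R) by exact: cvg_harmonic.
pose f n w := (expR (h n * X w) - 1) / h n.
apply: (@moment_closure_lim _ _ _ _ _ gV f X (fun w => expR (2 * `|X w|))) => //.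
- move=> n; rewrite /f; under eq_fun do rewrite mulrC.
  apply: closureZ; apply: moment_closureD => //; last exact: moment_closure_cst.
  apply: (expspan_closure gV); exists unit, (fun _ w => h n * X w), (fun=> 1).
  split; first by move=> _; exact: (gaussian_spaceZ gV).
  by apply/funext => w; rewrite (bigD1 tt)//= big1 ?addr0 ?mul1r// => -[].
- exact: all_moments_expR_abs.
- by move=> w; apply: cvg_expR_slope => //; exact: cvg_cst.
- move=> n w; rewrite /f normrM normfV (gtr0_norm (h0 n)).
  rewrite ler_pdivrMr//; apply: (le_trans (norm_expR_sub1 _)).
  rewrite normrM (gtr0_norm (h0 n)) -mulrA [leRHS]mulrC ler_wpM2l ?(ltW (h0 n))//.
  rewrite (_ : 2 * `|X w| = `|X w| + `|X w|); last by ring.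
  rewrite expRD ler_pM ?expR_ge0 ?norm_le_expR//.
  by rewrite ler_expR ler_piMl.
Qed.

Lemma norm_series_sin_le (y : R) n : `|series (sin_coeff y) n| <= expR `|y|.
Proof.
apply: (@le_trans _ _ (series (exp_coeff `|y|) n)).
  apply: (le_trans (ler_norm_sum _ _ _)); apply: ler_sum => i _.
  rewrite /sin_coeff /exp_coeff/= !normrM normrX normrX normrN1 expr1n mulr1.
  rewrite normfV [`|i`!%:R|]ger0_norm// ler_wpM2r// ler_piMl ?exprn_ge0//.
  by case: (odd i); rewrite ?normr1 ?normr0.
apply: nondecreasing_cvgn_le; last exact: is_cvg_series_exp_coeff.
apply: nondecreasing_series => i _ _.
by rewrite /exp_coeff/= divr_ge0// exprn_ge0.
Qed.

Lemma closure_sin X (t c : R) : V X -> closed (fun w => sin (t * X w - c)).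
Proof.
move=> VX; have [mX _] := momV VX.
have my : measurable_fun setT (fun w => t * X w - c).
  by apply: measurable_funB => //; exact: measurable_funM.
apply: (@moment_closure_lim _ _ _ _ _ gV (fun n w => series (sin_coeff (t * X w - c)) n) _
   (fun w => expR `|c| * expR (`|t| * `|X w|))).
- move=> n; rewrite /series/= /sin_coeff/=.
  apply: closure_sum => i; under eq_fun do rewrite mulrAC.
  apply: moment_closureM => //; first exact: moment_closure_cst.
  apply: closureX; apply: moment_closureD => //; last exact: moment_closure_cst.
  by apply: closureZ; exact: closure_gaussian.
- apply: all_momentsM; first exact: all_moments_cst.
  exact: all_moments_expR_abs.
- by apply: measurableT_comp => //; apply: continuous_measurable_fun; exact: continuous_sin.
- move=> w; rewrite unlock; exact: is_cvg_series_sin_coeff.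
- move=> n w; apply: (le_trans (norm_series_sin_le _ _)).
  rewrite -expRD ler_expR; apply: (le_trans (ler_normB _ _)).
  by rewrite normrM addrC.
Qed.

(* The iterates converge to [Num.sg y] for [`|y| <= 1], through polynomials. *)
Definition sharpen (y : R) : R := (3 * y - y ^+ 3) / 2.

Lemma iter_sharpen_bound n (y : R) : `|y| <= 1 -> `|iter n sharpen y| <= 1.
Proof.
move=> y1; elim: n => //= n; move: (iter n sharpen y) => z.
rewrite /sharpen !ler_norml => /andP[z1 z2]; apply/andP; split.
  by have := sqr_ge0 (z + 1); nra.
by have := sqr_ge0 (z - 1); nra.
Qed.

Lemma iter_sharpenN n (y : R) : iter n sharpen (- y) = - iter n sharpen y.
Proof. by elim: n => //= n ->; rewrite /sharpen; ring. Qed.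

Lemma cvg_iter_sharpen (y : R) : `|y| <= 1 ->
  iter n sharpen y @[n --> \oo] --> Num.sg y.
Proof.
have pos (x : R) : 0 < x -> x <= 1 -> iter n sharpen x @[n --> \oo] --> (1 : R).
  move=> x0 x1.
  have B n : x <= iter n sharpen x <= 1 /\ 1 - iter n sharpen x <= (1 - x / 2) ^+ n.
    elim: n => [|n [/andP[IH1 IH2] IH3]].
      by rewrite /= lexx x1 expr0; split=> //; lra.
    rewrite iterS exprS; move: (iter n sharpen x) IH1 IH2 IH3 => z z1 z2 z3.
    have z0 : 0 < z by lra.
    have E : 1 - sharpen z = (1 - z) * ((1 - z) * (2 + z) / 2).
      by rewrite /sharpen; field.
    have sz : z <= sharpen z.
      rewrite -subr_ge0 (_ : _ - _ = z * (1 - z) * (1 + z) / 2); last first.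
        by rewrite /sharpen; field.
      by rewrite divr_ge0// !mulr_ge0//; lra.
    have sz1 : 0 <= 1 - sharpen z by rewrite E !mulr_ge0//; lra.
    split; first by apply/andP; split; lra.
    rewrite E mulrC ler_pM//; [|lra|].
      by rewrite divr_ge0// mulr_ge0//; lra.
    by nra.
  apply: (@squeeze_cvgr _ _ _ _ (fun n => 1 - (1 - x / 2) ^+ n) (fun=> 1)).
  - by apply: nearW => n; have [/andP[_ ->] h] := B n; rewrite andbT; lra.
  - rewrite -[X in _ --> X]subr0; apply: cvgB; first exact: cvg_cst.
    by apply: cvg_expr; rewrite ger0_norm; lra.
  - exact: cvg_cst.
rewrite ler_norml => /andP[y1 y2].
have [y0|y0|<-] := ltgtP 0 y.
- by rewrite gtr0_sg//; exact: pos.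
- rewrite ltr0_sg// -[y]opprK; under eq_fun do rewrite iter_sharpenN.
  by apply: cvgN; apply: pos; lra.
- rewrite sgr0; under eq_fun => n.
    have -> : iter n sharpen 0 = 0.
      by elim: n => //= n ->; rewrite /sharpen expr0n mulr0 subr0 mul0r.
    over.
  exact: cvg_cst.
Qed.

Lemma bounded_closure_lim (f_ : nat -> T -> R) (f : T -> R) (M : R) :
  (forall n, closed (f_ n)) ->
  (forall w, f_ n w @[n --> \oo] --> f w) ->
  (forall n w, `|f_ n w| <= M) -> closed f.
Proof.
move=> Hf fc fM.
apply: (moment_closure_lim gV Hf (all_moments_cst P M)) => //.
apply: (measurable_fun_cvg (h := f_)) => // n.
by have [[]] := Hf n.
Qed.

Lemma closure_sg_sin X (t c : R) : V X -> closed (fun w => Num.sg (sin (t * X w - c))).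
Proof.
move=> VX; pose f n w := iter n sharpen (sin (t * X w - c)).
have sin1 w : `|sin (t * X w - c)| <= 1.
  by rewrite ler_norml sin_geN1 sin_le1.
apply: (@bounded_closure_lim f _ 1).
- elim=> [|n IH]; first exact: closure_sin.
  rewrite /f; under eq_fun do rewrite iterS /sharpen mulrC.
  apply: closureZ; apply: moment_closureD => //; first exact: closureZ.
  under eq_fun do rewrite -mulN1r.
  by apply: closureZ; exact: closureX.
- by move=> w; exact: cvg_iter_sharpen.
- by move=> n w; exact: iter_sharpen_bound.
Qed.

Lemma closure_sg X (c : R) : V X -> closed (fun w => Num.sg (X w - c)).
Proof.
move=> VX; pose h (n : nat) : R := n.+1%:R^-1.
have h0 n : 0 < h n by rewrite invr_gt0.
have hc : h n @[n --> \oo] --> (0 : R) by exact: cvg_harmonic.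
apply: (@bounded_closure_lim (fun n w => Num.sg (sin (h n * X w - h n * c))) _ 1).
- by move=> n; exact: closure_sg_sin.
- move=> w; apply: cvg_near_cst.
  have C : h n * (X w - c) @[n --> \oo] --> (0 : R).
    by rewrite -(mul0r (X w - c)); apply: cvgM => //; exact: cvg_cst.
  move/cvgr0_norm_lt : C => /(_ _ (pi_gt0 R)); apply: filterS => n /=.
  rewrite -mulrBr; move: (X w - c) => y; rewrite ltr_norml => /andP[y1 y2].
  have [y0|y0|<-] := ltgtP 0 y.
  + by rewrite !gtr0_sg// sin_gt0_pi// y2 mulr_gt0.
  + have ny : 0 < h n * (- y) by rewrite mulr_gt0// oppr_gt0.
    rewrite !ltr0_sg// -[h n * y]opprK sinN oppr_lt0 -mulrN sin_gt0_pi// ny/=.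
    by rewrite mulrN ltrNl.
  + by rewrite mulr0 sin0.
- by move=> n w; rewrite normr_sg; case: (_ != _).
Qed.

Lemma closure_indic_ray X (c : R) : V X -> closed (\1_(X @^-1` `]c, +oo[)).
Proof.
move=> VX; have Hs := closure_sg c VX.
have -> : \1_(X @^-1` `]c, +oo[) =
    (fun w => 2^-1 * (Num.sg (X w - c) + Num.sg (X w - c) ^+ 2)) :> (T -> R).
  apply/funext => w; rewrite indicE.
  have -> : (w \in X @^-1` `]c, +oo[) = (c < X w).
    apply/idP/idP => [/set_mem/=|cX]; first by rewrite in_itv/= andbT.
    by apply/mem_set; rewrite /= in_itv/= andbT.
  have [cX|cX|<-] := ltgtP c (X w).
  - by rewrite gtr0_sg ?subr_gt0// /=; field.
  - by rewrite ltr0_sg ?subr_lt0// /=; field.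
  - by rewrite subrr sgr0 /=; field.
by apply: closureZ; apply: moment_closureD => //; exact: closureX.
Qed.

Lemma closure_sigma_algebra : sigma_algebra setT [set A : set T | closed (\1_A)].
Proof.
have cC (A : set T) : closed (\1_A) -> closed (\1_(~` A)).
  move=> HA; rewrite (_ : \1_(~` A) = (fun w => 1 + (-1) * \1_A w) :> (T -> R)).
    by apply: moment_closureD => //; [exact: moment_closure_cst|exact: closureZ].
  apply/funext => w; rewrite !indicE in_setC.
  by case: (w \in A); rewrite /= ?mulr1 ?mulr0 ?subrr ?addr0.
split => /=.
- by rewrite indic0; exact: moment_closure_cst.
- by move=> A; rewrite setTD; exact: cC.
move=> A HA.
pose f n : T -> R := fun w => 1 + (-1) * \prod_(0 <= k < n) \1_(~` A k) w.
apply: (@bounded_closure_lim f _ 1).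
- move=> n; apply: moment_closureD => //; first exact: moment_closure_cst.
  apply: closureZ; elim: n => [|n IH].
    by under eq_fun do rewrite big_nil; exact: moment_closure_cst.
  under eq_fun do rewrite big_nat_recr//=.
  by apply: moment_closureM => //; exact: cC.
- move=> w; have [[k _ Akw]|nA] := pselect ((\bigcup_k A k) w).
    apply: cvg_near_cst; exists k.+1 => // n /= kn.
    rewrite /f indicE mem_set; last by exists k.
    rewrite (big_rem k)/= ?mem_index_iota// indicE memNset ?mul0r ?mulr0 ?addr0//.
  apply: cvg_near_cst; apply: nearW => n; rewrite /f indicE memNset//.
  rewrite big1 ?mulr1 ?subrr// => k _; rewrite indicE mem_set// => Akw.
  by apply: nA; exists k.
- move=> n w; rewrite /f.
  have : 0 <= (\prod_(0 <= k < n) \1_(~` A k) w : R) <= 1.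
    apply/andP; split; first by apply: prodr_ge0 => k _; rewrite indicE.
    by apply: prodr_ile1 => k _; rewrite indicE; case: (_ \in _); rewrite /= ?lexx ?ler01.
  by move: (\prod_(0 <= k < n) _) => p /andP[p0 p1]; rewrite ler_norml; lra.
Qed.

End moment_closure_sigma.

Section closure_measurable.
Context d (T : measurableType d) (R : realType) (P : probability T R).
Variable V : (T -> R) -> Prop.
Hypothesis gV : gaussian_space P V.
Local Notation closed := (moment_closure P V).

Import HBNNSimple.

Lemma closure_g_sigma (S : set (set T)) (A : set T) :
  (forall B, S B -> closed (\1_B)) -> <<s S >> A -> closed (\1_A).
Proof.
move=> SC; have sub : <<s S >> `<=` [set A : set T | closed (\1_A)].
  by apply: smallest_sub => //; exact: (closure_sigma_algebra gV).
exact: sub.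
Qed.

Lemma closure_preimage X (B : set R) : V X -> measurable B -> closed (\1_(X @^-1` B)).
Proof.
move=> VX mB.
have [sC1 sC2 sC3] := closure_sigma_algebra gV.
have sub : <<s @RGenOInfty.G R >> `<=` [set B | closed (\1_(X @^-1` B))].
  apply: smallest_sub; last by move=> _ /= [c ->]; exact: (closure_indic_ray gV).
  split => /=.
  - by rewrite preimage_set0.
  - by move=> C HC; have := sC2 _ HC; rewrite !setTD preimage_setC.
  - by move=> C HC; rewrite preimage_bigcup; exact: sC3.
apply: sub.
have E : measurable B = <<s @RGenOInfty.G R >> B :=
  congr1 (fun S => S B) (@RGenOInfty.measurableE R).
exact: (eq_ind _ id mB _ E).
Qed.

Lemma closure_bounded (S : set (set T)) (F : T -> R) (M : R) :
  (forall B, S B -> closed (\1_B)) -> measurable_wrt S F ->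
  (forall w, `|F w| <= M) -> closed F.
Proof.
move=> SC mF FM; pose T' : measurableType _ := g_sigma_algebraType S.
have FM0 w : 0 <= F w + M by have := FM w; rewrite ler_norml; lra.
pose g : T' -> \bar R := fun w => (F w + M)%:E.
have mg : measurable_fun [set: T'] g.
  by apply/measurable_EFinP; apply: measurable_funD.
pose h := nnsfun_approx measurableT mg.
have HT : closed (fun w => F w + M).
  apply: (@bounded_closure_lim _ _ _ _ _ gV (fun n w => h n w) _ (2 * M)).
  - move=> n; under eq_fun => w do rewrite fimfunE fsbig_finite//.
    apply: (closure_sum gV) => y; apply: (closureZ gV).
    apply: closure_g_sigma SC _.
    exact: (measurable_sfunP (h n)).
  - move=> w; have : EFin \o (h ^~ w) @ \oo --> g w 
      by apply: (cvg_nnsfun_approx measurableT mg _ I) => x _; rewrite lee_fin.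
    by move=> /fine_cvg.
  - move=> n w; rewrite ger0_norm//.
    have := le_approx (f := g) n (fun x _ => FM0 x) (I : setT w).
    rewrite -(nnsfun_approxE measurableT mg) lee_fin => /le_trans; apply.
    by have := FM w; rewrite ler_norml; lra.
have := moment_closureD gV HT (moment_closure_cst gV (- M)).
by under [X in moment_closure _ _ X -> _]eq_fun do rewrite addrK.
Qed.

End closure_measurable.

(** * Covariance of Gaussian functionals *)

Section covariance_closure.
Context d (T : measurableType d) (R : realType) (P : probability T R).

Lemma ler_addgt0_mul (x y M : R) :
  (forall e, 0 < e -> e <= 1 -> x <= y + e * M) -> x <= y.
Proof.
move=> h; apply/ler_addgt0Pl => e e0.
have M0 : 0 < `|M| + 1 + e by have := normr_ge0 M; lra.
have := h (e / (`|M| + 1 + e)) (divr_gt0 e0 M0).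
rewrite ler_pdivrMr// mul1r => h'; apply: le_trans (h' _) _.
  by have := normr_ge0 M; lra.
rewrite addrC lerD2r mulrAC ler_pdivrMr// ler_wpM2l ?(ltW e0)//.
by have := ler_norm M; lra.
Qed.

(* Optimization over [t] of a bound applied to the pair [t f], [t^-1 g]. *)
Lemma mean_le_scaled (c x y K : R) : 0 <= x -> 0 <= y -> 0 <= K ->
  (forall t, 0 < t -> 2 * c <= K * ((t * x) ^+ 2 + (t^-1 * y) ^+ 2)) -> c <= K * x * y.
Proof.
move=> x0 y0 K0 h; apply: (@ler_addgt0_mul _ _ (K * (x + y + 1))) => e e0 e1.
have xe : 0 < x + e by lra.
have ye : 0 < y + e by lra.
have t0 : 0 < (y + e) / (x + e) by exact: divr_gt0.
have := h (Num.sqrt ((y + e) / (x + e))); rewrite sqrtr_gt0 => /(_ t0).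
rewrite !exprMn exprVn sqr_sqrtr ?(ltW t0)// invf_div.
have h1 : (y + e) / (x + e) * x ^+ 2 <= (y + e) * (x + e).
  rewrite -mulrA ler_wpM2l ?(ltW ye)// ler_pdivrMl//.
  have := mulr_ge0 x0 (ltW e0); have := mulr_ge0 (ltW e0) (ltW e0); nra.
have h2 : (x + e) / (y + e) * y ^+ 2 <= (y + e) * (x + e).
  rewrite mulrAC -mulrA [leRHS]mulrC ler_wpM2l ?(ltW xe)// ler_pdivrMr//.
  by nra.
move=> h3.
have : 2 * c <= K * ((y + e) * (x + e) + (y + e) * (x + e)).
  by apply: le_trans h3 _; rewrite ler_wpM2l// lerD.
have : K * (e * e) <= K * e by rewrite ler_wpM2l// ler_piMl// ltW.
by nra.
Qed.

Lemma covariance_sqr_slack (k e x y X Y A c a b c' : R) :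
  e * e <= e -> k * (e * e) <= k * e ->
  a <= 2 * e * Y -> b <= 2 * e * (X + e) -> 2 * c' <= A ->
  A <= k * ((x + e) ^+ 2 + (y + e) ^+ 2) -> c <= a + b + c' ->
  2 * c <= k * (x ^+ 2 + y ^+ 2) + e * (k * (2 * x + 2 * y + 2) + 4 * (Y + X + 1)).
Proof. by lra. Qed.

Lemma nrm2E (f : T -> R) : nrm P 2 f = Num.sqrt (\int[P]_w (f w ^+ 2)).
Proof.
rewrite /nrm powR12_sqrt; last by apply: rintegral_ge0 => w; exact: powR_ge0.
congr (Num.sqrt _); apply: eq_Rintegral => w _.
by rewrite powR_mulrn// real_normK ?num_real.
Qed.

Lemma nrm_distrC q (f g : T -> R) :
  nrm P q (fun w => f w - g w) = nrm P q (fun w => g w - f w).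
Proof. by rewrite /nrm; under eq_Rintegral do rewrite distrC. Qed.

Lemma nrmZ q c (f : T -> R) : 0 < q -> 0 <= c -> Lp P q f ->
  Lp P q (fun w => c * f w) /\ nrm P q (fun w => c * f w) = c * nrm P q f.
Proof.
move=> q0 c0 [mf If].
have E w : `|c * f w| `^ q = c `^ q * `|f w| `^ q.
  by rewrite normrM (ger0_norm c0) powRM.
split; first split.
- exact: measurable_funM.
- under [X in rintegrable _ X]eq_fun do rewrite E.
  exact: rintegrableZ.
- rewrite /nrm; under eq_Rintegral do rewrite E.
  rewrite rintegralZ// powRM ?powR_ge0//; last first.
    by apply: rintegral_ge0 => w; exact: powR_ge0.
  by rewrite -powRrM divff ?gt_eqF// powRr1.
Qed.

Definition cov (f g : T -> R) : R := \int[P]_w (f w * g w) - \int[P]_w f w * \int[P]_w g w.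

Lemma covC f g : cov f g = cov g f.
Proof. by rewrite /cov [X in _ - X]mulrC; under eq_Rintegral do rewrite mulrC. Qed.

Lemma covB f f' g : all_moments P f -> all_moments P f' -> all_moments P g ->
  cov (fun w => f w - f' w) g = cov f g - cov f' g.
Proof.
move=> Mf Mf' Mg; rewrite /cov; under eq_Rintegral do rewrite mulrBl.
rewrite !rintegralB//; try exact: all_moments_integrable.
- by rewrite mulrBl; lra.
- by apply: all_moments_integrable; exact: all_momentsM.
- by apply: all_moments_integrable; exact: all_momentsM.
Qed.

Lemma norm_mean_le_nrm2 f : all_moments P f -> `|\int[P]_w f w| <= nrm P 2 f.
Proof.
move=> Mf; have := cauchy_schwarz_norm (all_moments_L2 Mf) (all_moments_L2 (all_moments_cst P 1)).
under eq_Rintegral do rewrite mulr1.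
by rewrite rintegral_cst expr1n sqrtr1 mulr1 nrm2E.
Qed.

Lemma norm_cov_le_nrm2 f g : all_moments P f -> all_moments P g ->
  `|cov f g| <= 2 * nrm P 2 f * nrm P 2 g.
Proof.
move=> Mf Mg; apply: (le_trans (ler_normB _ _)).
rewrite -mulrA mulr_natl mulr2n lerD//; first by rewrite !nrm2E cauchy_schwarz_norm//; exact: all_moments_L2.
by rewrite normrM ler_pM// norm_mean_le_nrm2.
Qed.

Variable V : (T -> R) -> Prop.
Hypothesis gV : gaussian_space P V.
Variables V1 V2 : (T -> R) -> Prop.
Hypotheses (gV1 : gaussian_space P V1) (gV2 : gaussian_space P V2).
Hypotheses (V1V : forall X, V1 X -> V X) (V2V : forall X, V2 X -> V X).
Variable rho : R.
Hypothesis rho0 : 0 <= rho.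
Hypothesis V12 : forall X Y, V1 X -> V2 Y ->
  `|dotP P X Y| <= rho * Num.sqrt (dotP P X X) * Num.sqrt (dotP P Y Y).
Variables (j : nat) (q : R).
Hypotheses (q1 : 1 <= q) (q2 : q <= 2) (qp : q^-1 + (2 ^ j.+1)%:R^-1 = 1).
Hypothesis rho_le : rho <= 2^-1 ^+ j ^+ 2.
Let K := rho / 2^-1 ^+ j ^+ 2.

Let K0 : 0 <= K.
Proof. by rewrite divr_ge0// sqr_ge0. Qed.

Let q0 : 0 < q.
Proof. exact: lt_le_trans q1. Qed.

Lemma closure_approx W f e : gaussian_space P W -> 0 < e -> moment_closure P W f ->
  exists2 f', expspan W f' &
    [/\ all_moments P f', nrm P 2 (fun w => f w - f' w) <= e & nrm P q f' <= nrm P q f + e].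
Proof.
move=> gW e0 [Mf Hf]; have [f' Wf' fe] := Hf 1%N (e ^+ 2) (exprn_gt0 _ e0).
have Mf' := expspan_all_moments gW Wf'.
have H2 : nrm P 2 (fun w => f w - f' w) <= e.
  rewrite nrm2E -(ger0_norm (ltW e0)) -sqrtr_sqr ler_sqrt ?sqr_ge0//.
  apply: le_trans fe; rewrite le_eqVlt; apply/orP; left; apply/eqP.
  by apply: eq_Rintegral => w _; rewrite real_normK ?num_real.
exists f' => //; split=> //.
have Mff : all_moments P (fun w => f' w - f w) by exact: all_momentsB.
have L (h : T -> R) : all_moments P h -> Lp P q h by exact: all_moments_Lp.
have := minkowski_real q1 (L _ Mf) (L _ Mff).
rewrite (_ : (fun w => f w + (f' w - f w)) = f'); last first.
  by apply/funext => w; rewrite addrC subrK.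
move=> /(_ (L _ Mf')) /le_trans; apply; rewrite lerD2l.
have [_ H3] := le_nrm q1 q2 (all_moments_Lp (ltr0n R 2) Mff).
rewrite [X in _ <= X]nrm_distrC in H3.
exact: (le_trans H3 H2).
Qed.

Local Opaque nrm cov.

Lemma closure_covariance_sqr f g :
  moment_closure P V1 f -> moment_closure P V2 g ->
  2 * `|cov f g| <= K * (nrm P q f ^+ 2 + nrm P q g ^+ 2).
Proof.
move=> Cf Cg; have [[Mf _] [Mg _]] := (Cf, Cg).
set x := nrm P q f; set y := nrm P q g.
have x0 : 0 <= x by exact: nrm_ge0.
have y0 : 0 <= y by exact: nrm_ge0.
set X := nrm P 2 f; set Y := nrm P 2 g.
apply: (@ler_addgt0_mul _ _ (K * (2 * x + 2 * y + 2) + 4 * (Y + X + 1))) => e e0 e1.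
have [f' Vf' [Mf' Hf1 Hf2]] := closure_approx gV1 e0 Cf.
have [g' Vg' [Mg' Hg1 Hg2]] := closure_approx gV2 e0 Cg.
have H1 : `|cov f g - cov f' g| <= 2 * e * Y.
  rewrite -covB//; apply: (le_trans (norm_cov_le_nrm2 _ Mg)).
    exact: all_momentsB.
  exact: (ler_wpM2r (nrm_ge0 P 2 g) (ler_wpM2l (ler0n R 2) Hf1)).
have Xf' : nrm P 2 f' <= X + e.
  have Mff : all_moments P (fun w => f' w - f w) by exact: all_momentsB.
  have L (h : T -> R) : all_moments P h -> Lp P 2 h by exact: all_moments_Lp.
  have := minkowski_real (ler1n R 2) (L _ Mf) (L _ Mff).
  rewrite (_ : (fun w => f w + (f' w - f w)) = f'); last first.
    by apply/funext => w; rewrite addrC subrK.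
  move=> /(_ (L _ Mf')) H3; rewrite nrm_distrC in Hf1.
  exact: (le_trans H3 (lerD (lexx _) Hf1)).
have H2 : `|cov f' g - cov f' g'| <= 2 * e * (X + e).
  rewrite covC [cov f' g']covC -covB//; apply: (le_trans (norm_cov_le_nrm2 _ Mf')).
    exact: all_momentsB.
  exact: (ler_pM (mulr_ge0 (ler0n R 2) (nrm_ge0 P 2 _)) (nrm_ge0 P 2 f') (ler_wpM2l (ler0n R 2) Hg1) Xf').
have H3 := expspan_covariance gV gV1 gV2 V1V V2V rho0 V12 q0 qp rho_le Vf' Vg'.
rewrite -/K in H3.
have H4 : K * (nrm P q f' ^+ 2 + nrm P q g' ^+ 2) <= K * ((x + e) ^+ 2 + (y + e) ^+ 2).
  have sq (a b : R) : 0 <= a -> a <= b -> a ^+ 2 <= b ^+ 2.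
    by move=> a0 ab; rewrite lerXn2r ?nnegrE// (le_trans a0).
  exact: (ler_wpM2l K0 (lerD (sq _ _ (nrm_ge0 P q f') Hf2) (sq _ _ (nrm_ge0 P q g') Hg2))).
have H5 : `|cov f g| <= `|cov f g - cov f' g| + `|cov f' g - cov f' g'| + `|cov f' g'|.
  have tri (a b c : R) : `|a| <= `|a - b| + `|b - c| + `|c|.
    by rewrite -[a in leLHS](subrK b) -[b in X in _ + X](subrK c) addrA
         (le_trans (ler_normD _ _))// lerD2r ler_normD.
  exact: tri.
have ee : e * e <= e by rewrite ler_piMl// ltW.
have Kee : K * (e * e) <= K * e by rewrite ler_wpM2l.
exact: (covariance_sqr_slack ee Kee H1 H2 H3 H4 H5).
Qed.

Lemma closure_covariance f g :
  moment_closure P V1 f -> moment_closure P V2 g ->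
  `|cov f g| <= K * nrm P q f * nrm P q g.
Proof.
move=> Cf Cg; have [[Mf _] [Mg _]] := (Cf, Cg).
apply: mean_le_scaled; rewrite ?nrm_ge0// => t t0.
have ti : 0 <= t^-1 by rewrite invr_ge0 ltW.
have [_ <-] := nrmZ q0 (ltW t0) (all_moments_Lp q0 Mf).
have [_ <-] := nrmZ q0 ti (all_moments_Lp q0 Mg).
apply: le_trans (closure_covariance_sqr (closureZ gV1 t Cf) (closureZ gV2 t^-1 Cg)).
rewrite ler_wpM2l// le_eqVlt; apply/orP; left; apply/eqP; congr `|_|.
Local Transparent cov.
rewrite /cov !rintegralZ ?(all_moments_integrable Mf) ?(all_moments_integrable Mg)//.
have E w : t * f w * (t^-1 * g w) = f w * g w by field; rewrite gt_eqF.
under [in RHS]eq_Rintegral do rewrite E.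
by congr (_ - _); field; rewrite gt_eqF.
Qed.

End covariance_closure.

Section truncation.
Context d (T : measurableType d) (R : realType) (P : probability T R).

Lemma rintegrable_monotone_lim (h_ : nat -> T -> R) (h : T -> R) (B : R) :
  (forall n, rintegrable P (h_ n)) -> measurable_fun setT h ->
  (forall n w, 0 <= h_ n w) -> (forall w, nondecreasing_seq (h_ ^~ w)) ->
  (forall w, h_ n w @[n --> \oo] --> h w) ->
  (forall n, \int[P]_w h_ n w <= B) -> rintegrable P h.
Proof.
move=> Ih mh h0 ndh hc hB.
have H0 w : 0 <= h w.
  rewrite -(cvg_lim _ (hc w))//; apply: limr_ge; first by apply/cvg_ex; exists (h w).
  by near=> n.
have cv : (\int[P]_w (h_ n w)%:E)%E @[n --> \oo] --> (\int[P]_w (h w)%:E)%E.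
  rewrite (_ : (fun w => (h w)%:E) = (fun w => limn (fun n => (h_ n w)%:E))); last first.
    by apply/funext => w; apply/esym/cvg_lim => //; apply: cvg_EFin; [near=> n|exact: hc].
  apply: cvg_monotone_convergence => //.
  - by move=> n; apply/measurable_EFinP; exact: rintegrable_measurable.
  - by move=> n w _; rewrite lee_fin.
  - by move=> w _ n m nm; rewrite lee_fin; exact: ndh.
apply: ge0_rintegrable => //; apply: (@le_lt_trans _ _ B%:E); last exact: ltry.
rewrite -(cvg_lim _ cv)//; apply: lime_le; first by apply/cvg_ex; eexists; exact: cv.
by near=> n; rewrite integral_EFin_fine ?lee_fin.
Unshelve. all: by end_near. Qed.

Lemma nrm_le q (f g : T -> R) : 0 < q -> measurable_fun setT f ->
  (forall w, `|f w| <= `|g w|) -> Lp P q g -> Lp P q f /\ nrm P q f <= nrm P q g.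
Proof.
move=> q0 mf fg [mg Ig].
have fgq w : `|f w| `^ q <= `|g w| `^ q.
  by rewrite ge0_ler_powR ?nnegrE// ltW.
have If : rintegrable P (fun w => `|f w| `^ q).
  apply: le_rintegrable Ig; first exact: measurable_norm_powR.
  by move=> w; rewrite ger0_norm ?powR_ge0.
split; first by split.
rewrite /nrm ge0_ler_powR ?nnegrE ?invr_ge0 ?(ltW q0)//.
- by apply: rintegral_ge0 => w; exact: powR_ge0.
- by apply: rintegral_ge0 => w; exact: powR_ge0.
- exact: le_rintegral.
Qed.

Lemma Lp_mean q (f : T -> R) : 1 <= q -> Lp P q f ->
  rintegrable P (fun w => `|f w|) /\ \int[P]_w `|f w| <= nrm P q f.
Proof.
move=> q1 Lf; have [[mf If]] := le_nrm (lexx 1) q1 Lf.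
have I1 : rintegrable P (fun w => `|f w|).
  by under eq_fun do rewrite -[`|_|]powRr1//.
have -> : nrm P 1 f = \int[P]_w `|f w|.
  rewrite /nrm invr1 powRr1.
    by apply: eq_Rintegral => w _; rewrite powRr1.
  by apply: rintegral_ge0 => w; exact: powR_ge0.
by move=> ->.
Qed.

Lemma measurable_wrt_comp (S : set (set T)) (F : T -> R) (phi : R -> R) :
  measurable_fun setT phi -> measurable_wrt S F -> measurable_wrt S (phi \o F).
Proof. by move=> mphi mF; exact: measurableT_comp. Qed.

Definition truncr (n : nat) (x : R) : R := if `|x| <= n%:R then x else 0.

Lemma measurable_truncr n : measurable_fun setT (truncr n).
Proof.
rewrite (_ : truncr n = fun x => x * \1_`[- n%:R, n%:R]%classic x); last first.
  apply/funext => x; rewrite indicE mem_setE in_itv/= -ler_norml /truncr.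
  by case: ifP; rewrite ?mulr1 ?mulr0.
by apply: measurable_funM => //; exact: measurable_indic.
Qed.

Lemma norm_truncr n x : `|truncr n x| <= n%:R.
Proof. by rewrite /truncr; case: ifP => //; rewrite normr0. Qed.

Lemma norm_truncr_le n x : `|truncr n x| <= `|x|.
Proof. by rewrite /truncr; case: ifP => //; rewrite normr0. Qed.

Lemma norm_truncr_nd x : nondecreasing_seq (fun n => `|truncr n x|).
Proof.
move=> n m nm; rewrite /truncr; case: ifPn => [xn|_]; last by rewrite normr0.
by rewrite ifT// (le_trans xn)// ler_nat.
Qed.

Lemma cvg_truncr x : truncr n x @[n --> \oo] --> x.
Proof.
apply: cvg_near_cst; near=> n; rewrite /truncr ifT//.
have : (Num.bound `|x| <= n)%N by near: n; exact: nbhs_infty_ge.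
rewrite -(ler_nat R); apply: le_trans; apply: ltW.
by apply: archi_boundP.
Unshelve. all: by end_near. Qed.

Variables (S1 S2 : set (set T)) (q K : R).
Hypotheses (q1 : 1 <= q) (K0 : 0 <= K).
Hypothesis bounded_covariance : forall (F G : T -> R) (M : R),
  measurable_fun setT F -> measurable_fun setT G ->
  measurable_wrt S1 F -> measurable_wrt S2 G ->
  (forall w, `|F w| <= M) -> (forall w, `|G w| <= M) ->
  `|cov P F G| <= K * nrm P q F * nrm P q G.

Let q0 : 0 < q. Proof. exact: lt_le_trans q1. Qed.

Lemma bounded_rintegrable (F : T -> R) (M : R) : measurable_fun setT F ->
  (forall w, `|F w| <= M) -> rintegrable P F.
Proof. by move=> mF FM; apply: (le_rintegrable mF FM); exact: rintegrable_cst. Qed.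

Lemma truncation_covariance (F G : T -> R) : Lp P q F -> Lp P q G ->
  measurable_wrt S1 F -> measurable_wrt S2 G ->
  rintegrable P (fun w => F w * G w) /\ `|cov P F G| <= K * nrm P q F * nrm P q G.
Proof.
move=> LF LG SF SG; have [[mF _] [mG _]] := (LF, LG).
pose tr (F : T -> R) n w := truncr n (F w).
have mtr (f : T -> R) n : measurable_fun setT f -> measurable_fun setT (tr f n).
  by move=> mf; apply: measurableT_comp mf; exact: measurable_truncr.
have ntr (f : T -> R) n w : `|tr f n w| <= `|f w| by exact: norm_truncr_le.
have btr (f : T -> R) n w : `|tr f n w| <= n%:R by exact: norm_truncr.
have mn (f : T -> R) : measurable_fun setT f -> measurable_fun setT (fun w => `|f w|).
  by move=> mf; exact: measurableT_comp.
have KF n : nrm P q (tr F n) <= nrm P q F.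
  by have [] := nrm_le q0 (mtr F n mF) (ntr F n) LF.
have KG n : nrm P q (tr G n) <= nrm P q G.
  by have [] := nrm_le q0 (mtr G n mG) (ntr G n) LG.
have [IF HF] := Lp_mean q1 LF; have [IG HG] := Lp_mean q1 LG.
have covle n : `|cov P (tr F n) (tr G n)| <= K * nrm P q F * nrm P q G.
  apply: (@le_trans _ _ (K * nrm P q (tr F n) * nrm P q (tr G n))).
    apply: (bounded_covariance (mtr F n mF) (mtr G n mG) _ _ (btr F n) (btr G n)).
    - by apply: measurable_wrt_comp SF; exact: measurable_truncr.
    - by apply: measurable_wrt_comp SG; exact: measurable_truncr.
  have h := ler_wpM2l K0 (KF n).
  exact: (ler_pM (mulr_ge0 K0 (nrm_ge0 _ _ _)) (nrm_ge0 _ _ _) h (KG n)).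
have nn (f : T -> R) : nrm P q (fun w => `|f w|) = nrm P q f.
  by rewrite /nrm; under eq_Rintegral do rewrite normr_id.
have covabs n : `|cov P (fun w => `|tr F n w|) (fun w => `|tr G n w|)| <= K * nrm P q F * nrm P q G.
  apply: (@le_trans _ _ (K * nrm P q (tr F n) * nrm P q (tr G n))).
    rewrite -(nn (tr F n)) -(nn (tr G n)).
    apply: (bounded_covariance (mn _ (mtr F n mF)) (mn _ (mtr G n mG)) _ _ (M := n%:R)).
    - apply: (measurable_wrt_comp (phi := fun x => `|truncr n x|)) SF.
      by apply: measurableT_comp => //; exact: measurable_truncr.
    - apply: (measurable_wrt_comp (phi := fun x => `|truncr n x|)) SG.
      by apply: measurableT_comp => //; exact: measurable_truncr.
    - by move=> w; rewrite normr_id; exact: btr.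
    - by move=> w; rewrite normr_id; exact: btr.
  have h := ler_wpM2l K0 (KF n).
  exact: (ler_pM (mulr_ge0 K0 (nrm_ge0 _ _ _)) (nrm_ge0 _ _ _) h (KG n)).
have btrM n w : `|tr F n w * tr G n w| <= n%:R * n%:R.
  by rewrite normrM ler_pM.
have cF w : tr F n w @[n --> \oo] --> F w by exact: cvg_truncr.
have cG w : tr G n w @[n --> \oo] --> G w by exact: cvg_truncr.
have cFG w : tr F n w * tr G n w @[n --> \oo] --> F w * G w by apply: cvgM.
have mFG : measurable_fun setT (fun w => F w * G w) by exact: measurable_funM.
have mtrM n : measurable_fun setT (fun w => tr F n w * tr G n w).
  by apply: measurable_funM; exact: mtr.
have IFG : rintegrable P (fun w => `|F w * G w|).
  apply: (@rintegrable_monotone_lim (fun n w => `|tr F n w * tr G n w|) _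
    (K * nrm P q F * nrm P q G + nrm P q F * nrm P q G)) => //.
  - move=> n; apply: (@bounded_rintegrable _ (n%:R * n%:R)); first exact: mn.
    by move=> w; rewrite normr_id.
  - exact: mn.
  - by move=> w n m nm; rewrite !normrM ler_pM//; exact: norm_truncr_nd.
  - by move=> w; exact: cvg_norm.
  - move=> n; have := covabs n; rewrite /cov.
    under eq_Rintegral do rewrite -normrM.
    move=> /ler_normlW; rewrite lerBlDr => /le_trans; apply; rewrite lerD2l.
    have le1 (f : T -> R) : Lp P q f -> measurable_fun setT f ->
        0 <= \int[P]_w `|tr f n w| <= nrm P q f.
      move=> Lf mf; apply/andP; split; first exact: rintegral_ge0.
      have [If] := Lp_mean q1 Lf; apply: le_trans.
      apply: le_rintegral => //; apply: (@bounded_rintegrable _ n%:R).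
        by apply: mn; exact: mtr.
      by move=> w; rewrite normr_id.
    have /andP[hF0 hF1] := le1 F LF mF; have /andP[hG0 hG1] := le1 G LG mG.
    exact: (ler_pM hF0 hG0 hF1 hG1).
split; first by apply: le_rintegrable IFG => // w; rewrite normr_id.
have d1 : \int[P]_w (tr F n w * tr G n w) @[n --> \oo] --> \int[P]_w (F w * G w).
  apply: (rintegral_dominated_convergence (g := fun w => `|F w * G w|)) => //.
  by move=> n w; rewrite !normrM ler_pM.
have d2 : \int[P]_w (tr F n w) @[n --> \oo] --> \int[P]_w (F w).
  by apply: (rintegral_dominated_convergence (g := fun w => `|F w|)) => // n; exact: mtr.
have d3 : \int[P]_w (tr G n w) @[n --> \oo] --> \int[P]_w (G w).
  by apply: (rintegral_dominated_convergence (g := fun w => `|G w|)) => // n; exact: mtr.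
have d4 : `|cov P (tr F n) (tr G n)| @[n --> \oo] --> `|cov P F G|.
  by apply: cvg_norm; apply: cvgB => //; exact: cvgM.
rewrite -(cvg_lim _ d4)//; apply: limr_le; first by apply/cvg_ex; eexists; exact: d4.
by near=> n; exact: covle.
Unshelve. all: by end_near. Qed.

End truncation.

(** * Fractional Brownian motion *)

Section linear_combinations.
Context d (T : measurableType d) (R : realType) (P : probability T R).

Definition lincomb (I : Type) (Y : I -> T -> R) (X : T -> R) :=
  exists s : seq (R * I), X = fun w => \sum_(p <- s) p.1 * Y p.2 w.

Lemma lincomb1 (I : Type) (Y : I -> T -> R) i : lincomb Y (Y i).
Proof.
by exists [:: (1, i)]; apply/funext => w; rewrite big_seq1 mul1r.
Qed.

Lemma lincomb0 (I : Type) (Y : I -> T -> R) : lincomb Y (fun=> 0).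
Proof. by exists [::]; apply/funext => w; rewrite big_nil. Qed.

Lemma lincombZD (I : Type) (Y : I -> T -> R) c X X' :
  lincomb Y X -> lincomb Y X' -> lincomb Y (fun w => c * X w + X' w).
Proof.
move=> [s ->] [s' ->]; exists ([seq (c * p.1, p.2) | p <- s] ++ s').
apply/funext => w; rewrite big_cat big_map/= big_distrr/=; congr (_ + _).
by apply: eq_bigr => p _; rewrite mulrA.
Qed.

Lemma lincomb_sub (I J : Type) (Y : I -> T -> R) (Z : J -> T -> R) X :
  (forall j, lincomb Y (Z j)) -> lincomb Z X -> lincomb Y X.
Proof.
move=> YZ [s ->]; elim: s => [|p s IH].
  by under eq_fun do rewrite big_nil; exact: lincomb0.
by under eq_fun do rewrite big_cons; exact: lincombZD.
Qed.

Lemma gaussian_space_lincomb (I : Type) (Y : I -> T -> R) :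
  (forall X, lincomb Y X -> is_gaussian P X) ->
  (forall i, \int[P]_w Y i w = 0) -> gaussian_space P (lincomb Y).
Proof.
move=> gY Y0.
have L2Y i : L2 P (Y i).
  by have [] := is_gaussian_centered (gY _ (lincomb1 Y i)) (Y0 i).
have IY i : rintegrable P (Y i).
  have := L2M (L2Y i) (all_moments_L2 (all_moments_cst P 1)).
  by under [X in rintegrable _ X]eq_fun do rewrite mulr1.
have X0 X : lincomb Y X -> \int[P]_w X w = 0.
  move=> [s ->]; rewrite rintegral_sum => [|p]; last exact: rintegrableZ.
  by rewrite big1// => p _; rewrite rintegralZ// Y0 mulr0.
split.
- by move=> X YX; have [] := is_gaussian_centered (gY _ YX) (X0 _ YX).
- move=> X YX; have [_ _ /(_ 1)] := is_gaussian_centered (gY _ YX) (X0 _ YX).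
  by under eq_Rintegral do rewrite mul1r; rewrite expr1n mul1r.
- exact: lincomb0.
- by move=> c X X'; exact: lincombZD.
Qed.

End linear_combinations.

Section fractional_brownian_motion.
Context d (T : measurableType d) (R : realType) (P : probability T R).
Variables (H : R) (W : R -> {RV P >-> R}).
Hypotheses (H0 : 0 < H) (H1 : H < 1) (fbmW : is_fbm H W).

Local Notation Wf := (fun t => (W t : T -> R)).

Lemma fbm_mean t : \int[P]_w W t w = 0.
Proof. by have [_ /(_ t) + _] := fbmW; rewrite unlock /Rintegral => ->. Qed.

Lemma fbm_gaussian X : lincomb Wf X -> is_gaussian P X.
Proof.
move=> [s ->]; have [gW _ _] := fbmW.
have := gW (size s) (fun k => (tnth (in_tuple s) k).1) (fun k => (tnth (in_tuple s) k).2).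
rewrite (_ : (fun w => \sum_(p <- s) _) = (fun w => \sum_(k < size s)
  (tnth (in_tuple s) k).1 * W (tnth (in_tuple s) k).2 w))//.
by apply/funext => w; rewrite big_tnth.
Qed.

Lemma gaussian_space_fbm : gaussian_space P (lincomb Wf).
Proof. by apply: gaussian_space_lincomb; [exact: fbm_gaussian|exact: fbm_mean]. Qed.

Lemma L2_fbm t : L2 P (W t).
Proof. by have [h _ _ _] := gaussian_space_fbm; have [] := h _ (lincomb1 Wf t). Qed.

Definition increment (p : R * R) (w : T) : R := W p.2 w - W p.1 w.

Lemma lincomb_increment p : lincomb Wf (increment p).
Proof.
have := lincombZD (-1) (lincomb1 Wf p.1) (lincomb1 Wf p.2).
by under [X in lincomb _ X -> _]eq_fun do rewrite mulN1r addrC.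
Qed.

Lemma gaussian_space_increment (I : Type) (e : I -> R * R) :
  gaussian_space P (lincomb (fun i => increment (e i))).
Proof.
apply: gaussian_space_lincomb => [X|i].
  by move/lincomb_sub => h; apply/fbm_gaussian/h => i; exact: lincomb_increment.
have [h _ _ _] := gaussian_space_fbm.
have IW t : rintegrable P (W t).
  have := L2M (L2_fbm t) (all_moments_L2 (all_moments_cst P 1)).
  by under [X in rintegrable _ X]eq_fun do rewrite mulr1.
by rewrite rintegralB// !fbm_mean subrr.
Qed.

Lemma fbm_covariance_increment : exists2 sigma2 : R, 0 < sigma2 &
  forall p p', \int[P]_w (increment p w * increment p' w) =
    sigma2 / 2 * (`|p.2 - p'.1| `^ (2 * H) + `|p'.2 - p.1| `^ (2 * H)
      - `|p'.2 - p.2| `^ (2 * H) - `|p'.1 - p.1| `^ (2 * H)).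
Proof.
have [_ W0 [sigma2 s0 covW]] := fbmW; exists sigma2 => // p p'.
have E s t : \int[P]_w (W s w * W t w) =
    sigma2 / 2 * (`|s| `^ (2 * H) + `|t| `^ (2 * H) - `|t - s| `^ (2 * H)).
  have := covW s t; rewrite unlock !W0/= unlock => /(congr1 fine)/= <-.
  apply: eq_Rintegral => w _.
  by change (W s w * W t w = (W s w - 0) * (W t w - 0)); rewrite !subr0.
have I s t : rintegrable P (fun w => W s w * W t w) by apply: L2M; exact: L2_fbm.
have IB s t s' : rintegrable P (fun w => W s w * W t w - W s w * W s' w).
  exact: rintegrableB.
under eq_Rintegral do rewrite /increment mulrBl !mulrBr.
rewrite !rintegralB// !E [`|p'.1 - p.2|]distrC.
by move: (_ `^ _) (_ `^ _) (_ `^ _) (_ `^ _) (_ `^ _) (_ `^ _) (_ `^ _) (_ `^ _) => *; ring.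
Qed.

End fractional_brownian_motion.

Lemma gap_ratio_le1 (R : realType) (H t0 t1 t2 : R) : H < 1 -> t0 < t1 ->
  gap_ratio H t0 t1 t2 <= 1 -> t2 - t1 <= t1 - t0.
Proof.
move=> H1 t01; apply: contraTT; rewrite -!ltNge => gap.
have gap1 : 1 < (t2 - t1) / (t1 - t0) by rewrite ltr_pdivlMr ?mul1r// subr_gt0.
have := @gt0_ltr_powR R (1 - H) _ 1 ((t2 - t1) / (t1 - t0)).
rewrite subr_gt0 powR1 => /(_ H1); apply => //.
  by rewrite nnegrE.
by rewrite nnegrE; exact: (le_trans ler01 (ltW gap1)).
Qed.

Lemma increments_decorrelation (R : realType) (H : R) : 0 < H -> H < 1 ->
  exists2 C : R, 0 < C &
  forall d (T : measurableType d) (P : probability T R) (W : R -> {RV P >-> R}),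
  is_fbm H W -> forall t0 t1 t2, t0 < t1 -> t1 < t2 -> gap_ratio H t0 t1 t2 <= 1 ->
  forall (I J : Type) (e : I -> R * R) (e' : J -> R * R),
  (forall i, (e i).1 <= t0 /\ (e i).2 <= t0) ->
  (forall j, t1 <= (e' j).1 <= t2 /\ t1 <= (e' j).2 <= t2) ->
  forall X Y, lincomb (fun i => increment W (e i)) X ->
    lincomb (fun j => increment W (e' j)) Y ->
  `|dotP P X Y| <= C * gap_ratio H t0 t1 t2 *
     Num.sqrt (dotP P X X) * Num.sqrt (dotP P Y Y).
Proof.
move=> H0 H1; pose a := H - 2^-1.
have a_gt : - 2^-1 < a by rewrite /a; lra.
have a_lt : a < 2^-1 by rewrite /a; lra.
have aE : 2 * a + 1 = 2 * H by rewrite /a; field.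
have aE' : 2^-1 - a = 1 - H by rewrite /a; field.
have [C C0 HC] := ksum_decorrelation a_gt a_lt; exists C => //.
move=> d T P W fbmW t0 t1 t2 t01 t12 gap I J e e' He He'.
have [sigma2 s0 covW] := fbm_covariance_increment fbmW.
have f0 := fvar_gt0 a_gt a_lt; pose k := sigma2 / fvar a.
have k0 : 0 < k by exact: divr_gt0.
have L2i p : L2 P (increment W p).
  by apply: L2B; exact: (L2_fbm fbmW).
have dotE (I1 I2 : Type) (e1 : I1 -> R * R) (e2 : I2 -> R * R)
    (s1 : seq (R * I1)) (s2 : seq (R * I2)) :
    dotP P (fun w => \sum_(p <- s1) p.1 * increment W (e1 p.2) w)
           (fun w => \sum_(p <- s2) p.1 * increment W (e2 p.2) w) =
    k * \int[lebesgue_measure]_x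
      (ksum a s1 (fun p => p.1) (fun p => (e1 p.2).1) (fun p => (e1 p.2).2) x *
       ksum a s2 (fun p => p.1) (fun p => (e2 p.2).1) (fun p => (e2 p.2).2) x).
  rewrite (dotP_sum _ _ (fun p => p.1) (fun p => p.1)) // rintegral_sumM; last 2 first.
  - by move=> i; exact: L2_fker.
  - by move=> i; exact: L2_fker.
  rewrite big_distrr/=; apply: eq_bigr => p _; rewrite big_distrr/=; apply: eq_bigr => p' _.
  rewrite integral_fkerM// /dotP covW aE [RHS]mulrCA; congr (_ * _).
  by rewrite mulrA; congr (_ * _); rewrite /k; field; rewrite gt_eqF.
move=> X Y [s ->] [s' ->]; rewrite !dotE.
have := HC t0 t1 t2 t01 t12 (gap_ratio_le1 H1 t01 gap) _ _ s (fun p => p.1)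
  (fun p => (e p.2).1) (fun p => (e p.2).2) s' (fun p => p.1)
  (fun p => (e' p.2).1) (fun p => (e' p.2).2) (fun p => He p.2) (fun p => He' p.2).
under [X in Num.sqrt X]eq_Rintegral do rewrite expr2.
under [X in _ * _ * Num.sqrt X]eq_Rintegral do rewrite expr2.
rewrite aE' -/(gap_ratio H t0 t1 t2).
have scale (z x y g : R) : `|z| <= g * Num.sqrt x * Num.sqrt y ->
    `|k * z| <= g * Num.sqrt (k * x) * Num.sqrt (k * y).
  move=> zxy; rewrite !(sqrtrM _ (ltW k0)) normrM (gtr0_norm k0).
  rewrite (_ : g * _ * _ = k * (g * Num.sqrt x * Num.sqrt y)); last first.
    by rewrite -[in RHS](sqr_sqrtr (ltW k0)) expr2; ring.
  by rewrite ler_wpM2l// ltW.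
exact: scale.
Qed.

Section increments_closure.
Context d (T : measurableType d) (R : realType) (P : probability T R).
Variables (H : R) (W : R -> {RV P >-> R}) (s t : \bar R).
Hypothesis fbmW : is_fbm H W.

Definition increment_index :=
  {p : R * R | (s < p.1%:E)%E /\ p.1 <= p.2 /\ (p.2%:E < t)%E}.

Definition increment_space := lincomb (fun i : increment_index => increment W (sval i)).

Lemma gaussian_space_increment_space : gaussian_space P increment_space.
Proof. exact: gaussian_space_increment fbmW _ _. Qed.

Lemma increments_sigma_closure (F : T -> R) (M : R) :
  measurable_wrt (increments_sigma W s t) F -> (forall w, `|F w| <= M) ->
  moment_closure P increment_space F.
Proof.
move=> mF FM; apply: (closure_bounded gaussian_space_increment_space _ mF FM) => A.
apply: (closure_g_sigma gaussian_space_increment_space) => B [u [v [su uv vt]]] [D mD <-].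
rewrite setTI; apply: (closure_preimage gaussian_space_increment_space _ mD).
exact: (lincomb1 _ (exist _ (u, v) (conj su (conj uv vt)) : increment_index)).
Qed.

End increments_closure.

(* Hypercontractivity is available for the exponents [2 ^ j.+1] only. *)
Lemma conjugate_exponent (R : realType) (q : R) : 1 < q ->
  exists (j : nat) (r : R), [/\ 1 <= r, r <= 2, r <= q & r^-1 + (2 ^ j.+1)%:R^-1 = 1].
Proof.
move=> q1; have q0 : 0 < q by lra.
have y0 : 0 < 1 - q^-1 by rewrite subr_gt0 invf_lt1.
pose j := Num.bound (1 - q^-1)^-1; pose x : R := (2 ^ j.+1)%:R^-1.
have x0 : 0 < x by rewrite invr_gt0 ltr0n expn_gt0.
have x2 : x <= 2^-1.
  by rewrite lef_pV2 ?posrE ?ltr0n ?expn_gt0// ler_nat expnS leq_pmulr// expn_gt0.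
have xq : x <= 1 - q^-1.
  rewrite -[leRHS]invrK lef_pV2 ?posrE ?ltr0n ?expn_gt0 ?invr_gt0//.
  apply: (@le_trans _ _ j%:R); first by apply/ltW/archi_boundP; rewrite invr_ge0 ltW.
  by rewrite ler_nat ltnW// ltnW// ltn_expl.
have x1 : 0 < 1 - x by lra.
exists j, (1 - x)^-1; split.
- by rewrite invf_ge1; lra.
- by rewrite invf_ple ?posrE//; lra.
- by rewrite invf_ple ?posrE//; lra.
- by rewrite invrK -/x subrK.
Qed.

Lemma fbm_covariance (R : realType) (H q : R) : 0 < H -> H < 1 -> 1 < q ->
  exists eps C : R, [/\ 0 < eps, 0 < C &
    forall d (T : measurableType d) (P : probability T R) (W : R -> {RV P >-> R}),
    is_fbm H W -> forall t0 t1 t2, t0 < t1 -> t1 < t2 -> gap_ratio H t0 t1 t2 <= eps ->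
    forall F G : T -> R, Lp P q F -> Lp P q G ->
      measurable_wrt (increments_sigma W -oo%E t0%:E) F ->
      measurable_wrt (increments_sigma W t1%:E t2%:E) G ->
    rintegrable P (fun w => F w * G w) /\
    `|cov P F G| <= C * gap_ratio H t0 t1 t2 * nrm P q F * nrm P q G].
Proof.
move=> H0 H1 q1; have [C C0 HC] := increments_decorrelation H0 H1.
have [j [r [r1 r2 rq rj]]] := conjugate_exponent q1.
pose delta : R := 2^-1 ^+ j ^+ 2.
have delta0 : 0 < delta by rewrite !exprn_gt0.
have eps0 : 0 < Num.min 1 (delta / C) by rewrite lt_min ltr01 divr_gt0.
exists (Num.min 1 (delta / C)), (C / delta); split=> //; first exact: divr_gt0.
move=> d T P W fbmW t0 t1 t2 t01 t12; rewrite le_min => /andP[gap1 gapd] F G LF LG SF SG.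
have gap0 : 0 <= gap_ratio H t0 t1 t2 by exact: powR_ge0.
have Cgap : 0 <= C * gap_ratio H t0 t1 t2 by rewrite mulr_ge0// ltW.
have Cgapd : C * gap_ratio H t0 t1 t2 <= delta by rewrite -ler_pdivlMl// mulrC.
have K0 : 0 <= C / delta * gap_ratio H t0 t1 t2.
  by rewrite mulr_ge0// divr_ge0// ltW.
apply: (truncation_covariance (ltW q1) K0 _ LF LG SF SG) => f g M mf mg Sf Sg fM gM.
have Cf := increments_sigma_closure fbmW Sf fM.
have Cg := increments_sigma_closure fbmW Sg gM.
have sub a b X : increment_space W a b X -> lincomb (fun t => W t : T -> R) X.
  by apply: lincomb_sub => i; exact: lincomb_increment.
have dec X Y : increment_space W -oo%E t0%:E X -> increment_space W t1%:E t2%:E Y ->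
    `|dotP P X Y| <= C * gap_ratio H t0 t1 t2 *
      Num.sqrt (dotP P X X) * Num.sqrt (dotP P Y Y).
  apply: (HC _ _ _ _ fbmW) => //.
  - move=> [[u v] /= [_ [uv]]]; rewrite lte_fin => vt.
    by split; rewrite ltW//; exact: le_lt_trans vt.
  - move=> [[u v] /= []]; rewrite !lte_fin => ut [uv vt].
    by split; apply/andP; split; apply: ltW => //;
      [exact: le_lt_trans vt|exact: lt_le_trans uv].
have main := closure_covariance (gaussian_space_fbm fbmW)
  (gaussian_space_increment_space _ _ fbmW) (gaussian_space_increment_space _ _ fbmW)
  (sub _ _) (sub _ _) Cgap dec r1 r2 rj Cgapd Cf Cg.
have q0 : 0 < q := lt_trans ltr01 q1.
have Lpb h : moment_closure P (increment_space W -oo%E t0%:E) h \/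
    moment_closure P (increment_space W t1%:E t2%:E) h -> Lp P q h.
  by move=> [[Mh _]|[Mh _]]; exact: all_moments_Lp.
have [_ nf] := le_nrm r1 rq (Lpb f (or_introl Cf)).
have [_ ng] := le_nrm r1 rq (Lpb g (or_intror Cg)).
have KE : C * gap_ratio H t0 t1 t2 / 2^-1 ^+ j ^+ 2 = C / delta * gap_ratio H t0 t1 t2.
  by rewrite mulrAC.
rewrite KE in main.
have h := ler_pM (mulr_ge0 K0 (nrm_ge0 P r f)) (nrm_ge0 P r g) (ler_wpM2l K0 nf) ng.
exact: (le_trans main h).
Qed.

Theorem theoremA1 (R : realType) (H q : R) (H0 : 0 < H) (H1 : H < 1)
    (q1 : 1 < q) :
  exists eps C : R, [/\ 0 < eps, 0 < C &
    forall (d : measure_display) (T : measurableType d) (P : probability T R)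
      (W : R -> {RV P >-> R}), is_fbm H W ->
    forall t0 t1 t2 : R, t0 < t1 -> t1 < t2 ->
    forall F G : {RV P >-> R},
      (F : T -> R) \in Lfun P q%:E -> (G : T -> R) \in Lfun P q%:E ->
      measurable_wrt (increments_sigma W -oo%E t0%:E) F ->
      measurable_wrt (increments_sigma W t1%:E t2%:E) G ->
    gap_ratio H t0 t1 t2 <= eps ->
    P.-integrable [set: T] (EFin \o (F \* G)) /\
    (`| 'E_P[F \* G] - 'E_P[F] * 'E_P[G] | <=
       C%:E * 'N[P]_q%:E[EFin \o F] * 'N[P]_q%:E[EFin \o G]
         * (gap_ratio H t0 t1 t2)%:E)%E].
Proof.
have [eps [C [eps0 C0 HC]]] := fbm_covariance H0 H1 q1.
exists eps, C; split=> // d T P W fbmW t0 t1 t2 t01 t12 F G LF LG SF SG gap.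
have q0 : 0 < q := lt_trans ltr01 q1.
have LpF := Lfun_Lp q0 LF; have LpG := Lfun_Lp q0 LG.
have [IFG covFG] := HC d T P W fbmW t0 t1 t2 t01 t12 gap F G LpF LpG SF SG.
have Lp_integrable (f : T -> R) : Lp P q f -> rintegrable P f.
  by move=> Lf; apply: (le_rintegrable Lf.1 _ (Lp_mean (ltW q1) Lf).1).
have EF : ('E_P[F] = (\int[P]_w F w)%R%:E)%E.
  by rewrite unlock -integral_EFin_fine//; exact: Lp_integrable.
have EG : ('E_P[G] = (\int[P]_w G w)%R%:E)%E.
  by rewrite unlock -integral_EFin_fine//; exact: Lp_integrable.
have EFG : ('E_P[F \* G] = (\int[P]_w (F w * G w))%R%:E)%E.
  by rewrite unlock -integral_EFin_fine.
split; first exact: IFG.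
rewrite EF EG EFG (LnormE LpF) (LnormE LpG).
have comm (c g x y : R) : c * x * y * g = c * g * x * y by ring.
by rewrite -(comm C (gap_ratio H t0 t1 t2)) in covFG; rewrite lee_fin.
Qed.
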